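(* Let $d\ge3$, $T>0$ and $0<\varepsilon<2$. There exists $(u,f)\in\mathcal N(Q_T)$ such that $(u,f)$ satisfies the energy equality on $[0,T]$, $$\tfrac12\|u(t_1)\|_2^2-\tfrac12\|u(t_0)\|_2^2+\int_{t_0}^{t_1}\|\nabla u(t)\|_2^2\,dt=\int_{t_0}^{t_1}\langle u,f\rangle\,dt\quad\text{for all }t_0,t_1\in[0,T],$$ but anomalous dissipation still occurs: $$\lim_{q\to\infty}\Big|\int_{T/2}^T\langle(u\cdot\nabla u)_{\le q},u_{\le q}\rangle\,dt\Big|>0.$$ In addition, $u\in L^3(0,T;B^{\frac13-\varepsilon}_{3,\infty}(\mathbb T^d))$, $u\in L^p(0,T;L^q(\mathbb T^d))$ for any $p,q\in[1,\infty]$ with $\frac2p+\frac2q=1+\varepsilon$, and $f\in L^{2-\varepsilon}(0,T;H^{-1}(\mathbb T^d))$.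
   Context: $\mathbb T^d$ is the $d$-dimensional ($2\pi$-periodic) torus, $Q_T=\mathbb T^d\times(0,T)$, $\langle\cdot,\cdot\rangle$ is the $L^2(\mathbb T^d)$ inner product, $\|\cdot\|_p$ is the $L^p(\mathbb T^d)$ norm. The forced Navier-Stokes equations (NSE) are $\partial_t u-\Delta u+\operatorname{div}(u\otimes u)+\nabla p=f$, $\operatorname{div}u=0$, with velocity $u$, pressure $p$, force $f$. $\mathcal L(0,T)$ is the set of $g\in L^1_{loc}(0,T)$ such that $\lim_{a\to0^+,\,b\to T^-}\int_a^b g\,dt$ exists (as a finite limit); integrals of such $g$ up to the endpoints are understood as these limits. Class $\mathcal N(Q_T)$ (smooth solutions with finite energy input): pairs $(u,f)$ such that (i) $u\in C^\infty(Q_T)\cap L^\infty(0,T;L^2(\mathbb T^d))$ and $f\in C^\infty(Q_T)$; (ii) $u,f$ satisfy the NSE (with some pressure $p$) at every point of $Q_T$; (iii) $\langle u,f\rangle\in\mathcal L(0,T)$; (iv) the limits of $f(t)$ exist in $\mathcal D'(\mathbb T^d)$ as $t\to0^+$ and $t\to T^-$. For $(u,f)\in\mathcal N(Q_T)$ the weak $L^2$ limits of $u(t)$ as $t\to0^+$ and $t\to T^-$ exist, and $u(0)$, $u(T)$ always denote these weak limits. Littlewood-Paley decomposition: fix a radially non-increasing $\chi\in C_c^\infty(\mathbb R^d)$ with $\chi(\xi)=1$ for $|\xi|\le 1/2$ and $\chi(\xi)=0$ for $|\xi|\ge1$, and put $\varphi(\xi)=\chi(\xi/2)-\chi(\xi)$.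 $\Delta_q$ is the Fourier multiplier with symbol $\varphi(2^{-q}\xi)$ for $q\ge0$ and $\chi(\xi)$ for $q=-1$; $u_{\le q}=\sum_{-1\le r\le q}\Delta_r u$, i.e. the multiplier with symbol $\chi(2^{-(q+1)}\xi)$ applied to $u$. The Besov norm is $\|u\|_{B^s_{3,\infty}}=\sup_{q\ge-1}2^{qs}\|\Delta_q u\|_3$. *)

(* Defs.v *)
From HB Require Import structures.
From mathcomp Require Import all_boot all_order all_algebra.
From mathcomp Require Import complex.
From mathcomp Require Import all_classical all_reals all_analysis.
From mathcomp Require Import measurable_realfun.

Set Implicit Arguments.
Unset Strict Implicit.
Unset Printing Implicit Defensive.

Import Order.TTheory GRing.Theory Num.Theory.
Import numFieldNormedType.Exports.

Local Open Scope classical_set_scope.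
Local Open Scope ring_scope.

(* Functions on the 2 pi-periodic torus T^d are represented by 2 pi-periodic
   functions on R^d ('rV[R]_d); functions on Q_T = T^d x (0, T) are curried
   functions of t : R and x : 'rV[R]_d, whose values for t outside of ]0, T[
   are irrelevant. *)

Section torus_measure.
Context {R : realType}.

Lemma lebesgue_circle_lty : (lebesgue_measure `[0%R, (2 * pi)%R : R] < +oo)%E.
Proof. by rewrite lebesgue_measure_itv/=; case: ifP => // _; rewrite -EFinD ltry. Qed.

Definition circle_measure : {finite_measure set (measurableTypeR R) -> \bar R} :=
  @mfrestr _ (measurableTypeR R) R _ lebesgue_measure (measurable_itv _)
    lebesgue_circle_lty.

Definition tcons n (x : R * n.-tuple R) :
  n.+1.-tuple R := [tuple of x.1 :: x.2].

Lemma measurable_tcons n : measurable_fun setT (@tcons n).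
Proof. exact: measurable_cons. Qed.

Section step.
Variables (n : nat)
  (m : {finite_measure set (n.-tuple R) -> \bar R}).

Definition torus_measure_step := pushforward (circle_measure \x m)%E (@tcons n).

Let step0 : torus_measure_step set0 = 0%E.
Proof. by rewrite /torus_measure_step /pushforward preimage_set0 measure0. Qed.

Let step_ge0 A : (0 <= torus_measure_step A)%E.
Proof. by rewrite /torus_measure_step /pushforward measure_ge0. Qed.

Let step_sigma_additive : semi_sigma_additive torus_measure_step.
Proof.
move=> F mF tF mUF; rewrite /torus_measure_step /pushforward preimage_bigcup.
apply: measure_semi_sigma_additive.
- by move=> k; rewrite -[X in measurable X]setTI; exact: measurable_tcons.
- apply/trivIsetP => /= i j _ _ ij; rewrite -preimage_setI.
  by move/trivIsetP : tF => /(_ _ _ _ _ ij) ->//; rewrite preimage_set0.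
- by rewrite -preimage_bigcup -[X in measurable X]setTI; exact: measurable_tcons.
Qed.

HB.instance Definition _ := isMeasure.Build _ _ _
  torus_measure_step step0 step_ge0 step_sigma_additive.

Let step_fin : fin_num_fun torus_measure_step.
Proof.
move=> U mU; rewrite ge0_fin_numE//.
apply: (@le_lt_trans _ _ (torus_measure_step setT)).
  by apply: le_measure; rewrite ?inE.
rewrite /torus_measure_step /pushforward preimage_setT -setXTT product_measure1E//.
by rewrite lte_mul_pinfty// ?fin_num_measure// -ge0_fin_numE// fin_num_measure.
Qed.

HB.instance Definition _ := Measure_isFinite.Build _ _ _
  torus_measure_step step_fin.

End step.

(* Lebesgue measure on the fundamental cell [0, 2 pi]^n. *)
Fixpoint torus_measure (n : nat) :
    {finite_measure set (n.-tuple R) -> \bar R} :=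
  match n with
  | 0 => \d_([tuple] : 0.-tuple R)
  | n'.+1 => torus_measure_step (torus_measure n')
  end.

End torus_measure.

Section definitions.
Context {R : realType}.

Definition torus_pt d (x : d.-tuple R) : 'rV[R]_d :=
  \row_i tnth x i.

(* Euclidean norm of vectors, Frobenius norm of matrices; the library's
   default norm on matrices is the maximum norm. *)
Definition enorm m n (A : 'M[R]_(m, n)) : R :=
  Num.sqrt (\sum_i \sum_j A i j ^+ 2).

Definition unit_vec d (j : 'I_d) : 'rV[R]_d := delta_mx 0 j.

Definition partial d (j : 'I_d) (g : 'rV[R]_d -> R) : 'rV[R]_d -> R :=
  'D_(unit_vec j) g.

Definition component d (v : 'rV[R]_d -> 'rV[R]_d) (i : 'I_d) : 'rV[R]_d -> R :=
  fun x => v x 0 i.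

(* g is of class C^k on the open set D of a finite-dimensional space *)
Fixpoint class_C (V W : normedModType R) (D : set V) (k : nat) (g : V -> W)
    : Prop :=
  match k with
  | 0 => forall x, D x -> {for x, continuous g}
  | k'.+1 => (forall x, D x -> differentiable g x) /\
             (forall v, class_C D k' ('D_v g))
  end.

Definition smooth_on (V W : normedModType R) (D : set V) (g : V -> W) : Prop :=
  forall k, class_C D k g.

Definition torus_periodic d (W : Type) (g : 'rV[R]_d -> W) : Prop :=
  forall (j : 'I_d) (x : 'rV[R]_d), g (x + (2 * pi) *: unit_vec j) = g x.

Definition QT d (T : R) : set (R * 'rV[R]_d)%type := [set z | 0 < z.1 < T].

Definition smooth_QT d (W : normedModType R) (T : R) (g : R -> 'rV[R]_d -> W)
    : Prop :=
  smooth_on (@QT d T) (fun z => g z.1 z.2) /\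
  (forall t, 0 < t < T -> torus_periodic (g t)).

Definition Lp_norm d m n (p : \bar R) (w : 'rV[R]_d -> 'M[R]_(m, n)) : \bar R :=
  Lnorm (torus_measure d) p (fun x => (enorm (w (torus_pt x)))%:E).

Definition inner d (v w : 'rV[R]_d -> 'rV[R]_d) : R :=
  \int[torus_measure d]_x (\sum_i v (torus_pt x) 0 i * w (torus_pt x) 0 i).

Definition in_L2 d (v : 'rV[R]_d -> 'rV[R]_d) : Prop :=
  [/\ torus_periodic v,
      forall i, measurable_fun setT
        (fun x : d.-tuple R => v (torus_pt x) 0 i) &
      (Lp_norm 2%:E v < +oo)%E].

Definition sq_norm2 d m n (w : 'rV[R]_d -> 'M[R]_(m, n)) : R :=
  fine (Lp_norm 2%:E w) ^+ 2.

Definition weak_limit d (F : set_system R) (v : R -> 'rV[R]_d -> 'rV[R]_d)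
    (v0 : 'rV[R]_d -> 'rV[R]_d) : Prop :=
  in_L2 v0 /\
  forall w, in_L2 w -> (fun t => inner (v t) w) @ F --> inner v0 w.

(* g belongs to L^p(0, T; X), where N is the norm of X *)
Definition in_LpX (X : Type) (T : R) (p : \bar R) (N : X -> \bar R)
    (g : R -> X) : Prop :=
  measurable_fun (`]0, T[ : set R) (fun t => N (g t)) /\
  (Lnorm (mrestr lebesgue_measure (measurable_itv `]0%R, T[)) p (fun t => N (g t))
     < +oo)%E.

Definition test_function d (phi : 'rV[R]_d -> R) : Prop :=
  smooth_on setT phi /\ torus_periodic phi.

Definition partials d (s : seq 'I_d) (g : 'rV[R]_d -> R) : 'rV[R]_d -> R :=
  foldr (@partial d) g s.

(* Elements of D'(T^d): linear forms on test functions, continuous for the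
   topology defined by the C^N seminorms; only the values of L on test
   functions are relevant. *)
Definition is_distribution d (L : ('rV[R]_d -> R) -> R) : Prop :=
  (forall (a : R) phi psi, test_function phi -> test_function psi ->
     L (fun x => a * phi x + psi x) = a * L phi + L psi) /\
  (exists (N : nat) (C : R), forall phi (M : R), test_function phi ->
     (forall s, (size s <= N)%N -> forall x, `|partials s phi x| <= M) ->
     `|L phi| <= C * M).

Definition has_distribution_limit d (F : set_system R)
    (f : R -> 'rV[R]_d -> 'rV[R]_d) : Prop :=
  forall i : 'I_d, exists2 L, is_distribution L &
    forall phi, test_function phi ->
      (fun t => \int[torus_measure d]_x (f t (torus_pt x) 0 i * phi (torus_pt x)))
        @ F --> L phi.

Definition NSE_at d (u f : R -> 'rV[R]_d -> 'rV[R]_d) (p : R -> 'rV[R]_d -> R)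
    (t : R) (x : 'rV[R]_d) : Prop :=
  (forall i : 'I_d,
     derive1 (fun s => u s x 0 i) t
     - \sum_j partial j (partial j (component (u t) i)) x
     + \sum_j partial j (fun y => u t y 0 i * u t y 0 j) x
     + partial i (p t) x = f t x 0 i) /\
  \sum_j partial j (component (u t) j) x = 0.

Definition set_integral (g : R -> R) (ab : R * R) : R :=
  \int[lebesgue_measure]_(s in `[ab.1, ab.2]) g s.

Definition class_L (T : R) (g : R -> R) : Prop :=
  locally_integrable `]0, T[ g /\
  exists l : R, set_integral g @ filter_prod 0^'+ T^'- --> l.

(* Oriented integral from t0 to t1, as a limit of integrals over compact
   subintervals of the open interval between t0 and t1. *)
Definition time_integral (g : R -> R) (t0 t1 : R) : R :=
  if t0 <= t1 then lim (set_integral g @ filter_prod t0^'+ t1^'-)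
  else - lim (set_integral g @ filter_prod t1^'+ t0^'-).

Definition class_N d (T : R) (u f : R -> 'rV[R]_d -> 'rV[R]_d) : Prop :=
  [/\ [/\ smooth_QT T u, in_LpX T +oo%E (Lp_norm 2%:E) u & smooth_QT T f],
      exists2 p : R -> 'rV[R]_d -> R, smooth_QT T p &
        forall t x, 0 < t < T -> NSE_at u f p t x,
      class_L T (fun t => inner (u t) (f t)) &
      has_distribution_limit 0^'+ f /\ has_distribution_limit T^'- f].

Definition gradient d (v : 'rV[R]_d -> 'rV[R]_d) (x : 'rV[R]_d) : 'M[R]_d :=
  \matrix_(i, j) partial j (component v i) x.

Definition with_endpoints (X : Type) (T : R) (u0 uT : X) (u : R -> X) : R -> X :=
  fun t => if t == 0 then u0 else if t == T then uT else u t.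

(* The condition class_L on the dissipation says that the improper integral of
   ||grad u||^2 in the equality is finite (time_integral is a total
   function). *)
Definition energy_equality d (T : R) (u f : R -> 'rV[R]_d -> 'rV[R]_d) : Prop :=
  exists u0 uT : 'rV[R]_d -> 'rV[R]_d,
  [/\ weak_limit 0^'+ u u0, weak_limit T^'- u uT,
      class_L T (fun t => sq_norm2 (gradient (u t))) &
      let ubar := with_endpoints T u0 uT u in
      forall t0 t1 : R, 0 <= t0 <= T -> 0 <= t1 <= T ->
        2^-1 * sq_norm2 (ubar t1) - 2^-1 * sq_norm2 (ubar t0)
        + time_integral (fun t => sq_norm2 (gradient (u t))) t0 t1
        = time_integral (fun t => inner (u t) (f t)) t0 t1].

Definition freq d (k : 'rV[int]_d) : 'rV[R]_d := map_mx intr k.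

Definition phase d (k : 'rV[int]_d) (x : 'rV[R]_d) : R :=
  \sum_j freq k 0 j * x 0 j.

(* (2 pi)^-d times the integral of g(x) exp(- i k.x) *)
Definition fourier d (g : 'rV[R]_d -> R) (k : 'rV[int]_d) : R[i] :=
  Complex
    (((2 * pi) ^+ d)^-1 *
      \int[torus_measure d]_x (g (torus_pt x) * cos (phase k (torus_pt x))))
    (- (((2 * pi) ^+ d)^-1 *
      \int[torus_measure d]_x (g (torus_pt x) * sin (phase k (torus_pt x))))).

(* Fourier multiplier with finitely supported (on Z^d) real symbol m. For the
   even symbols used below the sum is real, so that taking the real part only
   serves to land in R. *)
Definition multiplier d (m : 'rV[R]_d -> R) (g : 'rV[R]_d -> R)
    : 'rV[R]_d -> R :=
  fun x => complex.Re (\sum_(k \in [set: 'rV[int]_d])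
    ((m (freq k))%:C * fourier g k *
     Complex (cos (phase k x)) (sin (phase k x))))%C.

Definition LP_cutoff d (chi : 'rV[R]_d -> R) : Prop :=
  [/\ smooth_on setT chi,
      forall xi eta, enorm xi <= enorm eta -> chi eta <= chi xi,
      forall xi, enorm xi <= 2^-1 -> chi xi = 1 &
      forall xi, 1 <= enorm xi -> chi xi = 0].

Definition LP_symbol d (chi : 'rV[R]_d -> R) (q : int) (xi : 'rV[R]_d) : R :=
  if 0 <= q then
    let eta := (2 : R) ^ (- q) *: xi in chi (2^-1 *: eta) - chi eta
  else chi xi.

(* Littlewood-Paley block Delta_q, for q >= -1 *)
Definition LP_block d (chi : 'rV[R]_d -> R) (q : int)
    (v : 'rV[R]_d -> 'rV[R]_d) : 'rV[R]_d -> 'rV[R]_d :=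
  fun x => \row_i multiplier (LP_symbol chi q) (component v i) x.

(* v_{<= q}: the sum of the blocks Delta_r v for -1 <= r <= q, r = j - 1 *)
Definition LP_le d (chi : 'rV[R]_d -> R) (q : nat)
    (v : 'rV[R]_d -> 'rV[R]_d) : 'rV[R]_d -> 'rV[R]_d :=
  fun x => \sum_(j < q.+2) LP_block chi (j%:Z - 1) v x.

Definition besov3_norm d (chi : 'rV[R]_d -> R) (s : R)
    (v : 'rV[R]_d -> 'rV[R]_d) : \bar R :=
  ereal_sup [set ((2 `^ (q%:~R * s))%:E * Lp_norm 3%:E (LP_block chi q v))%E
            | q in [set q : int | -1 <= q]].

Definition Hm1_norm d (v : 'rV[R]_d -> 'rV[R]_d) : \bar R :=
  ((\esum_(k in [set: 'rV[int]_d])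
     ((1 + enorm (freq k) ^+ 2)^-1 *
      \sum_i (complex.Re (fourier (component v i) k) ^+ 2 +
              complex.Im (fourier (component v i) k) ^+ 2))%:E) `^ 2^-1)%E.

Definition convection d (v : 'rV[R]_d -> 'rV[R]_d) : 'rV[R]_d -> 'rV[R]_d :=
  fun x => \row_i \sum_j v x 0 j * partial j (component v i) x.

Definition flux d (chi : 'rV[R]_d -> R) (q : nat)
    (v : 'rV[R]_d -> 'rV[R]_d) : R :=
  inner (LP_le chi q (convection v)) (LP_le chi q v).

End definitions.

(* Main.v *)
Require Import Defs.
From mathcomp Require Import all_boot all_order all_algebra.
From mathcomp Require Import all_classical all_reals all_analysis.
From mathcomp Require Import complex measurable_realfun ess_sup_inf.
From mathcomp Require Import ring lra zify.

Set Implicit Arguments.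
Unset Strict Implicit.
Unset Printing Implicit Defensive.

Import Order.TTheory GRing.Theory Num.Theory.
Import numFieldNormedType.Exports.

Local Open Scope classical_set_scope.
Local Open Scope ring_scope.

(** The velocity is a sum of pulses [u(t) = eta_n(t) U_n] living in disjoint
    time intervals that accumulate at [T]; each pulse is smooth, so [u] is
    smooth on the open time interval, and the force is defined by the equation
    with zero pressure.  The sup of the kinetic energy of the [n]-th pulse tends
    to zero, so [u(0) = u(T) = 0] and nothing is lost at the end of the interval:
    the power of the force is the dissipation plus half the derivative of the
    squared norm, and both have primitives that are continuous up to [T]
    ([pulses_energy]).

    Anomalous dissipation is a property of the flux and not of the energy.
    The profile [U_n] is a divergence-free trigonometric polynomial whose
    frequencies form two clusters, near the lengths [lam_n] and
    [h_n = lam_(n+1)].  The low waves are a shear flow and the Reynolds stress of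
    the high ones works on it, so that the nonlinear term moves energy from the
    low cluster to the high one at some rate [transfer] ([transfer_bounds]).  The
    flux of [U_n] through a dyadic frequency strictly between the clusters is
    exactly minus this rate ([flux_mid]), it vanishes beyond them ([flux_small],
    [flux_large]), and the transition at the two ends is negligible
    ([flux_bottom], [flux_top]).  The pulse lasts for the time [1 / transfer]:
    every pulse then carries the same amount through all the frequencies between
    [lam_n] and [lam_(n+1)], the force taking care of moving the energy to where
    the next pulse needs it.  Every high frequency is crossed by exactly one
    pulse, so the total flux through it tends to a nonzero constant, minus the
    integral of the cube of the profile ([anomalous_flux]).

    This has to be done with little energy and dissipation.  Each cluster
    consists of about [N^3] waves, all amplitudes being of the order [a / N^3]
    with coherent phases.  The supremum is then of the order [a], the energy of
    the order [E = a^2 / N^3], and the transfer of the order [a lam E], because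
    about [N^6] triads of waves resonate and all of them contribute with the same
    sign ([transfer_sum]).  Spreading the waves thus makes the
    transfer large for a given energy.  With [a = lam] and [N = lam^(2/3)] all the
    quantities to be summed, namely the energy, the dissipation [lam^2 E] over
    the duration [lam^(-2)], and the cube of the [B^(1/3)] norm, the borderline
    [L^p L^q] norms and the squared [H^(-1)] norm of the force over that
    duration, are of order one.  Correcting by powers of [b = 2^(m^2)],
    [m = n + n0], a small power of [lam], makes the energy and the dissipation
    summable, while the loss of [eps] in the remaining exponents beats any fixed
    power of [b].  As [lam_n] is a power of [b], the ratio [rho] of consecutive
    frequencies is exponential in [m]: it tends to infinity, which makes the
    clusters separate, and is still negligible against [b].

    For [f] the [H^(-1)] norm is controlled because all its parts are divergences
    of tensors: [U_n] itself has a potential that is smaller by the factor [lam]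
    ([Hm1_norm_div], [cflow_Hm1]).  Against a fixed test function the large term
    [eta_n' U_n] is killed by the oscillation of [U_n], so [f] tends to zero in
    the sense of distributions ([force_limit_end]). *)

(** * Smooth functions on open sets *)

Section class_C_theory.
Context {R : realType}.
Implicit Types V W : normedModType R.

Lemma near_eq_differentiable V W (f g : V -> W) x :
  (\forall y \near x, f y = g y) -> differentiable f x -> differentiable g x.
Proof.
move=> fg df.
have fgx : f x = g x by exact: (nbhs_singleton fg).
have E : g \o shift x = cst (g x) + 'd f x +o_ 0 id.
  apply/eqaddoP => e e0.
  have /eqaddoP/(_ e e0) H := diff_locally df.
  have fg0 : \forall h \near (0 : V), f (h + x) = g (h + x).
    by move: fg; rewrite (near_shift 0) /= subr0.
  near=> h.
  have : g (h + x) = f (h + x) by apply/esym; near: h.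
  have : `|(f \o shift x - (cst (f x) + 'd f x)) h| <= e * `|id h| by near: h.
  move=> H1 H2.
  rewrite [X in `|X|](_ : _ = (f \o shift x - (cst (f x) + 'd f x)) h) //.
  by rewrite !fctE /= H2 fgx.
have dE : 'd g x = 'd f x :> (V -> W).
  by apply: (@diff_unique _ _ _ g ('d f x) x) => //; exact: diff_continuous.
apply/diff_locallyP; split; first by rewrite dE; exact: diff_continuous.
by rewrite dE.
Unshelve. all: by end_near. Qed.

(** Differentiability and directional derivatives only depend on germs, so it
    is enough to have a local representative of class C^k near each point; fields
    glued from pieces in time are smooth for this reason. *)
Lemma class_C_local V W (D : set V) k (g : V -> W) :
  (forall x, D x -> exists U h, [/\ open U, U x, class_C U k h &
     forall y, U y -> h y = g y]) -> class_C D k g.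
Proof.
elim: k g => [|k IH] g H /=.
  move=> x Dx; have [U [h [oU Ux hc hg]]] := H x Dx.
  have nhg : \forall y \near x, h y = g y.
    by apply: filterS (open_nbhs_nbhs (conj oU Ux)).
  rewrite /prop_for /continuous_at -(hg x Ux).
  by apply: cvg_trans (hc x Ux); apply: near_eq_cvg.
split=> [x Dx|v].
  have [U [h [oU Ux [hd _] hg]]] := H x Dx.
  apply: (near_eq_differentiable (f := h)); last exact: hd.
  by apply: filterS (open_nbhs_nbhs (conj oU Ux)).
apply: IH => x Dx; have [U [h [oU Ux [_ hv] hg]]] := H x Dx.
exists U, ('D_v h); split; [by []|by []|exact: hv|move=> y Uy].
apply: near_eq_derive.
by apply: filterS (open_nbhs_nbhs (conj oU Uy)).
Qed.

Lemma eq_class_C V W (D : set V) k (f g : V -> W) : open D ->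
  (forall x, D x -> f x = g x) -> class_C D k f -> class_C D k g.
Proof. by move=> oD fg fC; apply: class_C_local => x Dx; exists D, f. Qed.

Lemma class_C_cont V W (D : set V) k (f : V -> W) : class_C D k f ->
  forall x, D x -> {for x, continuous f}.
Proof.
case: k => [//|k [fd _] x Dx]; exact/differentiable_continuous/fd.
Qed.

Lemma class_CW V W (D : set V) k (f : V -> W) :
  class_C D k.+1 f -> class_C D k f.
Proof.
elim: k f => [|k IH] f; first exact: class_C_cont.
by move=> [fd fv]; split=> // v; apply: IH; apply: fv.
Qed.

Lemma class_C_cst V W (D : set V) k (w : W) : class_C D k (fun=> w).
Proof.
elim: k w => [|k IH] w /=; first by move=> x Dx; exact: cvg_cst.
split=> [x _|v]; first exact: differentiable_cst.
have -> : 'D_v (fun=> w) = (fun=> 0) :> (V -> W).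
  by apply/funext => x; exact: derive_cst.
exact: IH.
Qed.

Lemma class_CD V W (D : set V) k (f g : V -> W) : open D ->
  class_C D k f -> class_C D k g -> class_C D k (f \+ g).
Proof.
move=> oD; elim: k f g => [|k IH] f g.
  by move=> fC gC x Dx; apply: cvgD; [exact: fC|exact: gC].
move=> [fd fv] [gd gv]; split=> [x Dx|v].
  by apply: differentiableD; [exact: fd|exact: gd].
apply: (eq_class_C oD _ (IH _ _ (fv v) (gv v))) => x Dx /=.
by rewrite deriveD //; apply: diff_derivable; [exact: fd|exact: gd].
Qed.

Lemma class_CM V (D : set V) k (f g : V -> R) : open D ->
  class_C D k f -> class_C D k g -> class_C D k (f \* g).
Proof.
move=> oD; elim: k f g => [|k IH] f g.
  by move=> fC gC x Dx; apply: cvgM; [exact: fC|exact: gC].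
move=> fC gC; have [fd fv] := fC; have [gd gv] := gC; split=> [x Dx|v].
  by apply: differentiableM; [exact: fd|exact: gd].
have H1 := IH _ _ (class_CW fC) (gv v).
have H2 := IH _ _ (class_CW gC) (fv v).
apply: (eq_class_C oD _ (class_CD oD H1 H2)) => x Dx /=.
by rewrite deriveM //; apply: diff_derivable; [exact: fd|exact: gd].
Qed.

Lemma class_CZl V W (D : set V) k (f : V -> R) (w : W) : open D ->
  class_C D k f -> class_C D k (fun x => f x *: w).
Proof.
move=> oD; elim: k f => [|k IH] f.
  by move=> fC x Dx; apply: cvgZr_tmp; exact: fC.
move=> [fd fv]; split=> [x Dx|v].
  by apply: differentiableZl; exact: fd.
apply: (eq_class_C oD _ (IH _ (fv v))) => x Dx.
rewrite !deriveE; [|exact: differentiableZl (fd _ Dx)|exact: fd].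
by rewrite diffZl //; exact: fd.
Qed.

(** A map [A] with constant differential [L] satisfies
    [D_v (g o A) = (D_(L v) g) o A], again a composite with [A], so the induction
    closes without a chain rule of higher order. *)
Lemma class_C_comp_affine (U V W : normedModType R) (D : set V) (D' : set U) k
    (g : V -> W) (A L : U -> V) : open D' ->
  (forall y, is_diff y A L) -> (forall y, D' y -> D (A y)) ->
  class_C D k g -> class_C D' k (g \o A).
Proof.
move=> oD' dA DA; elim: k g => [|k IH] g.
  move=> gC y Dy; apply: continuous_comp; last exact/gC/DA.
  by apply: differentiable_continuous; have [] := dA y.
move=> [gd gv]; split=> [y Dy|v].
  by apply: differentiable_comp; [have [] := dA y|exact/gd/DA].
apply: (eq_class_C oD' _ (IH _ (gv (L v)))) => y Dy /=.
have [dAy dAE] := dA y.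
rewrite !deriveE; [|exact: differentiable_comp (gd _ (DA _ Dy))|exact/gd/DA].
by rewrite (diff_comp dAy (gd _ (DA _ Dy))) /= dAE.
Qed.

(** The derivative of each function involves the other one, hence the joint
    induction. *)
Lemma class_C_cos_sin V (D : set V) k (g : V -> R) : open D ->
  class_C D k g -> class_C D k (fun x => cos (g x)) /\ class_C D k (fun x => sin (g x)).
Proof.
move=> oD; elim: k => [|k IH].
  move=> gC; split => x Dx; apply: (@continuous_comp _ _ _ g); try exact: gC.
  - exact: continuous_cos.
  - exact: continuous_sin.
move=> gC; have [gd gv] := gC; have [Hc Hs] := IH (class_CW gC).
have dc (y : R) : differentiable (@cos R) y by apply/derivable1_diffP.
have ds (y : R) : differentiable (@sin R) y by apply/derivable1_diffP.
split; split=> [x Dx|v].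
- by apply: (@differentiable_comp _ _ _ _ g); [exact: gd|].
- have H : class_C D k ((fun=> -1) \* (fun x => sin (g x)) \* ('D_v g : V -> R)).
    by apply: class_CM => //; [apply: class_CM => //; exact: class_C_cst|exact: gv].
  apply: (eq_class_C oD _ H) => x Dx /=.
  rewrite !deriveE; [|exact: (@differentiable_comp _ _ _ _ g)  (gd _ Dx) (dc _)|exact: gd].
  rewrite (diff_comp (f:=g) (g := @cos R)) //=; last exact: gd.
  by rewrite deriv1E //= derive1E; have [_ ->] := is_derive_cos (g x); rewrite mulN1r mulrC.
- by apply: (@differentiable_comp _ _ _ _ g); [exact: gd|].
- have H : class_C D k ((fun x => cos (g x)) \* ('D_v g : V -> R)).
    by apply: class_CM => //; exact: gv.
  apply: (eq_class_C oD _ H) => x Dx /=.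
  rewrite !deriveE; [|exact: (@differentiable_comp _ _ _ _ g)  (gd _ Dx) (ds _)|exact: gd].
  rewrite (diff_comp (f:=g) (g := @sin R)) //=; last exact: gd.
  by rewrite deriv1E //= derive1E; have [_ ->] := is_derive_sin (g x); rewrite mulrC.
Qed.

Lemma smooth_on_local V W (D : set V) (g : V -> W) :
  (forall x, D x -> exists U h, [/\ open U, U x, smooth_on U h &
     forall y, U y -> h y = g y]) -> smooth_on D g.
Proof.
move=> H k; apply: class_C_local => x Dx; have [U [h [oU Ux hC hg]]] := H x Dx.
by exists U, h; split.
Qed.

Lemma eq_smooth_on V W (D : set V) (f g : V -> W) : open D ->
  (forall x, D x -> f x = g x) -> smooth_on D f -> smooth_on D g.
Proof. by move=> oD fg fC k; exact: eq_class_C fg (fC k). Qed.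

Lemma smooth_on_derive V W (D : set V) (f : V -> W) v :
  smooth_on D f -> smooth_on D ('D_v f).
Proof. by move=> fC k; have [_] := fC k.+1; apply. Qed.

Lemma smooth_on_diff V W (D : set V) (f : V -> W) x :
  smooth_on D f -> D x -> differentiable f x.
Proof. by move=> fC Dx; have [fd _] := fC 1; exact: fd. Qed.

Lemma smooth_on_sub V W (D E : set V) (f : V -> W) : E `<=` D ->
  smooth_on D f -> smooth_on E f.
Proof.
move=> ED fC k; elim: k f {fC}(fC k) => [|k IH] f /=; first by move=> H x /ED; exact: H.
by move=> [fd fv]; split=> [x /ED|v]; [exact: fd|exact: IH].
Qed.

Lemma smooth_on_cst V W (D : set V) (w : W) : smooth_on D (fun=> w).
Proof. by move=> k; exact: class_C_cst. Qed.

Lemma smooth_onD V W (D : set V) (f g : V -> W) : open D ->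
  smooth_on D f -> smooth_on D g -> smooth_on D (f \+ g).
Proof. by move=> oD fC gC k; exact: class_CD. Qed.

Lemma smooth_onM V (D : set V) (f g : V -> R) : open D ->
  smooth_on D f -> smooth_on D g -> smooth_on D (f \* g).
Proof. by move=> oD fC gC k; exact: class_CM. Qed.

Lemma smooth_onZl V W (D : set V) (f : V -> R) (w : W) : open D ->
  smooth_on D f -> smooth_on D (fun x => f x *: w).
Proof. by move=> oD fC k; exact: class_CZl. Qed.

Lemma smooth_on_sum V W (D : set V) (I : Type) (r : seq I) (P : pred I)
  (f : I -> V -> W) : open D ->
  (forall i, smooth_on D (f i)) -> smooth_on D (fun x => \sum_(i <- r | P i) f i x).
Proof.
move=> oD fC; elim: r => [|i r IH].
  by under eq_fun do rewrite big_nil; exact: smooth_on_cst.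
under eq_fun do rewrite big_cons.
case: (P i) => //; exact: smooth_onD.
Qed.

Lemma smooth_on_comp_affine (U V W : normedModType R) (D : set V) (D' : set U)
    (g : V -> W) (A L : U -> V) : open D' ->
  (forall y, is_diff y A L) -> (forall y, D' y -> D (A y)) ->
  smooth_on D g -> smooth_on D' (g \o A).
Proof. by move=> oD' dA DA gC k; exact: class_C_comp_affine dA DA (gC k). Qed.

Lemma smooth_on_cos V (D : set V) (g : V -> R) : open D ->
  smooth_on D g -> smooth_on D (fun x => cos (g x)).
Proof. by move=> oD gC k; have [] := class_C_cos_sin oD (gC k). Qed.

Lemma smooth_on_sin V (D : set V) (g : V -> R) : open D ->
  smooth_on D g -> smooth_on D (fun x => sin (g x)).
Proof. by move=> oD gC k; have [] := class_C_cos_sin oD (gC k). Qed.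

End class_C_theory.

(** * Integration on the torus *)

Section torus_functions.
Context {R : realType} {d : nat}.
Implicit Types g : 'rV[R]_d -> R.

Let grid (n : nat) (k : 'rV[int]_d) : 'rV[R]_d :=
  \row_j ((k 0 j)%:~R / n.+1%:R).
Let cell (n : nat) (x : d.-tuple R) : 'rV[int]_d :=
  \row_j Num.floor (tnth x j * n.+1%:R).

Let measurable_cell n (k : 'rV[int]_d) : measurable [set x | cell n x = k].
Proof.
have -> : [set x | cell n x = k] = \bigcap_(j in [set: 'I_d])
    ((fun x : d.-tuple R => tnth x j) @^-1`
      `[(k 0 j)%:~R / n.+1%:R, ((k 0 j) + 1)%:~R / n.+1%:R[).
  apply/seteqP; split=> x /=.
    move=> <- j _ /=; rewrite in_itv /= mxE ler_pdivrMr // ltr_pdivlMr //.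
    by rewrite floor_le_tmp floorD1_gt.
  move=> H; apply/rowP => j; rewrite mxE; have := H j I.
  rewrite /= in_itv /= ler_pdivrMr // ltr_pdivlMr // => /andP[? ?].
  by apply/floor_def/andP.
apply: fin_bigcap_measurable => // j _.
rewrite -[X in measurable X]setTI; apply: measurable_tnth => //.
Qed.

(** Tuples carry the product sigma-algebra, for which continuity does not give
    measurability at once: [g] is the pointwise limit of its values at the corners
    of the cells of finer and finer grids, and each of these approximations is
    constant on countably many boxes. *)
Lemma measurable_continuous_torus g : continuous g ->
  measurable_fun setT (fun x : d.-tuple R => g (torus_pt x)).
Proof.
move=> gc.
apply: (@measurable_fun_cvg _ _ _ _ (fun n x => g (grid n (cell n x)))).
  move=> n _ Y mY; rewrite setTI.
  have -> : (fun x => g (grid n (cell n x))) @^-1` Y =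
      \bigcup_(k : 'rV[int]_d) (if `[< Y (g (grid n k)) >] then [set x | cell n x = k] else set0).
    apply/seteqP; split=> [x /= Yx|x [k _]].
      by exists (cell n x) => //; rewrite asboolT.
    by case: ifPn => [/asboolP Yk /= xk|//]; rewrite /= xk.
  apply: countable_bigcupT_measurable => // k; case: ifPn => // _.
move=> x _.
suff xc : grid n (cell n x) @[n --> \oo] --> torus_pt x.
  exact: (cvg_comp _ _ xc (gc (torus_pt x))).
apply/cvgrPdist_le => e e0.
near=> n.
rewrite /Num.Def.normr/= mx_normrE (bigmax_le _ (ltW e0))//= => -[i j] _.
rewrite !mxE /=.
have n0 : (0 : R) < n.+1%:R by [].
have /andP[f1 f2] := mem_rg1_floor (tnth x j * n.+1%:R).
rewrite ger0_norm; last by rewrite subr_ge0 ler_pdivrMr.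
apply: (@le_trans _ _ n.+1%:R^-1).
  rewrite lerBlDr -[X in X + _]mul1r -mulrDl ler_pdivlMr // addrC.
  exact: ltW.
have : n.+1%:R^-1 < e by near: n; exact: near_infty_natSinv_lt (PosNum e0).
exact: ltW.
Unshelve. all: by end_near. Qed.

Lemma torus_periodic_int (W : Type) (g : 'rV[R]_d -> W) (j : 'I_d) (m : int) x :
  torus_periodic g -> g (x + (2 * pi * m%:~R) *: unit_vec j) = g x.
Proof.
move=> gp.
have H (n : nat) y : g (y + (2 * pi * n%:R) *: unit_vec j) = g y.
  elim: n => [|n IH]; first by rewrite mulr0 scale0r addr0.
  have -> : n.+1%:R = n%:R + 1 :> R by rewrite natr1.
  by rewrite mulrDr mulr1 scalerDl addrA gp.
case: m => n; first exact: H.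
rewrite NegzE mulrNz mulrN scaleNr.
by rewrite -[in LHS](H n.+1) subrK.
Qed.

(** Brings a point to the fundamental cell, where compactness applies. *)
Lemma torus_reduce (W : Type) (g : 'rV[R]_d -> W) x : torus_periodic g ->
  exists y : 'rV[R]_d, (forall j, 0 <= y 0 j <= 2 * pi) /\ g x = g y.
Proof.
move=> gp.
pose c (j : 'I_d) : int := - Num.floor (x 0 j / (2 * pi)).
have H (s : seq 'I_d) : g (x + \sum_(j <- s) (2 * pi * (c j)%:~R) *: unit_vec j) = g x.
  elim: s => [|j s IH]; first by rewrite big_nil addr0.
  by rewrite big_cons addrCA addrC torus_periodic_int.
exists (x + \sum_j (2 * pi * (c j)%:~R) *: unit_vec j); split; last by rewrite H.
move=> j; rewrite !mxE summxE (bigD1 j) //= big1 ?addr0 => [|i ij]; last first.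
  by rewrite !mxE eqxx /= eq_sym (negbTE ij) mulr0.
rewrite !mxE !eqxx mulr1 /c mulrNz.
have pi0 : (0 : R) < 2 * pi by rewrite mulr_gt0 // pi_gt0.
have /andP[f1 f2] := mem_rg1_floor (x 0 j / (2 * pi)).
rewrite mulrN subr_ge0 mulrC -ler_pdivlMr // f1 /=.
move: f2; rewrite ltr_pdivrMr // mulrDl mul1r => /ltW.
by rewrite lerBlDl.
Qed.

Definition torus_cont g := continuous g /\ torus_periodic g.

Lemma torus_cont_bounded g : torus_cont g -> exists2 M, 0 <= M & forall x, `|g x| <= M.
Proof.
move=> [gc gp].
have K : compact [set v : 'rV[R]_d | forall i, `[0, 2 * pi]%classic (v ord0 i)].
  by apply: (rV_compact (A := fun=> `[0, 2 * pi]%classic)) => i; exact: segment_compact.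
have gK : compact (g @` [set v : 'rV[R]_d | forall i, `[0, 2 * pi]%classic (v ord0 i)]).
  by apply: continuous_compact => //; apply: continuous_subspaceT.
have [M [Mr HM]] := compact_bounded gK.
exists (`|M| + 1) => // x.
have [y [yK ->]] := torus_reduce x gp.
apply: HM; first by rewrite (le_lt_trans (ler_norm _)) // ltrDl.
by exists y => // j; rewrite /= in_itv /=; exact: yK.
Qed.

Lemma torus_cont_cst (c : R) : torus_cont (fun=> c).
Proof. by split; [exact: cst_continuous|]. Qed.

Lemma torus_contD g h : torus_cont g -> torus_cont h -> torus_cont (fun x => g x + h x).
Proof.
move=> [gc gp] [hc hp]; split=> [x|j x]; last by rewrite gp hp.
exact: (cvgD (gc x) (hc x)).
Qed.

Lemma torus_contM g h : torus_cont g -> torus_cont h -> torus_cont (fun x => g x * h x).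
Proof.
move=> [gc gp] [hc hp]; split=> [x|j x]; last by rewrite gp hp.
exact: (cvgM (gc x) (hc x)).
Qed.

Lemma torus_contZ (c : R) g : torus_cont g -> torus_cont (fun x => c * g x).
Proof. exact/torus_contM/torus_cont_cst. Qed.

Lemma torus_contN g : torus_cont g -> torus_cont (fun x => - g x).
Proof. by move=> gc; under eq_fun do rewrite -mulN1r; exact: torus_contZ. Qed.

Lemma torus_contB g h : torus_cont g -> torus_cont h -> torus_cont (fun x => g x - h x).
Proof. by move=> ? ?; apply: torus_contD => //; exact: torus_contN. Qed.

Lemma torus_cont_sum (I : Type) (r : seq I) (P : pred I) (F : I -> 'rV[R]_d -> R) :
  (forall i, P i -> torus_cont (F i)) -> torus_cont (fun x => \sum_(i <- r | P i) F i x).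
Proof.
move=> Fc; elim: r => [|i r IH].
  by under eq_fun do rewrite big_nil; exact: torus_cont_cst.
under eq_fun do rewrite big_cons.
by case Pi: (P i) => //; apply: torus_contD => //; exact: Fc.
Qed.

Lemma torus_cont_integrable g : torus_cont g ->
  (torus_measure d).-integrable setT (EFin \o (fun x => g (torus_pt x))).
Proof.
move=> gc; have [M M0 gM] := torus_cont_bounded gc.
apply: measurable_bounded_integrable => //.
- by rewrite -ge0_fin_numE // fin_num_measure.
- by apply: measurable_continuous_torus; case: gc.
- exists M; split; first exact: num_real.
  by move=> B MB x _ /=; exact: (le_trans (gM _) (ltW MB)).
Qed.

End torus_functions.

Definition tint {R : realType} {d : nat} (g : 'rV[R]_d -> R) : R :=
  \int[torus_measure d]_x g (torus_pt x).

Section tint_linear.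
Context {R : realType} {d : nat}.
Implicit Types g h : 'rV[R]_d -> R.

Lemma tintD g h : torus_cont g -> torus_cont h ->
  tint (fun x => g x + h x) = tint g + tint h.
Proof. by move=> gc hc; apply: RintegralD => //; exact: torus_cont_integrable. Qed.

Lemma tintZ (c : R) g : torus_cont g -> tint (fun x => c * g x) = c * tint g.
Proof. by move=> gc; apply: RintegralZl => //; exact: torus_cont_integrable. Qed.

Lemma tintN g : torus_cont g -> tint (fun x => - g x) = - tint g.
Proof.
move=> gc; rewrite -mulN1r -tintZ //.
by apply: eq_Rintegral => x _; rewrite mulN1r.
Qed.

Lemma tintB g h : torus_cont g -> torus_cont h ->
  tint (fun x => g x - h x) = tint g - tint h.
Proof.
by move=> gc hc; rewrite -tintN // -tintD //; exact: torus_contN.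
Qed.

Lemma eq_tint g h : g =1 h -> tint g = tint h.
Proof. by move=> gh; apply: eq_Rintegral => x _; rewrite gh. Qed.

Lemma tint0 : tint ((fun=> 0) : 'rV[R]_d -> R) = 0.
Proof. by rewrite /tint /Rintegral integral0. Qed.

Lemma tint_sum (I : Type) (r : seq I) (P : pred I) (F : I -> 'rV[R]_d -> R) :
  (forall i, P i -> torus_cont (F i)) ->
  tint (fun x => \sum_(i <- r | P i) F i x) = \sum_(i <- r | P i) tint (F i).
Proof.
move=> Fc; elim: r => [|i r IH].
  by rewrite big_nil -[RHS]tint0; apply: eq_tint => x; rewrite big_nil.
rewrite big_cons; transitivity (tint (fun x => if P i then F i x + \sum_(i <- r | P i) F i x
   else \sum_(i <- r | P i) F i x)).
  by apply: eq_tint => x; rewrite big_cons.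
case: ifPn => // Pi; rewrite tintD ?IH //; first exact: Fc.
exact: torus_cont_sum.
Qed.

Lemma le_tint g h : torus_cont g -> torus_cont h -> (forall x, g x <= h x) -> tint g <= tint h.
Proof.
by move=> gc hc gh; apply: le_Rintegral => //; exact: torus_cont_integrable.
Qed.

Lemma tint_ge0 g : (forall x, 0 <= g x) -> 0 <= tint g.
Proof. by move=> g0; apply: Rintegral_ge0. Qed.

Lemma EFin_tint g : torus_cont g ->
  ((tint g)%:E = \int[torus_measure d]_x (g (torus_pt x))%:E)%E.
Proof.
by move=> gc; rewrite /Rintegral fineK //; exact: integrable_fin_num (torus_cont_integrable gc).
Qed.

End tint_linear.

Lemma rV_continuous (R : realType) (T : topologicalType) n (F : T -> 'rV[R]_n) :
  (forall j, continuous (fun x => F x 0 j)) -> continuous F.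
Proof.
move=> Fc x; apply/cvgrPdist_le => e e0; near=> y.
rewrite /Num.Def.normr/= mx_normrE (bigmax_le _ (ltW e0))//= => -[i j] _.
rewrite !mxE /= ord1.
move: j; near: y; apply: filter_forall => j.
by have /cvgrPdist_le/(_ e e0) := Fc j x.
Unshelve. all: by end_near. Qed.

(** A directional derivative only sees the restriction to a line, which may as
    well lie in another space. *)
Lemma is_derive_along (R : realType) (V V' W : normedModType R) (F : V -> W) (G : V' -> W)
    a v b w l :
  (forall h : R, F (h *: v + a) = G (h *: w + b)) ->
  is_derive b w G l -> is_derive a v F l.
Proof.
move=> FG.
have FGa : F a = G b by have := FG 0; rewrite !scale0r !add0r.
have E : (fun h : R => h^-1 *: ((F \o shift a) (h *: v) - F a)) =
         (fun h : R => h^-1 *: ((G \o shift b) (h *: w) - G b)).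
  by apply/funext => h /=; rewrite FG FGa.
by case=> dG eG; split; [rewrite /derivable E|rewrite /derive E].
Qed.

Section divergence.
Context {R : realType}.

Lemma torus_measure_setT d :
  torus_measure d [set: d.-tuple R] = ((2 * pi) ^+ d)%:E.
Proof.
elim: d => [|d IH] /=; first by rewrite diracT expr0.
rewrite /torus_measure_step /pushforward preimage_setT -setXTT product_measure1E //.
rewrite exprS EFinM; congr (_ * _)%E; last exact: IH.
transitivity (lebesgue_measure ([set: R] `&` `[0, 2 * pi])); first by [].
rewrite setTI lebesgue_measure_itv /=.
have pi0 : (0 : R) < 2 * pi by rewrite mulr_gt0 // pi_gt0.
by rewrite lte_fin pi0 -EFinD subr0.
Qed.

Lemma tint_cst d (c : R) : tint ((fun=> c) : 'rV[R]_d -> R) = (2 * pi) ^+ d * c.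
Proof.
rewrite /tint Rintegral_cst // mulrC; congr (_ * _).
by have := torus_measure_setT d => /= ->.
Qed.

Definition cons_rV n (s : R) (z : 'rV[R]_n) : 'rV[R]_n.+1 :=
  \row_j (if unlift ord0 j is Some i then z 0 i else s).

Lemma torus_pt_tcons n (s : R) (y : n.-tuple R) :
  torus_pt (tcons (s, y)) = cons_rV s (torus_pt y).
Proof.
apply/rowP => j; rewrite !mxE; case: unliftP => [i ->|->]; last by rewrite (tnth_nth 0).
by rewrite mxE !(tnth_nth 0).
Qed.

Lemma cons_rV_continuous n (s : R) : continuous (@cons_rV n s).
Proof.
apply: rV_continuous => j; under eq_fun do rewrite mxE.
by case: unliftP => [i _|_]; [exact: coord_continuous|exact: cst_continuous].
Qed.

Lemma cons_rV_continuousl n (z : 'rV[R]_n) : continuous (fun s => cons_rV s z).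
Proof.
apply: rV_continuous => j; under eq_fun do rewrite mxE.
by case: unliftP => [i _|_]; [exact: cst_continuous|move=> x; exact: cvg_id].
Qed.

Lemma cons_rV_unit0 n (s c : R) (z : 'rV[R]_n) :
  cons_rV s z + c *: unit_vec ord0 = cons_rV (s + c) z.
Proof.
apply/rowP => j; rewrite !mxE eqxx /=; case: unliftP => [i ->|->].
  by rewrite eq_sym (negbTE (neq_lift _ _)) mulr0 addr0.
by rewrite eqxx mulr1.
Qed.

Lemma cons_rV_unitS n (s c : R) (z : 'rV[R]_n) (i : 'I_n) :
  cons_rV s z + c *: unit_vec (lift ord0 i) = cons_rV s (z + c *: unit_vec i).
Proof.
apply/rowP => j; rewrite !mxE eqxx /=; case: unliftP => [k ->|->].
  by rewrite !mxE eqxx /= (inj_eq lift_inj).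
by rewrite (negbTE (neq_lift _ _)) mulr0 addr0.
Qed.

Lemma torus_cont_cons n (g : 'rV[R]_n.+1 -> R) s :
  torus_cont g -> torus_cont (fun z => g (cons_rV s z)).
Proof.
move=> [gc gp]; split=> [z|j z]; last by rewrite -cons_rV_unitS gp.
exact: (continuous_comp (@cons_rV_continuous _ s z) (gc _)).
Qed.

Lemma circle_integral (f : R -> R) M : measurable_fun setT f ->
  (forall s, `|f s| <= M) ->
  (\int[circle_measure]_s (f s)%:E = \int[lebesgue_measure]_(s in `[0%R, (2 * pi)%R]) (f s)%:E)%E.
Proof.
move=> mf fM.
have fi : circle_measure.-integrable setT (EFin \o f).
  apply: measurable_bounded_integrable => //.
    by rewrite -ge0_fin_numE // fin_num_measure.
  exists M; split; first exact: num_real.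
  by move=> B MB x _ /=; exact: (le_trans (fM _) (ltW MB)).
have mI : measurable (`[0%R, (2 * pi)%R]%classic : set (measurableTypeR R)) by [].
transitivity (\int[circle_measure]_(s in `[0%R, (2 * pi)%R]) (f s)%:E)%E.
  have := @negligible_integral _ _ _ circle_measure setT (~` `[0%R, (2 * pi)%R]%classic) _ (measurableC mI) measurableT fi.
  rewrite setTD setCK; apply.
  transitivity (lebesgue_measure (~` `[0, 2 * pi] `&` `[0, (2 * pi : R)])); first by [].
  by rewrite setIC setICr measure0.
apply: eq_measure_integral => A mA AI.
transitivity (lebesgue_measure (A `&` `[0, (2 * pi : R)])); first by [].
by rewrite setIidl.
Qed.

Section fubini.
Context {n : nat}.
Variable g : 'rV[R]_n.+1 -> R.
Hypothesis gc : torus_cont g.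

Let G (z : measurableTypeR R * n.-tuple R) := g (cons_rV z.1 (torus_pt z.2)).

Let GE z : g (torus_pt (tcons z)) = G z.
Proof. by case: z => s y; rewrite torus_pt_tcons. Qed.

Let mG : measurable_fun setT G.
Proof.
have -> : G = (fun x => g (torus_pt x)) \o @tcons R n.
  by apply/funext => z /=; rewrite GE.
have mt : measurable_fun [set: measurableTypeR R * n.-tuple R] (@tcons R n).
  exact: measurable_tcons.
apply: measurableT_comp; last exact: mt.
by apply: measurable_continuous_torus; case: gc.
Qed.

Let iG : (circle_measure \x torus_measure n)%E.-integrable setT (EFin \o G).
Proof.
have [M M0 gM] := torus_cont_bounded gc.
apply: measurable_bounded_integrable => //.
  have := @product_measure1E _ _ _ _ _ (@circle_measure R) (@torus_measure R n) setT setT measurableT measurableT.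
  rewrite setXTT => E; apply: (@le_lt_trans _ _ (@circle_measure R setT * @torus_measure R n setT)%E).
    by rewrite -E.
  by rewrite lte_mul_pinfty// ?fin_num_measure// -ge0_fin_numE// fin_num_measure.
exists M; split; first exact: num_real.
by move=> B MB x _ /=; exact: (le_trans (gM _) (ltW MB)).
Qed.

Let tint_prod : (\int[torus_measure n.+1]_x (g (torus_pt x))%:E =
  \int[circle_measure \x torus_measure n]_z (G z)%:E)%E.
Proof.
have mf : measurable_fun setT (fun x : n.+1.-tuple R => (g (torus_pt x))%:E).
  by apply/measurable_EFinP; apply: measurable_continuous_torus; case: gc.
have iG' : (@circle_measure R \x @torus_measure R n)%E.-integrable
    ((@tcons R n : measurableTypeR R * n.-tuple R -> n.+1.-tuple R) @^-1` setT) ((fun x => (g (torus_pt x))%:E) \o @tcons R n).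
  by rewrite preimage_setT; apply: eq_integrable iG => // z _ /=; rewrite GE.
have mt : measurable_fun [set: measurableTypeR R * n.-tuple R] (@tcons R n).
  exact: measurable_tcons.
have := integral_pushforward mt mf iG' measurableT.
rewrite preimage_setT => H; transitivity (\int[circle_measure \x torus_measure n]_z
    (g (torus_pt (tcons z)))%:E)%E.
  by rewrite -[RHS]H; exact: eq_measure_integral.
by apply: eq_integral => z _; rewrite GE.
Qed.

Lemma tint_fubini1 : (\int[torus_measure n.+1]_x (g (torus_pt x))%:E =
  \int[circle_measure]_s \int[torus_measure n]_y (g (cons_rV s (torus_pt y)))%:E)%E.
Proof. by rewrite tint_prod -integral12_prod_meas1. Qed.

Lemma tint_fubini2 : (\int[torus_measure n.+1]_x (g (torus_pt x))%:E =
  \int[torus_measure n]_y \int[circle_measure]_s (g (cons_rV s (torus_pt y)))%:E)%E.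
Proof. by rewrite tint_prod -integral21_prod_meas1. Qed.

End fubini.

Lemma circle_divergence (f F : R -> R) : continuous f ->
  (forall s : R, is_derive s 1 F (f s)) -> F (2 * pi) = F 0 ->
  (\int[lebesgue_measure]_(s in `[0%R, (2 * pi)%R]) (f s)%:E)%E = 0%E.
Proof.
move=> fc dF Fp.
have pi0 : (0 : R) < 2 * pi by rewrite mulr_gt0 // pi_gt0.
have Fc : continuous F.
  by move=> s; apply: differentiable_continuous; apply/derivable1_diffP; have [] := dF s.
rewrite (continuous_FTC2 (F := F)) //; first by rewrite Fp -EFinB subrr.
- exact: continuous_subspaceT.
- split=> [s _||]; first by have [] := dF s.
  + by apply: cvg_at_right_filter; exact: Fc.
  + by apply: cvg_at_left_filter; exact: Fc.
- by move=> s _; rewrite derive1E; have [] := dF s.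
Qed.

(** By Fubini the integral along the coordinate [j] may be computed separately,
    where it is the difference of the values of [g] at the ends of a period.  When
    [j] is not the first coordinate, this is the induction hypothesis on each
    slice. *)
Lemma torus_divergence d (j : 'I_d) (g h : 'rV[R]_d -> R) :
  torus_periodic g -> torus_cont h ->
  (forall x, is_derive x (unit_vec j) g (h x)) -> tint h = 0.
Proof.
suff H : torus_periodic g -> torus_cont h ->
    (forall x, is_derive x (unit_vec j) g (h x)) ->
    (\int[torus_measure d]_x (h (torus_pt x))%:E)%E = 0%E.
  by move=> gp hc dg; rewrite /tint /Rintegral H.
elim: d j g h => [[]//|d IH] j g h gp hc dg.
have [M M0 hM] := torus_cont_bounded hc.
case: (unliftP ord0 j) => [i ji|j0].
  rewrite tint_fubini1 // -[RHS](integral0 (@circle_measure R) setT).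
  apply: eq_integral => s _.
  apply: (IH i (fun z => g (cons_rV s z)) (fun z => h (cons_rV s z))).
  - by move=> k z; rewrite -cons_rV_unitS gp.
  - exact: torus_cont_cons.
  - move=> z; apply: is_derive_along (dg (cons_rV s z)) => c.
    by rewrite ji addrC [in RHS]addrC cons_rV_unitS.
rewrite tint_fubini2 // -[RHS](integral0 (@torus_measure R d) setT).
apply: eq_integral => y _.
have sc : continuous (fun s => h (cons_rV s (torus_pt y))).
  by move=> s; exact: (continuous_comp (@cons_rV_continuousl _ _ s) (hc.1 _)).
rewrite (@circle_integral (fun s => h (cons_rV s (torus_pt y))) M) //; last first.
  exact: continuous_measurable_fun.
apply: (@circle_divergence _ (fun s => g (cons_rV s (torus_pt y)))) => //.
- move=> s; apply: is_derive_along (dg (cons_rV s (torus_pt y))) => c.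
  by rewrite j0 [in RHS]addrC cons_rV_unit0 addrC /GRing.scale /= mulr1.
- by rewrite -[in LHS](add0r (2 * pi)) -cons_rV_unit0 -j0 gp.
Qed.

End divergence.

(** * Test functions and trigonometric functions *)

Section test_functions.
Context {R : realType} {d : nat}.
Implicit Types (g h : 'rV[R]_d -> R) (k l : 'rV[int]_d) (j : 'I_d).

Lemma tf_torus_cont g : test_function g -> torus_cont g.
Proof. by move=> [gs gp]; split => // x; exact: (gs 0%N x). Qed.

Lemma tf_cst (c : R) : test_function ((fun=> c) : 'rV[R]_d -> R).
Proof. by split => //; exact: smooth_on_cst. Qed.

Lemma tfD g h : test_function g -> test_function h -> test_function (fun x => g x + h x).
Proof.
move=> [gs gp] [hs hp]; split=> [|j x]; last by rewrite gp hp.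
by apply: smooth_onD => //; exact: openT.
Qed.

Lemma tfM g h : test_function g -> test_function h -> test_function (fun x => g x * h x).
Proof.
move=> [gs gp] [hs hp]; split=> [|j x]; last by rewrite gp hp.
by apply: smooth_onM => //; exact: openT.
Qed.

Lemma tfZ c g : test_function g -> test_function (fun x => c * g x).
Proof. exact/tfM/tf_cst. Qed.

Lemma tf_sum (I : Type) (r : seq I) (P : pred I) (F : I -> 'rV[R]_d -> R) :
  (forall i, P i -> test_function (F i)) -> test_function (fun x => \sum_(i <- r | P i) F i x).
Proof.
move=> Fc; elim: r => [|i r IH].
  by under eq_fun do rewrite big_nil; exact: tf_cst.
under eq_fun do rewrite big_cons.
by case Pi: (P i) => //; apply: tfD => //; exact: Fc.
Qed.

Lemma tf_derivable g j x : test_function g -> derivable g x (unit_vec j).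
Proof. by move=> [gs _]; apply: diff_derivable; exact: smooth_on_diff gs _. Qed.

Lemma tf_is_derive g j x : test_function g ->
  is_derive x (unit_vec j) g (partial j g x).
Proof. by move=> tg; apply: derivableP; exact: tf_derivable. Qed.

Lemma tf_partial g j : test_function g -> test_function (partial j g).
Proof.
move=> [gs gp]; split; first exact: smooth_on_derive.
move=> i x.
have H : is_derive (x + (2 * pi) *: unit_vec i) (unit_vec j) g (partial j g x).
  apply: is_derive_along (tf_is_derive j x (conj gs gp)) => c.
  by rewrite addrA gp.
by have [_ <-] := H.
Qed.

Lemma partialD g h j x : test_function g -> test_function h ->
  partial j (fun x => g x + h x) x = partial j g x + partial j h x.
Proof. by move=> tg th; rewrite /partial deriveD //; exact: tf_derivable. Qed.

Lemma partialM g h j x : test_function g -> test_function h ->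
  partial j (fun x => g x * h x) x = g x * partial j h x + h x * partial j g x.
Proof. by move=> tg th; rewrite /partial deriveM //; exact: tf_derivable. Qed.

Lemma partial_cst c j x : partial j ((fun=> c) : 'rV[R]_d -> R) x = 0.
Proof. exact: derive_cst. Qed.

Lemma partialZ c g j x : test_function g ->
  partial j (fun x => c * g x) x = c * partial j g x.
Proof. by move=> tg; rewrite partialM ?partial_cst ?mulr0 ?addr0 //; exact: tf_cst. Qed.

Lemma partial_sum (I : Type) (r : seq I) (P : pred I) (F : I -> 'rV[R]_d -> R) j x :
  (forall i, P i -> test_function (F i)) ->
  partial j (fun x => \sum_(i <- r | P i) F i x) x = \sum_(i <- r | P i) partial j (F i) x.
Proof.
move=> Fc; elim: r => [|i r IH].
  by under eq_fun do rewrite big_nil; rewrite big_nil partial_cst.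
under eq_fun do rewrite big_cons; rewrite big_cons.
case Pi: (P i) => //; rewrite partialD ?IH //; first exact: Fc.
exact: tf_sum.
Qed.

Lemma tint_partial g j : test_function g -> tint (partial j g) = 0.
Proof.
move=> tg; apply: (@torus_divergence _ _ j g).
- by case: tg.
- exact/tf_torus_cont/tf_partial.
- by move=> x; exact: tf_is_derive.
Qed.

Lemma tint_by_parts g h j : test_function g -> test_function h ->
  tint (fun x => partial j g x * h x) = - tint (fun x => g x * partial j h x).
Proof.
move=> tg th; apply/eqP; rewrite -addr_eq0 -tintD; last 2 first.
- by apply: torus_contM; apply: tf_torus_cont => //; exact: tf_partial.
- by apply: torus_contM; apply: tf_torus_cont => //; exact: tf_partial.
apply/eqP; rewrite -[RHS](tint_partial j (tfM tg th)).
by apply: eq_tint => x; rewrite [RHS]partialM // addrC [partial j g x * _]mulrC.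
Qed.

Lemma phaseD k l x : phase (k + l) x = phase k x + phase l x :> R.
Proof.
by rewrite /phase -big_split; apply: eq_bigr => j _; rewrite !mxE intrD mulrDl.
Qed.

Lemma phaseN k x : phase (- k) x = - phase k x :> R.
Proof.
by rewrite /phase -sumrN; apply: eq_bigr => j _; rewrite !mxE mulrNz mulNr.
Qed.

Lemma phaseB k l x : phase (k - l) x = phase k x - phase l x :> R.
Proof. by rewrite phaseD phaseN. Qed.

Lemma phase0 x : phase (0 : 'rV[int]_d) x = 0 :> R.
Proof. by rewrite /phase big1 // => j _; rewrite !mxE mul0r. Qed.

Lemma phase_shift k x (c : R) j :
  phase k (c *: unit_vec j + x) = c * freq k 0 j + phase k x.
Proof.
rewrite /phase.
transitivity (\sum_i (freq k 0 i * (c * unit_vec j 0 i) + freq k 0 i * x 0 i)).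
  by apply: eq_bigr => i _; rewrite -mulrDr; congr (_ * _); rewrite !mxE.
rewrite big_split /=; congr (_ + _).
rewrite (bigD1 j) //= big1 ?addr0 => [|i ij].
  by rewrite !mxE !eqxx mulr1 mulrC.
by rewrite !mxE (negbTE ij) andbF !mulr0.
Qed.

Definition cosk k : 'rV[R]_d -> R := fun x => cos (phase k x).
Definition sink k : 'rV[R]_d -> R := fun x => sin (phase k x).

Lemma is_derive_affine (a b s : R) : is_derive s 1 (fun s => s * a + b) a.
Proof.
have := @is_deriveD R R R (fun s => s * a) (fun=> b) s 1 a 0.
rewrite addr0; apply.
have -> : (fun s : R => s * a) = a *: id by apply/funext => t; rewrite /= mulrC.
by rewrite -[X in is_derive _ _ _ X]mulr1; exact: is_deriveZ.
Qed.

Lemma phase_smooth k : smooth_on setT (phase k : 'rV[R]_d -> R).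
Proof.
rewrite /phase; apply: smooth_on_sum; first exact: openT.
move=> j; apply: smooth_onM; [exact: openT|exact: smooth_on_cst|].
pose f := fun x : 'rV[R]_d => x 0 j.
have df (x : 'rV[R]_d) : differentiable f x by exact: differentiable_coord.
case=> [|n] /=; first by move=> x _; exact: coord_continuous.
split=> // v.
have -> : 'D_v f = (fun=> v 0 j) :> ('rV[R]_d -> R).
  apply/funext => x; have [_ e] : is_derive x v f (v 0 j); last exact: e.
  apply: (@is_derive_along _ _ R _ f (fun s => s * v 0 j + x 0 j) x v (0:R) 1) => [c|].
    by rewrite /f !mxE /GRing.scale /= mulr1 addr0 addrC.
  exact: is_derive_affine.
exact: class_C_cst.
Qed.

Lemma phase_period k x j : phase k (x + (2 * pi) *: unit_vec j) = phase k x + 2 * pi * (k 0 j)%:~R :> R.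
Proof. by rewrite addrC phase_shift addrC mxE. Qed.

Lemma cosD2pi_int (a : R) (m : int) : cos (a + 2 * pi * m%:~R) = cos a.
Proof.
have H (n : nat) b : cos (b + 2 * pi * n%:R) = cos b :> R.
  elim: n => [|n IH]; first by rewrite mulr0 addr0.
  have -> : n.+1%:R = n%:R + 1 :> R by rewrite natr1.
  by rewrite mulrDr addrA mulr1 [2 * pi]mulr_natl cosD2pi -[pi *+ 2]mulr_natl IH.
case: m => n; first exact: H.
by rewrite NegzE mulrNz mulrN -[in LHS](H n.+1) subrK.
Qed.

Lemma sinD2pi_int (a : R) (m : int) : sin (a + 2 * pi * m%:~R) = sin a.
Proof. by rewrite -!cosBpihalf addrAC cosD2pi_int. Qed.

Lemma tf_cosk k : test_function (cosk k).
Proof.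
split; first by apply: smooth_on_cos; [exact: openT|exact: phase_smooth].
by move=> j x; rewrite /cosk phase_period cosD2pi_int.
Qed.

Lemma tf_sink k : test_function (sink k).
Proof.
split; first by apply: smooth_on_sin; [exact: openT|exact: phase_smooth].
by move=> j x; rewrite /sink phase_period sinD2pi_int.
Qed.

Lemma partial_cosk k j x : partial j (cosk k) x = - (freq k 0 j * sink k x).
Proof.
have [_ e] : is_derive x (unit_vec j) (cosk k) (- (freq k 0 j * sink k x)); last exact: e.
apply: (@is_derive_along _ _ R _ _ (fun s => cos (s * freq k 0 j + phase k x)) x _ (0:R) 1) => [c|].
  by rewrite /cosk phase_shift /GRing.scale /= mulr1 addr0.
have H := @is_derive1_comp R _ _ _ _ _ (is_derive_cos _) (is_derive_affine (freq k 0 j) (phase k x) 0).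
by apply: (is_derive_eq H); rewrite /= mul0r add0r mulNr mulrC.
Qed.

Lemma partial_sink k j x : partial j (sink k) x = freq k 0 j * cosk k x.
Proof.
have [_ e] : is_derive x (unit_vec j) (sink k) (freq k 0 j * cosk k x); last exact: e.
apply: (@is_derive_along _ _ R _ _ (fun s => sin (s * freq k 0 j + phase k x)) x _ (0:R) 1) => [c|].
  by rewrite /sink phase_shift /GRing.scale /= mulr1 addr0.
have H := @is_derive1_comp R _ _ _ _ _ (is_derive_sin _) (is_derive_affine (freq k 0 j) (phase k x) 0).
by apply: (is_derive_eq H); rewrite /= mul0r add0r mulrC.
Qed.

Lemma coskD_sum k l x : cosk k x * cosk l x = 2^-1 * (cosk (k - l) x + cosk (k + l) x).
Proof. rewrite /cosk phaseB phaseD cosB cosD; lra. Qed.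

Lemma sinkD_sum k l x : sink k x * sink l x = 2^-1 * (cosk (k - l) x - cosk (k + l) x).
Proof. rewrite /cosk /sink phaseB phaseD cosB cosD; lra. Qed.

Lemma sinkcosk_sum k l x : sink k x * cosk l x = 2^-1 * (sink (k + l) x + sink (k - l) x).
Proof. rewrite /cosk /sink phaseB phaseD sinB sinD; lra. Qed.

Lemma sinkN k x : sink (- k) x = - sink k x.
Proof. by rewrite /sink phaseN sinN. Qed.

Lemma coskN k x : cosk (- k) x = cosk k x.
Proof. by rewrite /cosk phaseN cosN. Qed.

Lemma cosk0 : cosk 0 = fun=> 1.
Proof. by apply/funext => x; rewrite /cosk phase0 cos0. Qed.

(** For [k_j <> 0] the cosine is the derivative of [sin (k.x) / k_j], whose
    integral vanishes by periodicity. *)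
Lemma tint_cosk k : tint (cosk k) = (2 * pi) ^+ d * (k == 0)%:R.
Proof.
have [->|/eqP k0] := eqVneq k 0; first by rewrite cosk0 tint_cst.
rewrite mulr0.
have [j kj] : exists j, k 0 j != 0.
  by apply: contra_notP k0 => /forallNP H; apply/rowP => j; rewrite mxE; apply/eqP/negPn/negP/H.
rewrite -[RHS](tint_partial j (tfZ (freq k 0 j)^-1 (tf_sink k))).
apply: eq_tint => x; rewrite partialZ ?partial_sink //; last exact: tf_sink.
by rewrite mulrA mulVf ?mul1r // mxE intr_eq0.
Qed.

Lemma tint_sink k : tint (sink k) = 0.
Proof.
have [->|/eqP k0] := eqVneq k 0.
  by rewrite -[RHS](@tint0 R d); apply: eq_tint => x; rewrite /sink phase0 sin0.
have [j kj] : exists j, k 0 j != 0.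
  by apply: contra_notP k0 => /forallNP H; apply/rowP => j; rewrite mxE; apply/eqP/negPn/negP/H.
rewrite -[RHS](tint_partial j (tfZ (- (freq k 0 j)^-1) (tf_cosk k))).
apply: eq_tint => x; rewrite partialZ ?partial_cosk //; last exact: tf_cosk.
by rewrite mulNr mulrN opprK mulrA mulVf ?mul1r // mxE intr_eq0.
Qed.

Let tc := tf_torus_cont.

Lemma tint_coscos k l : tint (fun x => cosk k x * cosk l x) =
  (2 * pi) ^+ d / 2 * ((k == l)%:R + (k == - l)%:R).
Proof.
rewrite (eq_tint (coskD_sum k l)) tintZ; last by apply: torus_contD; exact/tc/tf_cosk.
rewrite tintD; [|exact/tc/tf_cosk|exact/tc/tf_cosk].
by rewrite !tint_cosk subr_eq0 addr_eq0; ring.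
Qed.

Lemma tint_sinsin k l : tint (fun x => sink k x * sink l x) =
  (2 * pi) ^+ d / 2 * ((k == l)%:R - (k == - l)%:R).
Proof.
rewrite (eq_tint (sinkD_sum k l)) tintZ; last by apply: torus_contB; exact/tc/tf_cosk.
rewrite tintB; [|exact/tc/tf_cosk|exact/tc/tf_cosk].
by rewrite !tint_cosk subr_eq0 addr_eq0; ring.
Qed.

Lemma tint_sincos k l : tint (fun x => sink k x * cosk l x) = 0.
Proof.
rewrite (eq_tint (sinkcosk_sum k l)) tintZ; last by apply: torus_contD; exact/tc/tf_sink.
rewrite tintD; [|exact/tc/tf_sink|exact/tc/tf_sink].
by rewrite !tint_sink addr0 mulr0.
Qed.

(** Only resonant triads survive: this decides which waves exchange energy. *)
Lemma tint_sincossin a b c : tint (fun x => sink a x * cosk b x * sink c x) =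
  (2 * pi) ^+ d / 4 * ((a == b + c)%:R + (a + b == c)%:R
     - (a + c == b)%:R - (a + b + c == 0)%:R).
Proof.
have E : (fun x => sink a x * cosk b x * sink c x) =1
    (fun x => 2^-1 * (2^-1 * (cosk (a - c - b) x + cosk (a - c + b) x)
      - 2^-1 * (cosk (a + c - b) x + cosk (a + c + b) x))).
  by move=> x; rewrite mulrAC sinkD_sum -mulrA mulrBl !coskD_sum.
have tck k := tc (tf_cosk k).
rewrite (eq_tint E) tintZ; last first.
  by apply: torus_contB; apply: torus_contZ; exact: torus_contD.
rewrite tintB; [|exact/torus_contZ/torus_contD|exact/torus_contZ/torus_contD].
rewrite !tintZ; [|exact: torus_contD|exact: torus_contD].
rewrite !tintD // !tint_cosk.
have -> : (a - c - b == 0) = (a == b + c) by rewrite -addrA -opprD subr_eq0 addrC.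
have -> : (a - c + b == 0) = (a + b == c) by rewrite addrAC subr_eq0.
have -> : (a + c - b == 0) = (a + c == b) by rewrite subr_eq0.
by rewrite [a + c + b]addrAC; field.
Qed.

End test_functions.

(** * Fourier multipliers and Littlewood-Paley cutoffs *)

Section fourier_multipliers.
Context {R : realType} {d : nat}.
Implicit Types (g h : 'rV[R]_d -> R) (k l : 'rV[int]_d) (m : 'rV[R]_d -> R).

Let tc := @tf_torus_cont R d.

Definition freq_box (n : nat) : seq 'rV[int]_d :=
  undup [seq \row_j ((f j : nat)%:Z - n%:Z) | f : {ffun 'I_d -> 'I_(n + n).+1}].

Lemma mem_freq_box n k : (forall j, `|k 0 j| <= n%:Z) -> k \in freq_box n.
Proof.
move=> kn; rewrite mem_undup; apply/mapP.
exists [ffun j : 'I_d => inord (absz (k 0 j + n%:Z)%R)]; first by rewrite mem_enum.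
apply/rowP => j; rewrite mxE ffunE.
move: (kn j); move: (k 0 j : int) => a H; rewrite inordK; last by lia.
lia.
Qed.

Definition band_limited (n : nat) m := forall k, k \notin freq_box n -> m (freq k) = 0.

Lemma abs_le_enorm p (xi : 'rV[R]_p) j : `|xi 0 j| <= enorm xi.
Proof.
rewrite /enorm -sqrtr_sqr ler_wsqrtr // big_ord1 (bigD1 j) //= lerDl.
by apply: sumr_ge0 => i _; exact: sqr_ge0.
Qed.

Lemma enorm_ge0 p q (A : 'M[R]_(p, q)) : 0 <= enorm A.
Proof. exact: sqrtr_ge0. Qed.

Lemma enormZ p q (c : R) (A : 'M[R]_(p, q)) : enorm (c *: A) = `|c| * enorm A.
Proof.
rewrite /enorm -sqrtr_sqr -sqrtrM ?sqr_ge0 //; congr Num.sqrt.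
rewrite mulr_sumr; apply: eq_bigr => i _; rewrite mulr_sumr; apply: eq_bigr => j _.
by rewrite mxE exprMn.
Qed.

Lemma freqN k : freq (- k) = - freq k :> 'rV[R]_d.
Proof. by apply/rowP => j; rewrite !mxE mulrNz. Qed.

Lemma band_limited_le (Rad : R) m n : Rad <= n%:R ->
  (forall xi, Rad < enorm xi -> m xi = 0) -> band_limited n m.
Proof.
move=> Rn mR k kn; apply: mR; rewrite ltNge; apply: contra kn => kR.
apply: mem_freq_box => j.
rewrite -(ler_int R) intr_norm.
have := abs_le_enorm (freq k) j; rewrite mxE => /le_trans; apply.
exact: le_trans kR Rn.
Qed.

Let c0 : R := ((2 * pi) ^+ d)^-1.

Let pi2_gt0 : (0 : R) < (2 * pi) ^+ d.
Proof. by rewrite exprn_gt0 // mulr_gt0 // pi_gt0. Qed.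

(** The real part of the term of frequency [k] in the Fourier series of [g]. *)
Definition mode_part g k x : R :=
  c0 * (tint (fun y => g y * cosk k y) * cosk k x +
        tint (fun y => g y * sink k y) * sink k x).

Lemma multiplierE n m g x : band_limited n m ->
  multiplier m g x = \sum_(k <- freq_box n) m (freq k) * mode_part g k x.
Proof.
move=> mb; rewrite /multiplier.
set F := (fun k => (m (freq k))%:C * fourier g k * Complex (cos (phase k x)) (sin (phase k x)))%C.
have -> : \sum_(k \in [set: 'rV[int]_d]) F k = \sum_(k <- freq_box n) F k.
  rewrite [RHS]fsbig_seq ?undup_uniq //; apply/esym; apply: fsbig_widen => // k [_ /= kn].
  have k0 : m (freq k) = 0 by apply: mb; apply/negP.
  by rewrite /= /F k0 (_ : (0%:C)%C = 0) // !mul0r.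
have -> (s : seq 'rV[int]_d) : complex.Re (\sum_(k <- s) F k) = \sum_(k <- s) complex.Re (F k).
  elim: s => [|k s IH]; first by rewrite !big_nil.
  by rewrite !big_cons -IH; case: (F k) => ? ?; case: (\sum_(_ <- s) _).
apply: eq_bigr => k _; rewrite /F /fourier /mode_part /= /tint /cosk /sink /c0.
ring.
Qed.

Lemma multiplier_sum n (J : Type) (r : seq J) (mm : J -> 'rV[R]_d -> R) g x :
  (forall j, band_limited n (mm j)) ->
  \sum_(j <- r) multiplier (mm j) g x = multiplier (fun xi => \sum_(j <- r) mm j xi) g x.
Proof.
move=> mb; rewrite (@multiplierE n); last first.
  by move=> k kn; rewrite big1 // => j _; exact: mb.
under eq_bigr do rewrite (@multiplierE n) //.
by rewrite exchange_big; apply: eq_bigr => k _; rewrite mulr_suml.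
Qed.

Lemma tf_mode_part g k : test_function (mode_part g k).
Proof. by apply: tfZ; apply: tfD; apply: tfZ; [exact: tf_cosk|exact: tf_sink]. Qed.

Lemma tf_multiplier n m g : band_limited n m -> test_function (multiplier m g).
Proof.
move=> mb; have -> : multiplier m g = fun x => \sum_(k <- freq_box n) m (freq k) * mode_part g k x.
  by apply/funext => x; exact: multiplierE.
by apply: tf_sum => k _; apply: tfZ; exact: tf_mode_part.
Qed.

Lemma tint_mode_part g h k : torus_cont h ->
  tint (fun x => mode_part g k x * h x) =
  c0 * (tint (fun y => g y * cosk k y) * tint (fun y => h y * cosk k y) +
        tint (fun y => g y * sink k y) * tint (fun y => h y * sink k y)).
Proof.
move=> hc; have Cc := torus_contM hc (tc (tf_cosk k)); have Cs := torus_contM hc (tc (tf_sink k)).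
rewrite -(tintZ (tint (fun y => g y * cosk k y)) Cc).
rewrite -(tintZ (tint (fun y => g y * sink k y)) Cs).
rewrite -tintD; [|exact: torus_contZ|exact: torus_contZ].
rewrite -tintZ; last by apply: torus_contD; exact: torus_contZ.
by apply: eq_tint => x; rewrite /mode_part; ring.
Qed.

(** Each mode contributes a symmetric bilinear form in [g] and [h]. *)
Lemma multiplier_sym n m g h : band_limited n m -> torus_cont g -> torus_cont h ->
  tint (fun x => multiplier m g x * h x) = tint (fun x => g x * multiplier m h x).
Proof.
move=> mb gc hc.
have H g1 h1 : torus_cont h1 -> tint (fun x => multiplier m g1 x * h1 x) =
   \sum_(k <- freq_box n) m (freq k) * tint (fun x => mode_part g1 k x * h1 x).
  move=> hc1; transitivity (tint (fun x => \sum_(k <- freq_box n)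
     m (freq k) * (mode_part g1 k x * h1 x))).
    by apply: eq_tint => x; rewrite (@multiplierE n) // mulr_suml; apply: eq_bigr => k _; rewrite mulrA.
  have C k : torus_cont (fun x => mode_part g1 k x * h1 x).
    by apply: torus_contM => //; exact/tc/tf_mode_part.
  rewrite tint_sum; last by move=> k _; exact: torus_contZ.
  by apply: eq_bigr => k _; rewrite tintZ.
rewrite H //; transitivity (tint (fun x => multiplier m h x * g x)); last first.
  by apply: eq_tint => x; rewrite mulrC.
rewrite H //; apply: eq_bigr => k _; rewrite !tint_mode_part //; ring.
Qed.

(** A sine is carried by two opposite frequencies with opposite weights, and an
    even symbol takes the same value at both. *)
Lemma multiplier_sinpoly n m (I : finType) (kap : I -> 'rV[int]_d) (c : I -> R) x :
  band_limited n m -> (forall xi, m (- xi) = m xi) ->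
  multiplier m (fun y => \sum_i c i * sink (kap i) y) x =
  \sum_i m (freq (kap i)) * c i * sink (kap i) x.
Proof.
move=> mb mN; rewrite (@multiplierE n) //.
have Mc k : mode_part (fun y => \sum_i c i * sink (kap i) y) k x =
   \sum_i c i * mode_part (sink (kap i)) k x.
  rewrite /mode_part.
  have T (h : 'rV[R]_d -> R) : torus_cont h ->
     tint (fun y => (\sum_i c i * sink (kap i) y) * h y) =
     \sum_i c i * tint (fun y => sink (kap i) y * h y).
    move=> hc; transitivity (tint (fun y => \sum_i c i * (sink (kap i) y * h y))).
      by apply: eq_tint => y; rewrite mulr_suml; apply: eq_bigr => i _; rewrite mulrA.
    have C i : torus_cont (fun y => sink (kap i) y * h y).
      by apply: torus_contM => //; exact/tc/tf_sink.
    rewrite tint_sum; last by move=> i _; exact: torus_contZ.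
    by apply: eq_bigr => i _; rewrite tintZ.
  rewrite !T; [|exact/tc/tf_sink|exact/tc/tf_cosk].
  rewrite !mulr_suml -big_split mulr_sumr; apply: eq_bigr => i _ /=; ring.
under eq_bigr do rewrite Mc mulr_sumr.
rewrite exchange_big; apply: eq_bigr => i _ /=.
have -> : m (freq (kap i)) * c i * sink (kap i) x = c i * (m (freq (kap i)) * sink (kap i) x) by ring.
transitivity (c i * \sum_(k <- freq_box n) m (freq k) * mode_part (sink (kap i)) k x).
  by rewrite mulr_sumr; apply: eq_bigr => k _; ring.
congr (_ * _); set K := kap i.
have E k : mode_part (sink K) k x = 2^-1 * ((K == k)%:R - (K == - k)%:R) * sink k x.
  rewrite /mode_part tint_sincos tint_sinsin mul0r add0r !mulrA.
  by rewrite /c0 mulVf ?mul1r // gt_eqF.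
under eq_bigr do rewrite E.
have S k0 (G : 'rV[int]_d -> R) : \sum_(k <- freq_box n) m (freq k) * ((k0 == k)%:R * G k) =
    m (freq k0) * G k0.
  have [kin|kin] := boolP (k0 \in freq_box n).
    rewrite (bigD1_seq k0) ?undup_uniq //= eqxx mul1r big1 ?addr0 // => k.
    by rewrite eq_sym => /negbTE ->; rewrite mul0r mulr0.
  rewrite mb // mul0r big_seq big1 // => k kk.
  by case: eqVneq => [k0k|_]; rewrite ?mul0r ?mulr0 //; rewrite k0k kk in kin.
transitivity (\sum_(k <- freq_box n) m (freq k) * ((K == k)%:R * (2^-1 * sink k x)) -
   \sum_(k <- freq_box n) m (freq k) * ((- K == k)%:R * (2^-1 * sink k x))).
  rewrite -sumrB; apply: eq_bigr => k _; rewrite eqr_oppLR; ring.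
by rewrite !S freqN mN sinkN; field.
Qed.

End fourier_multipliers.

Section littlewood_paley.
Context {R : realType} {d : nat}.
Variable chi : 'rV[R]_d -> R.
Hypothesis hchi : LP_cutoff chi.

Lemma chi_radial (xi eta : 'rV[R]_d) : enorm xi = enorm eta -> chi xi = chi eta.
Proof. by case: hchi => _ H _ _ e; apply/le_anti/andP; split; apply: H; rewrite e. Qed.

Lemma chiN xi : chi (- xi) = chi xi.
Proof. by apply: chi_radial; rewrite -scaleN1r enormZ normrN1 mul1r. Qed.

Lemma chi_itv xi : 0 <= chi xi <= 1.
Proof.
have [_ Hm H1 H0] := hchi.
have [xh|xh] := leP (enorm xi) 2^-1; first by rewrite H1 // ler01 lexx.
have [x1|x1] := leP 1 (enorm xi); first by rewrite H0 // lexx ler01.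
have e0 : enorm xi != 0 by rewrite gt_eqF // (lt_trans _ xh).
have E (c : R) : 0 <= c -> enorm ((c / enorm xi) *: xi) = c.
  by move=> c0; rewrite enormZ normrM normfV !ger0_norm ?enorm_ge0 // mulfVK.
apply/andP; split.
  by rewrite -(H0 ((1 / enorm xi) *: xi)) ?E //; apply: Hm; rewrite E // ltW.
by rewrite -(H1 ((2^-1 / enorm xi) *: xi)) ?E //; apply: Hm; rewrite E // ltW.
Qed.

(** The symbol of the projection to the frequencies below [2^q], in which the
    sum of the dyadic blocks telescopes. *)
Definition LP_low (q : nat) (xi : 'rV[R]_d) : R := chi ((2 ^+ q.+1)^-1 *: xi).

Lemma LP_lowN q xi : LP_low q (- xi) = LP_low q xi.
Proof. by rewrite /LP_low scalerN chiN. Qed.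

Lemma LP_low_itv q xi : 0 <= LP_low q xi <= 1.
Proof. exact: chi_itv. Qed.

Lemma LP_low1 q xi : enorm xi <= 2 ^+ q -> LP_low q xi = 1.
Proof.
move=> xq; have [_ _ H1 _] := hchi; apply: H1.
rewrite enormZ ger0_norm ?invr_ge0 ?exprn_ge0 // mulrC ler_pdivrMr ?exprn_gt0 //.
by rewrite exprS mulKf.
Qed.

Lemma LP_low0 q xi : 2 ^+ q.+1 <= enorm xi -> LP_low q xi = 0.
Proof.
move=> xq; have [_ _ _ H0] := hchi; apply: H0.
by rewrite enormZ ger0_norm ?invr_ge0 ?exprn_ge0 // mulrC ler_pdivlMr ?exprn_gt0 // mul1r.
Qed.

Lemma LP_symbolN q xi : LP_symbol chi q (- xi) = LP_symbol chi q xi.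
Proof. by rewrite /LP_symbol !scalerN !chiN. Qed.

Lemma LP_symbol_nat (q : nat) xi : LP_symbol chi q%:Z xi = LP_low q xi -
  (if q is q'.+1 then LP_low q' xi else chi xi).
Proof.
rewrite /LP_symbol /= scalerA; congr (chi (_ *: _) - _).
  by rewrite -exprnN exprS invfM.
case: q => [|q]; first by rewrite oppr0 expr0z scale1r.
by rewrite -exprnN.
Qed.

Lemma LP_symbol_telescope q xi :
  \sum_(j < q.+2) LP_symbol chi (j%:Z - 1) xi = LP_low q xi.
Proof.
elim: q => [|q IH].
  by rewrite !big_ord_recl big_ord0 /= addr0 (LP_symbol_nat 0) {1}/LP_symbol /= addrC subrK.
rewrite big_ord_recr IH /=.
have -> : q.+2%:Z - 1 = q.+1%:Z by lia.
by rewrite LP_symbol_nat addrC subrK.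
Qed.

Lemma LP_symbol_itv (q : int) xi : -1 <= q -> `|LP_symbol chi q xi| <= 1.
Proof.
case: q => [q|[|q]] // _; last by rewrite /LP_symbol /=; have /andP[? ?] := chi_itv xi; rewrite ger0_norm.
rewrite LP_symbol_nat.
have H z : 0 <= z <= 1 -> `|LP_low q xi - z| <= 1.
  have /andP[? ?] := LP_low_itv q xi.
  by move=> /andP[? ?]; rewrite ler_norml; apply/andP; split; lra.
apply: H; have //: 0 <= (if q is q'.+1 then LP_low q' xi else chi xi) <= 1.
  by case: (q) => [|?]; [exact: chi_itv|exact: LP_low_itv].
Qed.

Lemma LP_symbol_large (q : nat) xi : enorm xi <= 2 ^+ q -> enorm xi <= 2^-1 \/ (0 < q)%N && (enorm xi <= 2 ^+ q.-1) ->
  LP_symbol chi q%:Z xi = 0.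
Proof.
move=> xq H; rewrite LP_symbol_nat LP_low1 //.
case: q xq H => [|q] xq [x1|] //=.
- by have [_ _ -> //] := hchi; rewrite subrr.
- rewrite LP_low1 ?subrr // (le_trans x1) // (@le_trans _ _ 1) //; last by rewrite exprn_ege1 // ler1n.
  by rewrite invf_le1 // ler1n.
- by move=> x2; rewrite LP_low1 ?subrr.
Qed.

(** A radius beyond which the symbols of index at most [q] vanish. *)
Definition LP_band (q : nat) := (2 ^ q.+1)%N.

Lemma LP_low_band q q' : (q <= q')%N -> band_limited (LP_band q') (LP_low q).
Proof.
move=> qq; apply: (@band_limited_le _ _ (2 ^+ q'.+1)); first by rewrite /LP_band natrX.
move=> xi H; apply: LP_low0; apply: le_trans (ltW H).
by rewrite ler_eXn2l // ltr1n.
Qed.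

Lemma LP_symbol_band (q : int) n : q <= n%:Z -> -1 <= q -> band_limited (LP_band n) (LP_symbol chi q).
Proof.
have chib : band_limited (LP_band n) chi.
  apply: (@band_limited_le _ _ 1); first by rewrite ler1n expn_gt0.
  by move=> xi H; have [_ _ _ ->] := hchi => //; exact: ltW.
case: q => [q|[|q]] qn q1 //.
move=> k kn; rewrite LP_symbol_nat (@LP_low_band _ n) ?sub0r //.
case: q qn q1 => [|q] qn q1; first by rewrite chib // oppr0.
by rewrite (@LP_low_band _ n) ?oppr0 //; lia.
Qed.

Lemma LP_leE q (v : 'rV[R]_d -> 'rV[R]_d) x i :
  LP_le chi q v x 0 i = multiplier (LP_low q) (component v i) x.
Proof.
rewrite /LP_le summxE.
transitivity (\sum_(j < q.+2) multiplier (LP_symbol chi (j%:Z - 1)) (component v i) x).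
  by apply: eq_bigr => j _; rewrite mxE.
rewrite (@multiplier_sum _ _ (LP_band q)) => [|j]; last by apply: LP_symbol_band; move: (ltn_ord j); move: (nat_of_ord j) => a; lia.
have -> // : (fun xi => \sum_(j < q.+2) LP_symbol chi (j%:Z - 1) xi) = LP_low q.
by apply/funext => xi; exact: LP_symbol_telescope.
Qed.

End littlewood_paley.

(** * Lebesgue norms, the nonlinear term and the norm of H^-1 *)

Section norms.
Context {R : realType} {d m n : nat}.
Implicit Types w : 'rV[R]_d -> 'M[R]_(m, n).

Definition entries_cont w := forall i j, torus_cont (fun x => w x i j).

Definition sumsq (A : 'M[R]_(m, n)) : R := \sum_i \sum_j A i j ^+ 2.

Lemma sumsq_ge0 A : 0 <= sumsq A.
Proof. by apply: sumr_ge0 => i _; apply: sumr_ge0 => j _; exact: sqr_ge0. Qed.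

Lemma enorm_sqr A : enorm A ^+ 2 = sumsq A.
Proof. by rewrite /enorm sqr_sqrtr // sumsq_ge0. Qed.

Lemma torus_cont_sumsq w : entries_cont w -> torus_cont (fun x => sumsq (w x)).
Proof.
by move=> wc; apply: torus_cont_sum => i _; apply: torus_cont_sum => j _; exact: torus_contM.
Qed.

Lemma torus_cont_enorm w : entries_cont w -> torus_cont (fun x => enorm (w x)).
Proof.
move=> wc; have [sc sp] := torus_cont_sumsq wc; split.
  move=> x; apply: (continuous_comp (sc x)); exact: sqrt_continuous.
by move=> j x; have := sp j x; rewrite /enorm /sumsq => ->.
Qed.

Lemma measurable_enorm w : entries_cont w ->
  measurable_fun setT (fun x : d.-tuple R => enorm (w (torus_pt x))).
Proof. by move=> wc; exact: (measurable_continuous_torus (proj1 (torus_cont_enorm wc))). Qed.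

Lemma Lp_normE (r : R) w : 0 < r ->
  Lp_norm r%:E w = ((\int[torus_measure d]_x ((enorm (w (torus_pt x)) `^ r)%:E)) `^ r^-1)%E.
Proof.
move=> r0; rewrite /Lp_norm unlock; congr (_ `^ _)%E; apply: eq_integral => x _.
by rewrite abse_EFin ger0_norm ?enorm_ge0 // poweR_EFin.
Qed.

Lemma Lp_norm_le (r : R) w (G : 'rV[R]_d -> R) : 0 < r -> entries_cont w -> torus_cont G ->
  (forall x, enorm (w x) `^ r <= G x) -> (Lp_norm r%:E w <= (tint G `^ r^-1)%:E)%E.
Proof.
move=> r0 wc Gc wG; rewrite Lp_normE // -poweR_EFin.
have I0 : (0 <= \int[torus_measure d]_x ((enorm (w (torus_pt x)) `^ r)%:E))%E.
  by apply: integral_ge0 => x _; rewrite lee_fin powR_ge0.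
have G0 : 0 <= tint G by apply: tint_ge0 => x; apply: le_trans (wG x); exact: powR_ge0.
apply: gt0_ler_poweR; rewrite ?invr_ge0 ?(ltW r0) ?in_itv /= ?I0 ?lee_fin ?G0 ?leey //.
rewrite EFin_tint //; apply: ge0_le_integral => //.
- by move=> x _; rewrite lee_fin powR_ge0.
- apply/measurable_EFinP; apply: (measurableT_comp (measurable_powR r)).
  exact: measurable_enorm.
- by apply/measurable_EFinP; apply: measurable_continuous_torus; case: Gc.
- by move=> x _; rewrite lee_fin.
Qed.

Lemma Lp_norm_ge0 p w : (0 <= Lp_norm p w)%E.
Proof. exact: Lnorm_ge0. Qed.

Lemma Lp_normy_le w S : 0 <= S -> (forall x, enorm (w x) <= S) -> (Lp_norm +oo%E w <= S%:E)%E.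
Proof.
move=> S0 wS; rewrite /Lp_norm unlock; case: ifPn => _; last by rewrite lee_fin.
apply/ess_supP; apply: aeW => x /=.
by rewrite lee_fin ger0_norm ?enorm_ge0.
Qed.

Lemma torus_measure_gt0 : (0 < @torus_measure R d setT)%E.
Proof.
have := @torus_measure_setT R d => /= ->; rewrite lte_fin.
by rewrite exprn_gt0 // mulr_gt0 // pi_gt0.
Qed.

Lemma Lp_normZ p (c : R) w : (1 <= p)%E -> entries_cont w ->
  Lp_norm p (fun x => c *: w x) = (`|c|%:E * Lp_norm p w)%E.
Proof.
move=> p1 wc; case: p p1 => [r| _ |//].
  rewrite lee_fin => r1; have r0 : 0 < r by exact: lt_le_trans r1.
  rewrite !Lp_normE //.
  under eq_integral do rewrite enormZ powRM ?enorm_ge0 // EFinM.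
  rewrite ge0_integralZl_EFin ?powR_ge0 //.
  - rewrite poweRM ?lee_fin ?powR_ge0 //; last first.
      by apply: integral_ge0 => x _; rewrite lee_fin powR_ge0.
    by rewrite poweR_EFin -powRrM divff ?gt_eqF // powRr1.
  - by move=> x _; rewrite lee_fin powR_ge0.
  - apply/measurable_EFinP; apply: (measurableT_comp (measurable_powR r)).
    exact: measurable_enorm.
rewrite /Lp_norm unlock torus_measure_gt0.
rewrite -ess_supZl ?torus_measure_gt0 //; congr ess_sup; apply/funext => x /=.
by rewrite -EFinM enormZ normrM normr_id.
Qed.

Lemma Lp_norm2E w : entries_cont w ->
  Lp_norm 2%:E w = (Num.sqrt (tint (fun x => sumsq (w x))))%:E.
Proof.
move=> wc; rewrite Lp_normE // -powR12_sqrt; last by apply: tint_ge0 => x; exact: sumsq_ge0.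
rewrite -poweR_EFin EFin_tint; last exact: torus_cont_sumsq.
congr (_ `^ _)%E; apply: eq_integral => x _.
by rewrite powR_mulrn ?enorm_ge0 // enorm_sqr.
Qed.

Lemma sq_norm2E w : entries_cont w -> sq_norm2 w = tint (fun x => sumsq (w x)).
Proof.
move=> wc; rewrite /sq_norm2 Lp_norm2E //= sqr_sqrtr //.
by apply: tint_ge0 => x; exact: sumsq_ge0.
Qed.

(** [|w|^r <= S^(r - 2) |w|^2]: all the norms with [r >= 2] follow from the
    energy and the supremum. *)
Lemma Lp_norm_interp (r S E : R) w : 2 <= r -> entries_cont w -> 0 <= S ->
  (forall x, enorm (w x) <= S) -> tint (fun x => sumsq (w x)) <= E ->
  (Lp_norm r%:E w <= ((S `^ (r - 2) * E) `^ r^-1)%:E)%E.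
Proof.
move=> r2 wc S0 wS wE; have r0 : 0 < r by apply: lt_le_trans r2.
have sc := torus_cont_sumsq wc.
apply: (le_trans (@Lp_norm_le r w (fun x => S `^ (r - 2) * sumsq (w x)) r0 wc (torus_contZ _ sc) _)).
  move=> x; rewrite -enorm_sqr -powR_mulrn ?enorm_ge0 //.
  have [e0|e0] := eqVneq (enorm (w x)) 0.
    by rewrite e0 powR0 ?gt_eqF // mulr_ge0 ?powR_ge0.
  have -> : enorm (w x) `^ r = enorm (w x) `^ (r - 2) * enorm (w x) `^ 2.
    by rewrite -powRD ?subrK // e0 implybT.
  rewrite ler_wpM2r ?powR_ge0 //; apply: ge0_ler_powR; rewrite ?nnegrE ?enorm_ge0 // subr_ge0 //.
rewrite lee_fin tintZ //; apply: ge0_ler_powR; rewrite ?nnegrE ?invr_ge0 ?(ltW r0) //.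
- by rewrite mulr_ge0 ?powR_ge0 //; apply: tint_ge0 => x; exact: sumsq_ge0.
- rewrite mulr_ge0 ?powR_ge0 //; apply: le_trans wE.
  by apply: tint_ge0 => x; exact: sumsq_ge0.
- by rewrite ler_wpM2l ?powR_ge0.
Qed.

(** [|w|^r <= 1 + |w|^2], and the torus has finite measure. *)
Lemma Lp_norm_low (r E : R) w : 1 <= r <= 2 -> entries_cont w ->
  tint (fun x => sumsq (w x)) <= E ->
  (Lp_norm r%:E w <= (((2 * pi) ^+ d + E) `^ r^-1)%:E)%E.
Proof.
move=> /andP[r1 r2] wc wE; have r0 : 0 < r by apply: lt_le_trans r1.
have sc := torus_cont_sumsq wc.
have c1 : torus_cont (fun _ : 'rV[R]_d => 1 : R) by exact: torus_cont_cst.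
apply: (le_trans (@Lp_norm_le r w (fun x => 1 + sumsq (w x)) r0 wc (torus_contD c1 sc) _)).
  move=> x; have [e1|/ltW e1] := leP (enorm (w x)) 1.
    apply: (@le_trans _ _ 1); last by rewrite lerDl sumsq_ge0.
    have -> : 1 = 1 `^ r :> R by rewrite powR1.
    by apply: ge0_ler_powR; rewrite ?nnegrE ?enorm_ge0 ?(ltW r0).
  apply: (@le_trans _ _ (enorm (w x) `^ 2)); first exact: ler_powR.
  by rewrite powR_mulrn ?enorm_ge0 // enorm_sqr lerDr.
rewrite lee_fin tintD // tint_cst mulr1; apply: ge0_ler_powR.
- by rewrite invr_ge0 ltW.
- rewrite nnegrE addr_ge0 //; first by rewrite exprn_ge0 // mulr_ge0 // pi_ge0.
  by apply: tint_ge0 => x; exact: sumsq_ge0.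
- rewrite nnegrE addr_ge0 //; first by rewrite exprn_ge0 // mulr_ge0 // pi_ge0.
  by apply: le_trans wE; apply: tint_ge0 => x; exact: sumsq_ge0.
- by rewrite lerD2l.
Qed.

End norms.

Section vector_calculus.
Context {R : realType} {d : nat}.
Implicit Types v z : 'rV[R]_d -> 'rV[R]_d.

Definition tf_vec v := forall i, test_function (component v i).
Definition div_free v := forall x, \sum_j partial j (component v j) x = 0.

Let tc := @tf_torus_cont R d.

Lemma tf_convection v a : tf_vec v -> test_function (component (convection v) a).
Proof.
move=> tv; have -> : component (convection v) a =
    fun x => \sum_j component v j x * partial j (component v a) x.
  by apply/funext => x; rewrite /component /convection mxE.
by apply: tf_sum => j _; apply: tfM => //; exact: tf_partial.
Qed.

Lemma div_tensor v a x : tf_vec v -> div_free v ->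
  \sum_j partial j (fun y => v y 0 a * v y 0 j) x = convection v x 0 a.
Proof.
move=> tv dv; rewrite /convection mxE.
transitivity (\sum_j (component v a x * partial j (component v j) x +
   component v j x * partial j (component v a) x)).
  by apply: eq_bigr => j _; rewrite -partialM.
by rewrite big_split /= -mulr_sumr dv mulr0 add0r.
Qed.

Lemma inner_tint v z : inner v z = tint (fun x => \sum_a v x 0 a * z x 0 a).
Proof. by []. Qed.

(** For a divergence-free field, [2 (v.grad v).v = v.grad |v|^2] integrates to
    zero.  In particular the flux of a field through all its frequencies
    vanishes. *)
Lemma convection_orth v : tf_vec v -> div_free v -> inner (convection v) v = 0.
Proof.
move=> tv dv.
pose sq := fun x => \sum_a component v a x * component v a x.
have tsq : test_function sq by apply: tf_sum => a _; exact: tfM.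
have E : 2 * inner (convection v) v = \sum_j tint (fun x => component v j x * partial j sq x).
  rewrite -tint_sum; last by move=> j _; apply/tc/tfM => //; exact: tf_partial.
  rewrite inner_tint -tintZ; last first.
    apply: torus_cont_sum => a _; apply: torus_contM; apply: tc; last exact: tv.
    exact: tf_convection.
  apply: eq_tint => x.
  under [RHS]eq_bigr => j _.
    rewrite partial_sum; last by move=> a _; exact: tfM.
    rewrite mulr_sumr; over.
  rewrite exchange_big mulr_sumr /=; apply: eq_bigr => a _.
  rewrite /convection mxE mulr_suml mulr_sumr; apply: eq_bigr => j _.
  by rewrite partialM // -/(component v j x) -/(component v a x); ring.
have : 2 * inner (convection v) v = 0.
  rewrite E; transitivity (- \sum_j tint (fun x => partial j (component v j) x * sq x)).
    rewrite -sumrN; apply: eq_bigr => j _; rewrite tint_by_parts //; exact/esym/opprK.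
  rewrite -tint_sum; last by move=> j _; apply/tc/tfM => //; exact: tf_partial.
  transitivity (- tint ((fun=> 0) : 'rV[R]_d -> R)); last by rewrite tint0 oppr0.
  congr (- _); apply: eq_tint => x.
  by rewrite -mulr_suml dv mul0r.
by move/eqP; rewrite mulf_eq0 pnatr_eq0 /= => /eqP.
Qed.

Definition lap v : 'rV[R]_d -> 'rV[R]_d :=
  fun x => \row_i \sum_j partial j (partial j (component v i)) x.

Lemma tf_lap v a : tf_vec v -> test_function (component (lap v) a).
Proof.
move=> tv; have -> : component (lap v) a =
    fun x => \sum_j partial j (partial j (component v a)) x.
  by apply/funext => x; rewrite /component /lap mxE.
by apply: tf_sum => j _; do 2!apply: tf_partial.
Qed.

Lemma lap_energy v : tf_vec v ->
  inner v (lap v) = - tint (fun x => sumsq (gradient v x)).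
Proof.
move=> tv.
have C a j : torus_cont (fun x => partial j (component v a) x * partial j (component v a) x).
  by apply: torus_contM; apply/tc/tf_partial.
transitivity (\sum_a \sum_j tint (fun x => component v a x * partial j (partial j (component v a)) x)).
  have C2 a j : torus_cont (fun x => component v a x * partial j (partial j (component v a)) x).
    by apply: torus_contM; apply: tc; [exact: tv|do 2!apply: tf_partial].
  rewrite inner_tint.
  under [RHS]eq_bigr => a _ do rewrite -tint_sum //.
  rewrite -tint_sum; last by move=> a _; exact: torus_cont_sum.
  apply: eq_tint => x; apply: eq_bigr => a _; rewrite mxE mulr_sumr //.
rewrite /sumsq.
transitivity (- \sum_a \sum_j tint (fun x => partial j (component v a) x * partial j (component v a) x)).
  rewrite -sumrN; apply: eq_bigr => a _; rewrite -sumrN; apply: eq_bigr => j _.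
  by rewrite tint_by_parts ?opprK //; exact: tf_partial.
congr (- _); under eq_bigr => a _ do rewrite -tint_sum //.
rewrite -tint_sum; last by move=> a _; exact: torus_cont_sum.
by apply: eq_tint => x; apply: eq_bigr => a _; apply: eq_bigr => j _; rewrite mxE -expr2.
Qed.

Lemma entries_cont_vec v : tf_vec v -> entries_cont v.
Proof. by move=> tv i j; rewrite (ord1 i); exact/tc/tv. Qed.

Lemma entries_cont_gradient v : tf_vec v -> entries_cont (gradient v).
Proof.
move=> tv i j; have -> : (fun x => gradient v x i j) = partial j (component v i).
  by apply/funext => x; rewrite mxE.
exact/tc/tf_partial.
Qed.

(** Young's inequality with a free weight: the optimal [dl] turns the right-hand
    side into a multiple of the product of [S] and of the two [L^2] norms. *)
Lemma convection_bound v z (S dl : R) : tf_vec v -> tf_vec z -> 0 < dl -> 0 <= S ->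
  (forall x i, `|v x 0 i| <= S) ->
  `|inner (convection v) z| <= S / 2 * (dl * tint (fun x => sumsq (gradient v x)) +
     d%:R / dl * tint (fun x => sumsq (z x))).
Proof.
move=> tv tz dl0 S0 vS.
have Cg := torus_cont_sumsq (entries_cont_gradient tv).
have Cz := torus_cont_sumsq (entries_cont_vec tz).
have CB : torus_cont (fun x => \sum_a convection v x 0 a * z x 0 a).
  by apply: torus_cont_sum => a _; apply: torus_contM; apply: tc; [exact: tf_convection|exact: tz].
have P x : `|\sum_a convection v x 0 a * z x 0 a| <=
   S / 2 * (dl * sumsq (gradient v x) + d%:R / dl * sumsq (z x)).
  apply: (le_trans (ler_norm_sum _ _ _)).
  rewrite /sumsq big_ord1 !mulr_sumr -big_split /= mulr_sumr; apply: ler_sum => a _.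
  rewrite /convection mxE mulr_suml.
  apply: (le_trans (ler_norm_sum _ _ _)).
  have -> : dl * (\sum_j gradient v x a j ^+ 2) + d%:R / dl * z x 0 a ^+ 2 =
     \sum_(j < d) (dl * gradient v x a j ^+ 2 + z x 0 a ^+ 2 / dl).
    by rewrite big_split /= -mulr_sumr sumr_const card_ord -mulr_natl; congr (_ + _); ring.
  rewrite mulr_sumr; apply: ler_sum => j _.
  rewrite !normrM mxE -/(partial j (component v a) x).
  set g := partial j (component v a) x; set y := z x 0 a.
  have H : `|g| * `|y| <= 2^-1 * (dl * g ^+ 2 + y ^+ 2 / dl).
    rewrite -(real_normK (num_real g)) -(real_normK (num_real y)).
    move: (`|g|) (`|y|) => G Y.
    have : 0 <= (dl * G - Y) ^+ 2 / dl by rewrite divr_ge0 ?sqr_ge0 // ltW.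
    have -> : (dl * G - Y) ^+ 2 / dl = dl * G ^+ 2 + Y ^+ 2 / dl - 2 * (G * Y).
      by field; rewrite gt_eqF.
    by lra.
  rewrite -mulrA -[S / 2 * _]mulrA ler_pM ?mulr_ge0 //.
have H1 : tint (fun x => S / 2 * (dl * sumsq (gradient v x) + d%:R / dl * sumsq (z x))) =
  S / 2 * (dl * tint (fun x => sumsq (gradient v x)) + d%:R / dl * tint (fun x => sumsq (z x))).
  rewrite tintZ; last by apply: torus_contD; exact: torus_contZ.
  by rewrite tintD ?tintZ //; exact: torus_contZ.
have Cr : torus_cont (fun x => S / 2 * (dl * sumsq (gradient v x) + d%:R / dl * sumsq (z x))).
  by apply: torus_contZ; apply: torus_contD; exact: torus_contZ.
rewrite inner_tint -H1 ler_norml -tintN //; apply/andP; split; apply: le_tint => //.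
- exact: torus_contN.
- by move=> x; have := P x; rewrite ler_norml => /andP[].
- by move=> x; have := P x; rewrite ler_norml => /andP[].
Qed.

End vector_calculus.

Section H_minus_one.
Context {R : realType} {d : nat}.
Implicit Types (g : 'rV[R]_d -> R) (k : 'rV[int]_d).

Let tc := @tf_torus_cont R d.
Let c0 : R := ((2 * pi) ^+ d)^-1.
Let c0_gt0 : 0 < c0.
Proof. by rewrite invr_gt0 exprn_gt0 // mulr_gt0 // pi_gt0. Qed.

Lemma cauchy_schwarz_sum (I : finType) (x y : I -> R) :
  (\sum_i x i * y i) ^+ 2 <= (\sum_i x i ^+ 2) * (\sum_i y i ^+ 2).
Proof.
have H : 0 <= \sum_i \sum_j (x i * y j - x j * y i) ^+ 2.
  by apply: sumr_ge0 => i _; apply: sumr_ge0 => j _; exact: sqr_ge0.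
have E : \sum_i \sum_j (x i * y j - x j * y i) ^+ 2 =
  2 * ((\sum_i x i ^+ 2) * (\sum_i y i ^+ 2)) - 2 * (\sum_i x i * y i) ^+ 2.
  transitivity (\sum_i \sum_j (x i ^+ 2 * y j ^+ 2) + \sum_i \sum_j (y i ^+ 2 * x j ^+ 2)
      - 2 * (\sum_i \sum_j (x i * y i) * (x j * y j))).
    rewrite mulr_sumr -sumrN -!big_split /=; apply: eq_bigr => i _.
    rewrite mulr_sumr -sumrN -!big_split /=; apply: eq_bigr => j _; ring.
  have D (F G : I -> R) : \sum_i \sum_j F i * G j = (\sum_i F i) * (\sum_i G i).
    by rewrite mulr_suml; apply: eq_bigr => i _; rewrite mulr_sumr.
  by rewrite !D; ring.
by move: H; rewrite E; lra.
Qed.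

(** Expand the integral of [(g - S)^2], where [S] is the partial Fourier sum
    over [K].  Since [k] and [-k] give the same real mode, the integral of [S^2]
    is at most the one of [S g], with equality when [K] is symmetric. *)
Lemma bessel (K : seq 'rV[int]_d) g : uniq K -> torus_cont g ->
  \sum_(k <- K) (tint (fun x => g x * cosk k x) ^+ 2 + tint (fun x => g x * sink k x) ^+ 2)
   <= (2 * pi) ^+ d * tint (fun x => g x ^+ 2).
Proof.
move=> uK gc.
pose a k := tint (fun x => g x * cosk k x); pose b k := tint (fun x => g x * sink k x).
rewrite -/a -/b.
pose S x := \sum_(k <- K) mode_part g k x.
have tS : test_function S by apply: tf_sum => k _; exact: tf_mode_part.
have Sc := tc tS.
have gcos k := torus_contM gc (tc (tf_cosk k)); have gsin k := torus_contM gc (tc (tf_sink k)).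
have H h : torus_cont h -> tint (fun x => S x * h x) =
   c0 * \sum_(k <- K) (a k * tint (fun y => h y * cosk k y) + b k * tint (fun y => h y * sink k y)).
  move=> hc; transitivity (\sum_(k <- K) tint (fun x => mode_part g k x * h x)).
    rewrite -tint_sum; last by move=> k _; apply: torus_contM => //; exact/tc/tf_mode_part.
    by apply: eq_tint => x; rewrite mulr_suml.
  by rewrite mulr_sumr; apply: eq_bigr => k _; rewrite tint_mode_part.
have aN k : a (- k) = a k by apply: eq_tint => x; rewrite coskN.
have bN k : b (- k) = - b k.
  by rewrite -tintN //; apply: eq_tint => x; rewrite sinkN mulrN.
have S1 (G : 'rV[int]_d -> R) l : \sum_(k <- K) (l == k)%:R * G k = (l \in K)%:R * G l.
  have [kin|kin] := boolP (l \in K).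
    rewrite (bigD1_seq l) //= eqxx big1 ?addr0 // => k.
    by rewrite eq_sym => /negbTE ->; rewrite mul0r.
  rewrite mul0r big_seq big1 // => k kk.
  by case: eqVneq => [k0k|_]; rewrite ?mul0r //; rewrite k0k kk in kin.
have pi0 : 0 < (2 * pi) ^+ d :> R by rewrite exprn_gt0 // mulr_gt0 // pi_gt0.
have c0E : c0 * (2 * pi) ^+ d = 1 by rewrite mulVf // gt_eqF.
have Scos l : l \in K -> tint (fun x => S x * cosk l x) = 2^-1 * (1 + (- l \in K)%:R) * a l.
  move=> lK; rewrite H; last exact/tc/tf_cosk.
  transitivity (2^-1 * (\sum_(k <- K) (l == k)%:R * a k + \sum_(k <- K) (- l == k)%:R * a k)).
    rewrite -big_split /= !mulr_sumr; apply: eq_bigr => k _.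
    rewrite tint_coscos.
    have -> : tint ((fun x => cosk l x * sink k x) : 'rV[R]_d -> R) = 0.
      by rewrite -[RHS](@tint_sincos R d k l); apply: eq_tint => x; rewrite mulrC.
    by rewrite -eqr_oppLR mulr0 addr0 -[RHS]mul1r -[X in _ = X * _]c0E; ring.
  by rewrite !S1 lK aN mul1r -mulrA mulrDl mul1r.
have Ssin l : l \in K -> tint (fun x => S x * sink l x) = 2^-1 * (1 + (- l \in K)%:R) * b l.
  move=> lK; rewrite H; last exact/tc/tf_sink.
  transitivity (2^-1 * (\sum_(k <- K) (l == k)%:R * b k - \sum_(k <- K) (- l == k)%:R * b k)).
    rewrite -sumrB /= !mulr_sumr; apply: eq_bigr => k _.
    by rewrite tint_sinsin tint_sincos -eqr_oppLR -[RHS]mul1r -[X in _ = X * _]c0E; ring.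
  by rewrite !S1 lK bN mul1r mulrN opprK -mulrA mulrDl mul1r.
pose Q := \sum_(k <- K) (a k ^+ 2 + b k ^+ 2).
have SgE : tint (fun x => S x * g x) = c0 * Q.
  by rewrite H //; congr (_ * _); apply: eq_bigr => k _; rewrite !expr2.
have SSE : tint (fun x => S x * S x) <= c0 * Q.
  rewrite H //; rewrite ler_wpM2l ?(ltW c0_gt0) // big_seq [leRHS]big_seq.
  apply: ler_sum => k kK; rewrite Scos // Ssin //.
  have : 0 <= a k ^+ 2 by exact: sqr_ge0.
  have : 0 <= b k ^+ 2 by exact: sqr_ge0.
  by case: (- k \in K); rewrite /= ?mulr1n; nra.
have : 0 <= tint (fun x => (g x - S x) ^+ 2) by apply: tint_ge0 => x; exact: sqr_ge0.
have -> : tint (fun x => (g x - S x) ^+ 2) =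
   tint (fun x => g x ^+ 2) - 2 * tint (fun x => S x * g x) + tint (fun x => S x * S x).
  have C1 : torus_cont (fun x => g x ^+ 2) by exact: torus_contM.
  have C2 := torus_contM Sc gc. have C3 := torus_contM Sc Sc.
  rewrite -tintZ // -tintB //; last exact: torus_contZ.
  rewrite -tintD //; last by apply: torus_contB => //; exact: torus_contZ.
  by apply: eq_tint => x; ring.
rewrite SgE => P; have : c0 * Q <= tint (fun x => g x ^+ 2) by lra.
by rewrite -ler_pdivlMl // invrK.
Qed.

Lemma fourier_div_bound (G : 'I_d -> 'rV[R]_d -> R) k :
  (forall j, test_function (G j)) ->
  complex.Re (fourier (fun x => \sum_j partial j (G j) x) k) ^+ 2 +
  complex.Im (fourier (fun x => \sum_j partial j (G j) x) k) ^+ 2 <=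
  c0 ^+ 2 * enorm (freq k) ^+ 2 *
   \sum_j (tint (fun x => G j x * cosk k x) ^+ 2 + tint (fun x => G j x * sink k x) ^+ 2).
Proof.
move=> tG.
have ReE : complex.Re (fourier (fun x => \sum_j partial j (G j) x) k) =
   c0 * \sum_j freq k 0 j * tint (fun x => G j x * sink k x).
  rewrite /= -/c0; congr (_ * _).
  transitivity (tint (fun x => (\sum_j partial j (G j) x) * cosk k x)); first by [].
  transitivity (tint (fun x => \sum_j partial j (G j) x * cosk k x)).
    by apply: eq_tint => x; rewrite mulr_suml.
  have C j : torus_cont (fun x => partial j (G j) x * cosk k x).
    by apply: torus_contM; apply: tc; [exact: tf_partial|exact: tf_cosk].
  rewrite tint_sum //; apply: eq_bigr => j _.
  rewrite tint_by_parts //; last exact: tf_cosk.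
  rewrite -tintN; last by apply: torus_contM; apply: tc => //; apply: tf_partial; exact: tf_cosk.
  rewrite -tintZ; last by apply: torus_contM; apply: tc => //; exact: tf_sink.
  by apply: eq_tint => x; rewrite partial_cosk; ring.
have ImE : complex.Im (fourier (fun x => \sum_j partial j (G j) x) k) =
   c0 * \sum_j freq k 0 j * tint (fun x => G j x * cosk k x).
  rewrite /= -/c0 -mulrN; congr (_ * _).
  transitivity (- tint (fun x => (\sum_j partial j (G j) x) * sink k x)); first by [].
  transitivity (- tint (fun x => \sum_j partial j (G j) x * sink k x)).
    by congr (- _); apply: eq_tint => x; rewrite mulr_suml.
  have C j : torus_cont (fun x => partial j (G j) x * sink k x).
    by apply: torus_contM; apply: tc; [exact: tf_partial|exact: tf_sink].
  rewrite tint_sum // -sumrN; apply: eq_bigr => j _.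
  rewrite tint_by_parts //; last exact: tf_sink.
  rewrite opprK -tintZ; last by apply: torus_contM; apply: tc => //; exact: tf_cosk.
  by apply: eq_tint => x; rewrite partial_sink; ring.
rewrite ReE ImE !exprMn -mulrDr -mulrA ler_wpM2l ?sqr_ge0 //.
rewrite enorm_sqr /sumsq big_ord1 big_split /= mulrDr addrC.
by apply: lerD; exact: cauchy_schwarz_sum.
Qed.

(** The weight of [H^(-1)] absorbs the factor [|k|^2] that the derivative produces
    in the squared Fourier coefficients; Bessel's inequality bounds what is
    left. *)
Lemma Hm1_norm_div (f : 'rV[R]_d -> 'rV[R]_d) (G : 'I_d -> 'I_d -> 'rV[R]_d -> R) :
  (forall i j, test_function (G i j)) ->
  (forall i x, component f i x = \sum_j partial j (G i j) x) ->
  (Hm1_norm f <= (Num.sqrt (c0 * \sum_i \sum_j tint (fun x => G i j x ^+ 2)))%:E)%E.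
Proof.
move=> tG fG.
have B0 : 0 <= c0 * \sum_i \sum_j tint (fun x => G i j x ^+ 2).
  rewrite mulr_ge0 ?(ltW c0_gt0) // sumr_ge0 // => i _; rewrite sumr_ge0 // => j _.
  by apply: tint_ge0 => x; exact: sqr_ge0.
rewrite /Hm1_norm -powR12_sqrt // -poweR_EFin.
have e0 : (0 <= \esum_(k in [set: 'rV[int]_d])
     ((1 + enorm (freq k : 'rV[R]_d) ^+ 2)^-1 *
      \sum_i (complex.Re (fourier (component f i) k) ^+ 2 +
              complex.Im (fourier (component f i) k) ^+ 2))%:E)%E.
  apply: esum_ge0 => k _; rewrite lee_fin mulr_ge0 //.
    by rewrite invr_ge0 addr_ge0 // sqr_ge0.
  by rewrite sumr_ge0 // => i _; rewrite addr_ge0 // sqr_ge0.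
apply: gt0_ler_poweR; rewrite ?invr_ge0 ?in_itv /= ?e0 ?lee_fin ?leey ?B0 //.
apply: ge_ereal_sup => _ [K [fK _] <-].
rewrite fsbig_finite //= sumEFin lee_fin.
set s := (X in \sum_(i <- X) _).
have us : uniq s by exact: finmap.fset_uniq.
apply: (@le_trans _ _ (\sum_(k <- s) c0 ^+ 2 * \sum_i \sum_j
  (tint (fun x => G i j x * cosk k x) ^+ 2 + tint (fun x => G i j x * sink k x) ^+ 2))).
  apply: ler_sum => k _.
  set N2 := enorm _ ^+ 2.
  have N0 : 0 <= N2 by exact: sqr_ge0.
  rewrite ler_pdivrMl ?ltr_pwDl //.
  rewrite mulr_sumr mulr_sumr; apply: ler_sum => i _.
  have -> : component f i = (fun x => \sum_j partial j (G i j) x) by apply/funext => x; exact: fG.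
  apply: (le_trans (fourier_div_bound _ _)); first exact: tG.
  rewrite [leRHS]mulrA; apply: ler_wpM2r.
    by rewrite sumr_ge0 // => j _; rewrite addr_ge0 // sqr_ge0.
  rewrite [leRHS]mulrC; apply: ler_wpM2l; first exact: sqr_ge0.
  by rewrite lerDr.
rewrite -mulr_sumr expr2 -mulrA ler_wpM2l ?(ltW c0_gt0) //.
rewrite exchange_big mulr_sumr /=; apply: ler_sum => i _.
rewrite exchange_big mulr_sumr /=; apply: ler_sum => j _.
rewrite /c0 ler_pdivrMl; first by apply: bessel => //; exact/tc/tG.
by rewrite -invr_gt0.
Qed.

End H_minus_one.

(** * Sine flows *)

Section sine_flows.
Context {R : realType} {d : nat} {I : finType}.
Variable kap : I -> 'rV[int]_d.
Implicit Types M : I -> 'M[R]_d.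

Let tc := @tf_torus_cont R d.
Let P : R := (2 * pi) ^+ d.
Definition dotv (x y : 'rV[R]_d) : R := \sum_a x 0 a * y 0 a.

Definition amp M i : 'rV[R]_d := \row_a \sum_b M i a b * freq (kap i) 0 b.

(** The amplitude of the wave [i] is [M_i k_i] with [M_i] antisymmetric, hence
    orthogonal to the frequency [k_i], which makes the flow divergence free.  The
    matrices [M_i] are also the amplitudes of a potential [spot] with divergence
    [sflow], smaller by a factor of the order of the frequency. *)
Definition sflow M (x : 'rV[R]_d) : 'rV[R]_d := \row_a \sum_i amp M i 0 a * sink (kap i) x.

Definition spot M a b (x : 'rV[R]_d) : R := \sum_i - M i a b * cosk (kap i) x.

Definition antisym M := forall i a b, M i a b = - M i b a.

(** Makes the sines of the waves orthogonal, and their cosines as well. *)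
Definition wave_separated := injective kap /\ forall i j, kap i + kap j != 0.

Lemma sflow_comp M a : component (sflow M) a = fun x => \sum_i amp M i 0 a * sink (kap i) x.
Proof. by apply/funext => x; rewrite /component mxE. Qed.

Lemma tf_sflow M : tf_vec (sflow M).
Proof.
by move=> a; rewrite sflow_comp; apply: tf_sum => i _; apply: tfZ; exact: tf_sink.
Qed.

Lemma ampZ M (c : I -> R) i : amp (fun i => c i *: M i) i = c i *: amp M i.
Proof.
apply/rowP => a; rewrite !mxE mulr_sumr; apply: eq_bigr => b _.
by rewrite mxE mulrA.
Qed.

Lemma amp_orth M i : antisym M -> dotv (amp M i) (freq (kap i)) = 0.
Proof.
move=> aM; rewrite /dotv.
have E : \sum_a amp M i 0 a * freq (kap i) 0 a = - \sum_a amp M i 0 a * freq (kap i) 0 a.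
  transitivity (\sum_a \sum_b M i a b * freq (kap i) 0 b * freq (kap i) 0 a).
    by apply: eq_bigr => a _; rewrite mxE mulr_suml.
  rewrite exchange_big -sumrN; apply: eq_bigr => a _ /=.
  rewrite [amp M i 0 a]mxE mulr_suml -sumrN; apply: eq_bigr => b _.
  by rewrite aM; ring.
by apply/eqP; rewrite -[_ == 0](mulrn_eq0 _ 2) mulr2n {1}E addNr.
Qed.

Lemma partial_sflow M a b x : partial b (component (sflow M) a) x =
  \sum_i amp M i 0 a * freq (kap i) 0 b * cosk (kap i) x.
Proof.
rewrite sflow_comp partial_sum; last by move=> i _; apply: tfZ; exact: tf_sink.
by apply: eq_bigr => i _; rewrite partialZ ?partial_sink ?mulrA //; exact: tf_sink.
Qed.

Lemma div_free_sflow M : antisym M -> div_free (sflow M).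
Proof.
move=> aM x; under eq_bigr do rewrite partial_sflow.
rewrite exchange_big big1 // => i _ /=.
by rewrite -mulr_suml -/(dotv _ _) amp_orth // mul0r.
Qed.

Lemma tf_spot M a b : test_function (spot M a b).
Proof. by apply: tf_sum => i _; apply: tfZ; exact: tf_cosk. Qed.

Lemma sflow_spot M a x : component (sflow M) a x = \sum_b partial b (spot M a b) x.
Proof.
rewrite sflow_comp; under [RHS]eq_bigr => b _.
  rewrite partial_sum; last by move=> i _; apply: tfZ; exact: tf_cosk.
  over.
rewrite exchange_big /=; apply: eq_bigr => i _; rewrite mxE mulr_suml; apply: eq_bigr => b _.
by rewrite partialZ ?partial_cosk; [ring|exact: tf_cosk].
Qed.

Lemma abs_sink k (x : 'rV[R]_d) : `|sink k x| <= 1.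
Proof. by rewrite ler_norml /sink sin_geN1 sin_le1. Qed.

Lemma sflow_le M S x a : (\sum_i `|amp M i 0 a| <= S) -> `|sflow M x 0 a| <= S.
Proof.
move=> MS; rewrite mxE; apply: le_trans MS; apply: (le_trans (ler_norm_sum _ _ _)).
by apply: ler_sum => i _; rewrite normrM ler_piMr // abs_sink.
Qed.

Lemma parseval_sin (c : I -> R) : wave_separated ->
  tint (fun x => (\sum_i c i * sink (kap i) x) ^+ 2) = P / 2 * \sum_i c i ^+ 2.
Proof.
move=> [kinj ksep].
have C i j : torus_cont (fun x => c i * c j * (sink (kap i) x * sink (kap j) x)).
  by apply: torus_contZ; apply: torus_contM; exact/tc/tf_sink.
transitivity (\sum_i \sum_j tint (fun x => c i * c j * (sink (kap i) x * sink (kap j) x))).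
  under [RHS]eq_bigr => i _ do rewrite -tint_sum //.
  rewrite -tint_sum; last by move=> i _; exact: torus_cont_sum.
  apply: eq_tint => x; rewrite expr2 mulr_suml; apply: eq_bigr => i _.
  by rewrite mulr_sumr; apply: eq_bigr => j _; ring.
rewrite mulr_sumr; apply: eq_bigr => i _.
rewrite (bigD1 i) //= big1 ?addr0 => [|j ji].
  rewrite tintZ; last by apply: torus_contM; exact/tc/tf_sink.
  by rewrite tint_sinsin eqxx -addr_eq0 (negbTE (ksep _ _)) /P subr0 mulr1; ring.
rewrite tintZ; last by apply: torus_contM; exact/tc/tf_sink.
by rewrite tint_sinsin (inj_eq kinj) eq_sym (negbTE ji) -addr_eq0 (negbTE (ksep _ _)) subrr !mulr0.
Qed.

Lemma parseval_cos (c : I -> R) : wave_separated ->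
  tint (fun x => (\sum_i c i * cosk (kap i) x) ^+ 2) = P / 2 * \sum_i c i ^+ 2.
Proof.
move=> [kinj ksep].
have C i j : torus_cont (fun x => c i * c j * (cosk (kap i) x * cosk (kap j) x)).
  by apply: torus_contZ; apply: torus_contM; exact/tc/tf_cosk.
transitivity (\sum_i \sum_j tint (fun x => c i * c j * (cosk (kap i) x * cosk (kap j) x))).
  under [RHS]eq_bigr => i _ do rewrite -tint_sum //.
  rewrite -tint_sum; last by move=> i _; exact: torus_cont_sum.
  apply: eq_tint => x; rewrite expr2 mulr_suml; apply: eq_bigr => i _.
  by rewrite mulr_sumr; apply: eq_bigr => j _; ring.
rewrite mulr_sumr; apply: eq_bigr => i _.
rewrite (bigD1 i) //= big1 ?addr0 => [|j ji].
  rewrite tintZ; last by apply: torus_contM; exact/tc/tf_cosk.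
  by rewrite tint_coscos eqxx -addr_eq0 (negbTE (ksep _ _)) /P addr0 mulr1; ring.
rewrite tintZ; last by apply: torus_contM; exact/tc/tf_cosk.
by rewrite tint_coscos (inj_eq kinj) eq_sym (negbTE ji) -addr_eq0 (negbTE (ksep _ _)) addr0 !mulr0.
Qed.

Lemma sflow_energy M : wave_separated ->
  tint (fun x => sumsq (sflow M x)) = P / 2 * \sum_i \sum_a amp M i 0 a ^+ 2.
Proof.
move=> ks.
have C a : torus_cont (fun x => component (sflow M) a x ^+ 2).
  by apply: torus_contM; apply/tc/tf_sflow.
transitivity (\sum_a tint (fun x => component (sflow M) a x ^+ 2)).
  by rewrite -tint_sum //; apply: eq_tint => x; rewrite /sumsq big_ord1.
rewrite exchange_big mulr_sumr /=; apply: eq_bigr => a _.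
by rewrite -parseval_sin //; apply: eq_tint => x; rewrite sflow_comp.
Qed.

Lemma sflow_enstrophy M : wave_separated ->
  tint (fun x => sumsq (gradient (sflow M) x)) =
  P / 2 * \sum_i \sum_a \sum_b (amp M i 0 a * freq (kap i) 0 b) ^+ 2.
Proof.
move=> ks.
have C a b : torus_cont (fun x => partial b (component (sflow M) a) x ^+ 2).
  by apply: torus_contM; apply/tc/tf_partial/tf_sflow.
transitivity (\sum_a \sum_b tint (fun x => partial b (component (sflow M) a) x ^+ 2)).
  under [RHS]eq_bigr => a _ do rewrite -tint_sum //.
  rewrite -tint_sum; last by move=> a _; exact: torus_cont_sum.
  by apply: eq_tint => x; apply: eq_bigr => a _; apply: eq_bigr => b _; rewrite mxE.
rewrite [X in _ = _ * X]exchange_big mulr_sumr /=; apply: eq_bigr => a _.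
rewrite [X in _ = _ * X]exchange_big mulr_sumr /=; apply: eq_bigr => b _.
by rewrite -parseval_cos //; apply: eq_tint => x; rewrite partial_sflow.
Qed.

Lemma spot_energy M a b : wave_separated ->
  tint (fun x => spot M a b x ^+ 2) = P / 2 * \sum_i M i a b ^+ 2.
Proof.
by move=> ks; rewrite parseval_cos //; congr (_ * _); apply: eq_bigr => i _; rewrite sqrrN.
Qed.

Lemma sflow_multiplier n m M a x : band_limited n m -> (forall xi, m (- xi) = m xi) ->
  multiplier m (component (sflow M) a) x = sflow (fun i => m (freq (kap i)) *: M i) x 0 a.
Proof.
move=> mb mN; rewrite sflow_comp (@multiplier_sinpoly _ _ n) // mxE.
apply: eq_bigr => i _; congr (_ * _).
by have /rowP/(_ a) := ampZ M (fun i => m (freq (kap i))) i; rewrite [X in _ = X -> _]mxE.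
Qed.

(** The projection acts on both factors of the flux.  Being symmetric it may be
    moved from the first factor to the second, where it rescales the amplitudes
    a second time. *)
Lemma sflow_flux chi q M : LP_cutoff chi ->
  flux chi q (sflow M) = inner (convection (sflow M))
    (sflow (fun i => (LP_low chi q (freq (kap i)) ^+ 2) *: M i)).
Proof.
move=> hchi; set U := sflow M; rewrite /flux !inner_tint.
have lb : band_limited (LP_band q) (LP_low chi q) by exact: LP_low_band.
have lN := LP_lowN hchi q.
have tB a : test_function (component (convection U) a) by apply: tf_convection; exact: tf_sflow.
pose U1 := sflow (fun i => LP_low chi q (freq (kap i)) *: M i).
have U1E x a : LP_le chi q U x 0 a = U1 x 0 a.
  by rewrite (LP_leE hchi) (sflow_multiplier _ _ _ lb).
have Cl a : torus_cont (fun x => multiplier (LP_low chi q) (component (convection U) a) x * U1 x 0 a).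
  apply: torus_contM; apply: tc; first exact: tf_multiplier lb.
  exact: (tf_sflow _ a).
transitivity (\sum_a tint (fun x => multiplier (LP_low chi q) (component (convection U) a) x * U1 x 0 a)).
  rewrite -tint_sum //; apply: eq_tint => x; apply: eq_bigr => a _.
  by rewrite U1E (LP_leE hchi).
rewrite -tint_sum //; rewrite tint_sum //.
pose U2 := sflow (fun i => LP_low chi q (freq (kap i)) ^+ 2 *: M i).
have Cr a : torus_cont (fun x => component (convection U) a x * U2 x 0 a).
  by apply: torus_contM; apply: tc => //; exact: (tf_sflow _ a).
rewrite [RHS](_ : _ = \sum_a tint (fun x => component (convection U) a x * U2 x 0 a)); last first.
  by rewrite -tint_sum //.
apply: eq_bigr => a _.
rewrite (multiplier_sym lb) //; [|exact: tc|exact/tc/(tf_sflow _ a)].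
apply: eq_tint => x; congr (_ * _).
rewrite -/(component U1 a) (sflow_multiplier _ _ _ lb) // /U2 !mxE; apply: eq_bigr => i _.
by rewrite !ampZ !mxE mulrA expr2.
Qed.

Lemma triad_sum M M' :
  inner (convection (sflow M)) (sflow M') =
  P / 4 * \sum_i \sum_j \sum_k dotv (amp M i) (freq (kap j)) * dotv (amp M j) (amp M' k) *
    ((kap i == kap j + kap k)%:R + (kap i + kap j == kap k)%:R
     - (kap i + kap k == kap j)%:R - (kap i + kap j + kap k == 0)%:R).
Proof.
rewrite inner_tint.
pose T i j k := dotv (amp M i) (freq (kap j)) * dotv (amp M j) (amp M' k).
have C i j k : torus_cont (fun x : 'rV[R]_d => sink (kap i) x * cosk (kap j) x * sink (kap k) x).
  by apply: torus_contM; [apply: torus_contM|]; apply: tc; [exact: tf_sink|exact: tf_cosk|exact: tf_sink].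
transitivity (\sum_i \sum_j \sum_k tint (fun x => T i j k * (sink (kap i) x * cosk (kap j) x * sink (kap k) x))).
  have C1 i j k : torus_cont (fun x => T i j k * (sink (kap i) x * cosk (kap j) x * sink (kap k) x)).
    exact: torus_contZ.
  pose F i j k x := T i j k * (sink (kap i) x * cosk (kap j) x * sink (kap k) x).
  transitivity (\sum_i tint (fun x => \sum_j \sum_k F i j k x)); last first.
    apply: eq_bigr => i _.
    have CF j : torus_cont (fun x => \sum_k F i j k x) by apply: torus_cont_sum => k _; exact: C1.
    rewrite tint_sum //; apply: eq_bigr => j _.
    by rewrite tint_sum // => k _; exact: C1.
  have CF i : torus_cont (fun x => \sum_j \sum_k F i j k x).
    by apply: torus_cont_sum => j _; apply: torus_cont_sum => k _; exact: C1.
  rewrite -tint_sum //; apply: eq_tint => x.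
  transitivity (\sum_a \sum_b (\sum_i amp M i 0 b * sink (kap i) x) *
     (\sum_j amp M j 0 a * freq (kap j) 0 b * cosk (kap j) x) * (\sum_k amp M' k 0 a * sink (kap k) x)).
    apply: eq_bigr => a _; rewrite !mxE mulr_suml; apply: eq_bigr => b _.
    by rewrite partial_sflow mxE.
  transitivity (\sum_a \sum_b \sum_i \sum_j \sum_k
    (amp M i 0 b * freq (kap j) 0 b * (amp M j 0 a * amp M' k 0 a) * (sink (kap i) x * cosk (kap j) x * sink (kap k) x))).
    apply: eq_bigr => a _; apply: eq_bigr => b _.
    rewrite mulr_suml mulr_suml; apply: eq_bigr => i _.
    rewrite -mulrA mulr_suml mulr_sumr; apply: eq_bigr => j _.
    by rewrite !mulr_sumr; apply: eq_bigr => k _; ring.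
  under eq_bigr => a _ do rewrite exchange_big.
  rewrite exchange_big; apply: eq_bigr => i _ /=.
  under eq_bigr => a _ do rewrite exchange_big.
  rewrite exchange_big; apply: eq_bigr => j _ /=.
  under eq_bigr => a _ do rewrite exchange_big.
  rewrite exchange_big; apply: eq_bigr => k _ /=.
  rewrite /T /dotv mulrC [X in _ = X * _]mulrC mulr_suml -mulrC mulr_suml; apply: eq_bigr => a _.
  by rewrite mulr_sumr mulr_suml; apply: eq_bigr => b _; ring.
rewrite mulr_sumr; apply: eq_bigr => i _; rewrite mulr_sumr; apply: eq_bigr => j _.
rewrite mulr_sumr; by apply: eq_bigr => k _; rewrite tintZ // tint_sincossin /T mulrCA.
Qed.

Lemma tint_sink_lap k (phi : 'rV[R]_d -> R) : test_function phi ->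
  tint (fun x => sink k x * (\sum_j partial j (partial j phi) x)) =
  - enorm (freq k : 'rV[R]_d) ^+ 2 * tint (fun x => sink k x * phi x).
Proof.
move=> tphi.
have C j : torus_cont (fun x => sink k x * partial j (partial j phi) x).
  by apply: torus_contM; apply: tc; [exact: tf_sink|do 2!apply: tf_partial].
transitivity (\sum_j tint (fun x => sink k x * partial j (partial j phi) x)).
  by rewrite -tint_sum //; apply: eq_tint => x; rewrite mulr_sumr.
rewrite enorm_sqr /sumsq big_ord1 -sumrN mulr_suml; apply: eq_bigr => j _.
have t1 := tf_sink k (R := R); have t2 := tf_cosk k (R := R).
have t3 := tf_partial j tphi.
rewrite -[LHS]opprK -tint_by_parts //.
have C2 : torus_cont (fun x => cosk k x * partial j phi x) by apply: torus_contM; exact: tc.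
transitivity (- (freq k 0 j * tint (fun x => cosk k x * partial j phi x))).
  by rewrite -tintZ //; congr (- _); apply: eq_tint => x; rewrite partial_sink mulrA.
have C3 : torus_cont (fun x => sink k x * phi x) by apply: torus_contM; exact: tc.
rewrite -[X in _ * X]opprK -tint_by_parts //.
have -> : tint (fun x => partial j (cosk k) x * phi x) = - freq k 0 j * tint (fun x => sink k x * phi x).
  by rewrite -tintZ //; apply: eq_tint => x; rewrite partial_cosk; ring.
by ring.
Qed.

End sine_flows.

(** * A flow with two clusters of frequencies *)

Section three_coordinates.
Context {T : nmodType} {d : nat}.

Definition i0 : 'I_d.+3 := @Ordinal d.+3 0 isT.
Definition i1 : 'I_d.+3 := @Ordinal d.+3 1 isT.
Definition i2 : 'I_d.+3 := @Ordinal d.+3 2 isT.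

Lemma sum3 (F : 'I_d.+3 -> T) : (forall j, j != i0 -> j != i1 -> j != i2 -> F j = 0) ->
  \sum_j F j = F i0 + F i1 + F i2.
Proof.
move=> H; rewrite (bigD1 i0) //= (bigD1 i1) //= (bigD1 i2) //= big1 ?addr0 ?addrA //.
by move=> j /andP[/andP[? ?] ?]; exact: H.
Qed.

Definition vec3 (a b c : T) : 'rV[T]_d.+3 :=
  \row_j (if j == i0 then a else if j == i1 then b else if j == i2 then c else 0).

Lemma vec3_0 a b c : vec3 a b c 0 i0 = a. Proof. by rewrite mxE. Qed.
Lemma vec3_1 a b c : vec3 a b c 0 i1 = b. Proof. by rewrite mxE. Qed.
Lemma vec3_2 a b c : vec3 a b c 0 i2 = c. Proof. by rewrite mxE. Qed.
Lemma vec3_else a b c j : j != i0 -> j != i1 -> j != i2 -> vec3 a b c 0 j = 0.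
Proof. by rewrite mxE; do 3!case: eqP. Qed.

Lemma vec3P (x y : 'rV[T]_d.+3) : (forall j, j != i0 -> j != i1 -> j != i2 -> x 0 j = y 0 j) ->
  x 0 i0 = y 0 i0 -> x 0 i1 = y 0 i1 -> x 0 i2 = y 0 i2 -> x = y.
Proof.
move=> H H0 H1 H2; apply/rowP => j.
have [->//|j0] := eqVneq j i0; have [->//|j1] := eqVneq j i1.
by have [->//|j2] := eqVneq j i2; exact: H.
Qed.

End three_coordinates.

Section three_coordinates_real.
Context {R : realType} {d : nat}.

Lemma freq_vec3 (a b c : int) : freq (vec3 a b c : 'rV[int]_d.+3) = vec3 (a%:~R : R) b%:~R c%:~R.
Proof. by apply/rowP => j; rewrite !mxE; do 3!case: eqP => //. Qed.

Lemma dotv_vec3 (a b c a' b' c' : R) :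
  dotv (vec3 a b c : 'rV[R]_d.+3) (vec3 a' b' c') = a * a' + b * b' + c * c'.
Proof.
rewrite /dotv sum3 ?vec3_0 ?vec3_1 ?vec3_2 // => j j0 j1 j2.
by rewrite vec3_else // mul0r.
Qed.

Lemma sumsq_vec3 (a b c : R) : sumsq (vec3 a b c : 'rV[R]_d.+3) = a ^+ 2 + b ^+ 2 + c ^+ 2.
Proof.
rewrite /sumsq big_ord1 sum3 ?vec3_0 ?vec3_1 ?vec3_2 // => j j0 j1 j2.
by rewrite vec3_else // expr0n.
Qed.

Definition skew (i j : 'I_d.+3) : 'M[R]_d.+3 := delta_mx i j - delta_mx j i.

Lemma skew_apply i j (x : 'rV[R]_d.+3) a :
  \sum_b skew i j a b * x 0 b = (a == i)%:R * x 0 j - (a == j)%:R * x 0 i.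
Proof.
have D (k l : 'I_d.+3) : \sum_b delta_mx k l a b * x 0 b = (a == k)%:R * x 0 l.
  rewrite (bigD1 l) //= big1 ?addr0 => [|b bl]; first by rewrite mxE eqxx andbT.
  by rewrite mxE (negbTE bl) andbF mul0r.
by rewrite -!D -sumrB; apply: eq_bigr => b _; rewrite !mxE mulrBl.
Qed.

Lemma skew_antisym i j a b : skew i j a b = - skew i j b a.
Proof. by rewrite !mxE opprB ![(a == _) && _]andbC. Qed.

End three_coordinates_real.

Section cluster_flow.
Context {R : realType} {d : nat}.
Variables (N lam h : nat).
Hypotheses (N0 : (0 < N)%N) (Nlam : (4 * N <= lam)%N) (lamh : (2 * lam <= h)%N).

Local Notation box n := ('I_n * 'I_n * 'I_n)%type.
(** The low waves have their frequencies in a box of side [N] at [lam e_1].  The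
    high waves form two boxes: one of side [N] at [h e_2], and one of side [2 N] at
    [lam e_1 + h e_2], large enough to contain all the sums of a low frequency and
    a frequency of the first high box. *)
Definition modes : finType := (box N + (box N + box (N + N)))%type.

Definition cc0 (i : modes) : nat := match i with
  | inl k => k.1.1 | inr (inl k) => k.1.1 | inr (inr k) => k.1.1 end.
Definition cc1 (i : modes) : nat := match i with
  | inl k => (lam + k.1.2)%N | inr (inl k) => k.1.2 | inr (inr k) => (lam + k.1.2)%N end.
Definition cc2 (i : modes) : nat := match i with
  | inl k => k.2 | inr (inl k) => (h + k.2)%N | inr (inr k) => (h + k.2)%N end.

Definition ckap (i : modes) : 'rV[int]_d.+3 := vec3 (cc0 i)%:Z (cc1 i)%:Z (cc2 i)%:Z.

Definition is_low (i : modes) := if i is inl _ then true else false.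

Lemma cc_bounds i : [/\ (cc0 i < N + N)%N, (cc1 i < lam + N + N)%N, (cc2 i < h + N + N)%N &
   if is_low i then [/\ (cc0 i < N)%N, (lam <= cc1 i)%N, (cc1 i < lam + N)%N & (cc2 i < N)%N] else (h <= cc2 i)%N].
Proof.
by case: i => [[[k0 k1] k2]|[[[k0 k1] k2]|[[k0 k1] k2]]] /=;
  have := ltn_ord k0; have := ltn_ord k1; have := ltn_ord k2; move=> *; split=> //; (try split); lia.
Qed.

Lemma csep : wave_separated ckap.
Proof.
split.
  have H (i j : modes) : ckap i = ckap j -> [/\ cc0 i = cc0 j, cc1 i = cc1 j & cc2 i = cc2 j].
    by move=> /rowP E; have := E i0; have := E i1; have := E i2;
      rewrite !vec3_0 !vec3_1 !vec3_2 => -[->] [->] [->].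
  move=> i j /H [].
  case: i => [[[k0 k1] k2]|[[[k0 k1] k2]|[[k0 k1] k2]]];
  case: j => [[[l0 l1] l2]|[[[l0 l1] l2]|[[l0 l1] l2]]] /=;
  have := ltn_ord k0; have := ltn_ord k1; have := ltn_ord k2;
  have := ltn_ord l0; have := ltn_ord l1; have := ltn_ord l2 => ? ? ? ? ? ? E0 E1 E2; try (exfalso; lia).
  - by congr inl; congr (_, _, _); apply: val_inj => /=; lia.
  - by congr (inr (inl _)); congr (_, _, _); apply: val_inj => /=; lia.
  - by congr (inr (inr _)); congr (_, _, _); apply: val_inj => /=; lia.
move=> i j; apply/eqP => /rowP E; have := E i1; have := E i2; rewrite !mxE /=.
case: i {E} => [[[k0 k1] k2]|[[[k0 k1] k2]|[[k0 k1] k2]]];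
  case: j => [[[l0 l1] l2]|[[[l0 l1] l2]|[[l0 l1] l2]]] /=; lia.
Qed.

Lemma card_modes : #|{: modes}| = (10 * N ^ 3)%N.
Proof. rewrite !card_sum !card_prod !card_ord; nia. Qed.

Lemma sum_modes_le (F : modes -> R) (B : R) : (forall i, F i <= B) ->
  \sum_i F i <= 10 * N%:R ^+ 3 * B.
Proof.
move=> FB; apply: (@le_trans _ _ (\sum_(i : modes) B)); first exact: ler_sum.
by rewrite sumr_const card_modes -[B *+ _]mulr_natl natrM natrX.
Qed.

Lemma cfreq i : freq (ckap i) = vec3 ((cc0 i)%:R : R) (cc1 i)%:R (cc2 i)%:R.
Proof. exact: freq_vec3. Qed.

Lemma enorm_cfreq i : enorm (freq (ckap i) : 'rV[R]_d.+3) ^+ 2 = ((cc0 i) ^ 2 + (cc1 i) ^ 2 + (cc2 i) ^ 2)%:R.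
Proof. by rewrite enorm_sqr cfreq sumsq_vec3 !natrD !natrX. Qed.

Lemma enorm_ge_of (c : nat) i : (c ^ 2 <= (cc0 i) ^ 2 + (cc1 i) ^ 2 + (cc2 i) ^ 2)%N ->
  c%:R <= enorm (freq (ckap i) : 'rV[R]_d.+3).
Proof.
move=> H; rewrite -(@ler_pXn2r _ 2) ?nnegrE ?enorm_ge0 // enorm_cfreq -natrX ler_nat //.
Qed.

Lemma enorm_low i : is_low i ->
  lam%:R <= enorm (freq (ckap i) : 'rV[R]_d.+3) <= lam%:R + 3 * N%:R.
Proof.
move=> li; have [_ _ _] := cc_bounds i; rewrite li => -[b0 b1 b2 b3].
apply/andP; split; first by apply: enorm_ge_of; nia.
have -> : lam%:R + 3 * N%:R = (lam + 3 * N)%:R :> R by rewrite natrD natrM.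
rewrite -(@ler_pXn2r _ 2) ?nnegrE ?enorm_ge0 // enorm_cfreq -natrX ler_nat; nia.
Qed.

Let lamR : (0 : R) < lam%:R. Proof. by rewrite ltr0n; lia. Qed.
Let hR : (0 : R) < h%:R. Proof. by rewrite ltr0n; lia. Qed.
Let NR : (0 : R) < N%:R. Proof. by rewrite ltr0n. Qed.
Let N3R : (0 : R) < N%:R ^+ 3. Proof. by rewrite exprn_gt0. Qed.

(** The offset [lam e_1] is orthogonal to [h e_2] and only lengthens the
    frequency by the order of [lam^2 / h]. *)
Lemma enorm_high i : ~~ is_low i ->
  h%:R <= enorm (freq (ckap i) : 'rV[R]_d.+3) <= h%:R + 2 * N%:R + 2 * lam%:R ^+ 2 / h%:R.
Proof.
move=> /negbTE li; have [b0 b1 b2] := cc_bounds i; rewrite li => b3.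
apply/andP; split; first by apply: enorm_ge_of; nia.
have X0 : 0 <= h%:R + 2 * N%:R + 2 * lam%:R ^+ 2 / h%:R :> R.
  by rewrite !addr_ge0 ?mulr_ge0 ?invr_ge0 ?exprn_ge0.
rewrite -(@ler_pXn2r _ 2) ?nnegrE ?enorm_ge0 ?X0 // enorm_cfreq.
have e0 : (cc0 i)%:R <= 2 * N%:R :> R by rewrite -natrM ler_nat; lia.
have e1 : (cc1 i)%:R <= lam%:R + 2 * N%:R :> R by rewrite -natrM -natrD ler_nat; lia.
have e2 : (cc2 i)%:R <= h%:R + 2 * N%:R :> R by rewrite -natrM -natrD ler_nat; lia.
have e4 : 4 * N%:R <= lam%:R :> R by rewrite -natrM ler_nat.
rewrite !natrD !natrX.
have f0 : (cc0 i)%:R ^+ 2 <= (lam%:R / 2) ^+ 2 :> R.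
  by rewrite ler_pXn2r ?nnegrE ?divr_ge0 //; lra.
have f1 : (cc1 i)%:R ^+ 2 <= (lam%:R * 3 / 2) ^+ 2 :> R.
  by rewrite ler_pXn2r ?nnegrE ?divr_ge0 ?mulr_ge0 //; lra.
have f2 : (cc2 i)%:R ^+ 2 <= (h%:R + 2 * N%:R) ^+ 2 :> R.
  by rewrite ler_pXn2r ?nnegrE ?addr_ge0 ?mulr_ge0.
set X := h%:R + 2 * N%:R in f2 *.
have Y0 : 0 <= 2 * lam%:R ^+ 2 / h%:R :> R by rewrite !mulr_ge0 ?invr_ge0 ?exprn_ge0.
have XY : 2 * lam%:R ^+ 2 <= X * (2 * lam%:R ^+ 2 / h%:R).
  have -> : X * (2 * lam%:R ^+ 2 / h%:R) = X / h%:R * (2 * lam%:R ^+ 2).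
    by field; rewrite gt_eqF.
  by rewrite ler_peMl ?mulr_ge0 ?exprn_ge0 // ler_pdivlMr // mul1r /X lerDl mulr_ge0.
rewrite sqrrD; set Y := 2 * lam%:R ^+ 2 / h%:R in Y0 XY *.
have Y2 : 0 <= Y ^+ 2 by exact: sqr_ge0.
have E : (lam%:R / 2) ^+ 2 + (lam%:R * 3 / 2) ^+ 2 = 5 / 2 * lam%:R ^+ 2 :> R by field.
have L0 : 0 <= lam%:R ^+ 2 :> R by exact: sqr_ge0.
move: XY L0 E f0 f1 f2 Y2; rewrite -mulr_natr; move: (lam%:R ^+ 2 : R) (X * Y) => L Z; lra.
Qed.

Lemma enorm_all i : lam%:R <= enorm (freq (ckap i) : 'rV[R]_d.+3) <= 2 * h%:R.
Proof.
have [b0 b1 b2 bb] := cc_bounds i.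
apply/andP; split; first by apply: enorm_ge_of; case: (is_low i) bb => [[]|] *; nia.
rewrite -natrM -(@ler_pXn2r _ 2) ?nnegrE ?enorm_ge0 // enorm_cfreq -natrX ler_nat.
have c0 : (cc0 i <= N + N)%N by lia.
have c1 : (2 * cc1 i <= 3 * lam)%N by lia.
have c2 : (8 * cc2 i <= 10 * h)%N by lia.
nia.
Qed.

Variable a : R.
Hypothesis a0 : 0 < a.

Let al : R := a / (lam%:R * N%:R ^+ 3).
Let be : R := a / (h%:R * N%:R ^+ 3).

(** The low waves point almost along [e_0] and vary along [e_1], a shear; the
    high ones point almost along [e_0 + e_1], so that their Reynolds stress
    [w_0 w_1] works on this shear.  With the factors [1 / lam] and [1 / h], which
    compensate for the lengths of the frequencies, every wave has an amplitude of
    the order of [a / N^3]. *)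
Definition cM (i : modes) : 'M[R]_d.+3 :=
  if is_low i then al *: skew i0 i1 else be *: (skew i0 i2 + skew i1 i2).

Definition cflow : 'rV[R]_d.+3 -> 'rV[R]_d.+3 := sflow ckap cM.

Lemma cM_antisym : antisym cM.
Proof.
move=> i u v; rewrite /cM; case: ifP => _.
  by rewrite !mxE -mulrN; congr (_ * _); have := skew_antisym i0 i1 u v (R := R); rewrite !mxE.
have E (A B : 'M[R]_d.+3) x y : (be *: (A + B)) x y = be * (A x y + B x y) by rewrite !mxE.
by rewrite !E (skew_antisym i0 i2 u v) (skew_antisym i1 i2 u v) -opprD mulrN.
Qed.

Lemma camp_low i : is_low i -> amp ckap cM i = vec3 (al * (cc1 i)%:R) (- (al * (cc0 i)%:R)) 0.
Proof.
move=> li; apply/rowP => u; rewrite mxE /cM li.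
transitivity (al * \sum_b skew i0 i1 u b * freq (ckap i) 0 b).
  by rewrite mulr_sumr; apply: eq_bigr => b _; rewrite [X in X * _ = _]mxE mulrA.
rewrite skew_apply cfreq vec3_0 vec3_1 mxE.
have [->|u0] := eqVneq u i0; first by rewrite mul1r mul0r subr0.
have [_|u1] := eqVneq u i1; first by rewrite mul0r mul1r sub0r mulrN.
by rewrite !mul0r subr0 mulr0 if_same.
Qed.

Lemma camp_high i : ~~ is_low i -> amp ckap cM i =
  vec3 (be * (cc2 i)%:R) (be * (cc2 i)%:R) (- (be * ((cc0 i)%:R + (cc1 i)%:R))).
Proof.
move=> /negbTE li; apply/rowP => u; rewrite mxE /cM li.
transitivity (be * (\sum_b skew i0 i2 u b * freq (ckap i) 0 b + \sum_b skew i1 i2 u b * freq (ckap i) 0 b)).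
  rewrite -big_split mulr_sumr; apply: eq_bigr => b _.
  by rewrite [X in X * _ = _]mxE [X in _ * X * _ = _]mxE /= -mulrA mulrDl.
rewrite !skew_apply cfreq vec3_0 vec3_1 vec3_2 mxE.
have [->|u0] := eqVneq u i0; first by rewrite /= mul1r !mul0r !subr0 addr0.
have [->|u1] := eqVneq u i1; first by rewrite /= mul1r !mul0r !subr0 add0r.
have [_|u2] := eqVneq u i2; first by rewrite /= !mul1r !mul0r !sub0r -opprD mulrN.
by rewrite !mul0r subr0 addr0 mulr0.
Qed.

Let al0 : 0 < al. Proof. by rewrite divr_gt0 // mulr_gt0. Qed.
Let be0 : 0 < be. Proof. by rewrite divr_gt0 // mulr_gt0. Qed.

Lemma amp_bound i u : `|amp ckap cM i 0 u| <= 2 * a / N%:R ^+ 3.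
Proof.
have [b0 b1 b2 bb] := cc_bounds i.
have alE : al * (2 * lam%:R) = 2 * a / N%:R ^+ 3 by rewrite /al; field; rewrite !gt_eqF.
have beE : be * (2 * h%:R) = 2 * a / N%:R ^+ 3 by rewrite /be; field; rewrite !gt_eqF.
have B0 : 0 <= 2 * a / N%:R ^+ 3 by rewrite !mulr_ge0 ?invr_ge0 // ltW.
have [li|li] := boolP (is_low i).
  move: bb; rewrite li camp_low // mxE => -[c0 c1 c2 c3].
  have H (c : nat) : (c <= 2 * lam)%N -> `|al * c%:R| <= 2 * a / N%:R ^+ 3.
    move=> cl; rewrite (ger0_norm (mulr_ge0 (ltW al0) (ler0n _ _))).
    by rewrite -alE ler_wpM2l ?(ltW al0) // -natrM ler_nat.
  case: ifP => _; first by apply: H; lia.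
  case: ifP => _; first by rewrite normrN; apply: H; lia.
  by rewrite if_same normr0.
move: bb; rewrite (negbTE li) camp_high // mxE => c0.
have H (c : nat) : (c <= 2 * h)%N -> `|be * c%:R| <= 2 * a / N%:R ^+ 3.
  move=> cl; rewrite (ger0_norm (mulr_ge0 (ltW be0) (ler0n _ _))).
  by rewrite -beE ler_wpM2l ?(ltW be0) // -natrM ler_nat.
case: ifP => _; first by apply: H; lia.
case: ifP => _; first by apply: H; lia.
case: ifP => _; last by rewrite normr0.
by rewrite normrN -natrD; apply: H; lia.
Qed.

Lemma pot_bound i u v : `|cM i u v| <= 2 * a / (lam%:R * N%:R ^+ 3).
Proof.
have sk (k l : 'I_d.+3) : `|skew k l u v : R| <= 1.
  by rewrite !mxE; do 2!case: (_ && _); rewrite ?subrr ?subr0 ?sub0r ?normrN ?normr1 ?normr0.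
have beal : be <= al.
  rewrite /al /be ler_wpM2l ?(ltW a0) // lef_pV2 ?posrE ?mulr_gt0 // ler_wpM2r ?(ltW N3R) //.
  by rewrite ler_nat; lia.
have -> : 2 * a / (lam%:R * N%:R ^+ 3) = 2 * al by rewrite /al mulrA.
rewrite /cM; case: ifP => _; rewrite mxE normrM gtr0_norm //.
  have := sk i0 i1; move: (`|_|) => x; move: al0; nra.
have : `|(skew i0 i2 + skew i1 i2 : 'M[R]_d.+3) u v| <= 2.
  by rewrite mxE (le_trans (ler_normD _ _)) // -[2]/(1 + 1) lerD.
have : 0 <= `|(skew i0 i2 + skew i1 i2 : 'M[R]_d.+3) u v| by [].
move: (`|_|) => x; move: al0 be0 beal; nra.
Qed.

End cluster_flow.

(** * Size of the cluster flow and transfer of energy *)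

Section cluster_bounds.
Context {R : realType} {d : nat}.
Variables (N lam h : nat) (a : R).
Hypotheses (N0 : (0 < N)%N) (Nlam : (4 * N <= lam)%N) (lamh : (2 * lam <= h)%N) (a0 : 0 < a).

Local Notation modes := (modes N).
Local Notation cM := (@cM R d N lam h a).
Local Notation ckap := (@ckap d N lam h).
Local Notation U := (@cflow R d N lam h a).
Local Notation A := (amp ckap cM).
Let P : R := (2 * pi) ^+ d.+3.
Let P0 : 0 < P. Proof. by rewrite exprn_gt0 // mulr_gt0 // pi_gt0. Qed.
Let D : R := d.+3%:R.
Let lamR : (0 : R) < lam%:R. Proof. by rewrite ltr0n; lia. Qed.
Let hR : (0 : R) < h%:R. Proof. by rewrite ltr0n; lia. Qed.
Let NR : (0 : R) < N%:R. Proof. by rewrite ltr0n. Qed.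
Let N3R : (0 : R) < N%:R ^+ 3. Proof. by rewrite exprn_gt0. Qed.
Let al : R := a / (lam%:R * N%:R ^+ 3).
Let be : R := a / (h%:R * N%:R ^+ 3).

Let csep := @csep d N lam h N0 Nlam lamh.
Let amp_bound := @amp_bound R d N lam h N0 Nlam lamh a a0.
Let sum_modes_le := sum_modes_le (R := R) N0 Nlam lamh.

Lemma amp_sum_le u : \sum_i `|A i 0 u| <= 20 * a.
Proof.
apply: (le_trans (sum_modes_le (fun i => amp_bound i u))).
rewrite le_eqVlt; apply/orP; left; apply/eqP; field; by rewrite gt_eqF.
Qed.

Lemma cflow_sup x u : `|U x 0 u| <= 20 * a.
Proof. exact/sflow_le/amp_sum_le. Qed.

(** About [N^3] waves of squared amplitude [(a / N^3)^2]. *)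
Lemma amp_energy_le (c : modes -> R) (e : R) : (forall i, `|c i| <= e) ->
  \sum_i \sum_u amp ckap (fun i => c i *: cM i) i 0 u ^+ 2 <= 40 * D * e ^+ 2 * (a ^+ 2 / N%:R ^+ 3).
Proof.
move=> ce; have -> : 40 * D * e ^+ 2 * (a ^+ 2 / N%:R ^+ 3) =
   10 * N%:R ^+ 3 * (D * (e * (2 * a / N%:R ^+ 3)) ^+ 2).
  by field; rewrite gt_eqF.
apply: sum_modes_le => i.
apply: (@le_trans _ _ (\sum_(u < d.+3) (e * (2 * a / N%:R ^+ 3)) ^+ 2)).
  apply: ler_sum => u _; rewrite (ampZ ckap cM c) mxE.
  rewrite -[leLHS]real_normK ?num_real // ler_pXn2r ?nnegrE //.
    by rewrite normrM; apply: ler_pM.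
  by apply: le_trans (ler_pM _ _ (ce i) (amp_bound i u)); rewrite ?mulr_ge0.
by rewrite sumr_const card_ord -[X in X <= _]mulr_natl.
Qed.

Lemma scaled_energy (c : modes -> R) (e : R) : (forall i, `|c i| <= e) ->
  tint (fun x => sumsq (sflow ckap (fun i => c i *: cM i) x)) <=
  20 * D * P * e ^+ 2 * (a ^+ 2 / N%:R ^+ 3).
Proof.
move=> ce; rewrite sflow_energy //.
have := amp_energy_le ce; set X := (X in X <= _); set Y := a ^+ 2 / _ => H.
have -> : 20 * D * P * e ^+ 2 * Y = P / 2 * (40 * D * e ^+ 2 * Y) by field.
by rewrite ler_pM2l // divr_gt0.
Qed.

Lemma cflow_energy : tint (fun x => sumsq (U x)) <= 20 * D * P * (a ^+ 2 / N%:R ^+ 3).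
Proof.
have c1 (i : modes) : `|1 : R| <= 1 by rewrite normr1.
have := scaled_energy c1; rewrite expr1n mulr1; apply: le_trans.
rewrite le_eqVlt; apply/orP; left; apply/eqP; apply: eq_tint => x; congr sumsq.
by congr (sflow _ _ x); apply/funext => i; rewrite scale1r.
Qed.

Lemma cflow_enstrophy : tint (fun x => sumsq (gradient U x)) <=
  80 * D ^+ 2 * P * h%:R ^+ 2 * (a ^+ 2 / N%:R ^+ 3).
Proof.
rewrite sflow_enstrophy //.
have -> : 80 * D ^+ 2 * P * h%:R ^+ 2 * (a ^+ 2 / N%:R ^+ 3) =
   P / 2 * (10 * N%:R ^+ 3 * (D * (D * ((2 * a / N%:R ^+ 3) * (2 * h%:R)) ^+ 2))).
  by field; rewrite gt_eqF.
rewrite ler_pM2l ?divr_gt0 //; apply: sum_modes_le => i.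
apply: (@le_trans _ _ (\sum_(u < d.+3) \sum_(v < d.+3) ((2 * a / N%:R ^+ 3) * (2 * h%:R)) ^+ 2)).
  apply: ler_sum => u _; apply: ler_sum => v _.
  rewrite -[leLHS]real_normK ?num_real // ler_pXn2r ?nnegrE //; last first.
    by rewrite mulr_ge0 // (le_trans _ (amp_bound i u)).
  rewrite normrM ler_pM //; have /andP[_] := enorm_all N0 Nlam lamh i (R := R) (d := d).
  by apply: le_trans; exact: abs_le_enorm.
by rewrite !sumr_const !card_ord -[X in X *+ _]mulr_natl -[X in X <= _]mulr_natl.
Qed.

Lemma cpot_energy u v : tint (fun x => spot ckap cM u v x ^+ 2) <=
  20 * P * (a ^+ 2 / (lam%:R ^+ 2 * N%:R ^+ 3)).
Proof.
rewrite spot_energy //.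
have -> : 20 * P * (a ^+ 2 / (lam%:R ^+ 2 * N%:R ^+ 3)) =
   P / 2 * (10 * N%:R ^+ 3 * (2 * a / (lam%:R * N%:R ^+ 3)) ^+ 2).
  by field; rewrite !gt_eqF.
rewrite ler_pM2l ?divr_gt0 //; apply: sum_modes_le => i.
rewrite -[leLHS]real_normK ?num_real // ler_pXn2r ?nnegrE //.
- exact: pot_bound.
- by apply: le_trans (pot_bound N0 Nlam lamh a0 i u v).
Qed.

Definition low_flow := sflow ckap (fun i => (if is_low i then 1 else 0 : R) *: cM i).
(** The rate at which the nonlinear term drains energy from the low waves. *)
Definition transfer : R := - inner (convection U) low_flow.

Local Notation box := ('I_N * 'I_N * 'I_N)%type.

Let ltnDD (i j : 'I_N) : (i + j < N + N)%N.
Proof. by have := ltn_ord i; have := ltn_ord j; lia. Qed.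

Let lo (p : box) : modes := inl p.
Let hi (q : box) : modes := inr (inl q).
Let hi2 (q : 'I_(N + N) * 'I_(N + N) * 'I_(N + N)) : modes := inr (inr q).
Let sum_box (q p : box) : 'I_(N + N) * 'I_(N + N) * 'I_(N + N) :=
  (Ordinal (ltnDD q.1.1 p.1.1), Ordinal (ltnDD q.1.2 p.1.2), Ordinal (ltnDD q.2 p.2)).

Let addE (x y : 'rV[int]_d.+3) u : (x + y) 0 u = x 0 u + y 0 u.
Proof. by rewrite mxE. Qed.

Let ckap_eq (i j k : modes) : ckap i = ckap j + ckap k <->
  [/\ cc0 i = (cc0 j + cc0 k)%N, cc1 lam i = (cc1 lam j + cc1 lam k)%N & cc2 h i = (cc2 h j + cc2 h k)%N].
Proof.
split=> [/rowP E|[E0 E1 E2]].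
  have := E i0; have := E i1; have := E i2.
  rewrite !addE !vec3_0 !vec3_1 !vec3_2; split; lia.
apply: vec3P => [l l0 l1 l2|||]; rewrite addE.
- by rewrite !vec3_else // addr0.
- by rewrite !vec3_0 E0 PoszD.
- by rewrite !vec3_1 E1 PoszD.
- by rewrite !vec3_2 E2 PoszD.
Qed.

Let ckap_sum_box q p q' : (ckap (hi2 q') == ckap (hi q) + ckap (lo p)) = (q' == sum_box q p).
Proof.
apply/eqP/eqP => [/ckap_eq [] /=|->]; last by apply/ckap_eq; split => /=; lia.
case: q' => [[a1 a2] a3] /= ? ? ?.
by congr (_, _, _); apply: val_inj => /=; lia.
Qed.

Let ckap_neq i j k : (cc1 lam i != cc1 lam j + cc1 lam k)%N || (cc2 h i != cc2 h j + cc2 h k)%N ->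
  (ckap i == ckap j + ckap k) = false.
Proof. by move=> H; apply/negbTE/eqP => /ckap_eq[_ E1 E2]; move: H; rewrite E1 E2 !eqxx. Qed.

Let ckap_neq0 i j p : (ckap i + ckap j + ckap (lo p) == 0) = false.
Proof.
apply/negbTE/eqP => /rowP /(_ i1); rewrite !mxE /=.
by case: p => [[p0 p1] p2] /=; lia.
Qed.

(** The coefficient of the triad [(i, j, k)] in the work of the nonlinear
    term. *)
Let dlt (i j k : modes) : R :=
  (ckap i == ckap j + ckap k)%:R + (ckap i + ckap j == ckap k)%:R
     - (ckap i + ckap k == ckap j)%:R - (ckap i + ckap j + ckap k == 0)%:R.

Let dlt_main q p q' : dlt (hi2 q') (hi q) (lo p) = (q' == sum_box q p)%:R.
Proof.
have E2 : (ckap (lo p) == ckap (hi2 q') + ckap (hi q)) = false.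
  by apply: ckap_neq; move: p q' q => [[? ?] p2] [[? ?] ?] [[? ?] ?] /=; have := ltn_ord p2; lia.
have E3 : (ckap (hi q) == ckap (hi2 q') + ckap (lo p)) = false.
  by apply: ckap_neq; move: p q' q {E2} => [[? ?] p2] [[? ?] ?] [[? q1] ?] /=; have := ltn_ord q1; lia.
rewrite /dlt ckap_sum_box ckap_neq0 [ckap _ + ckap _ == ckap (lo p)]eq_sym E2.
by rewrite [_ == ckap (hi q)]eq_sym E3 !subr0 addr0.
Qed.

Let dlt_main2 q p q' : dlt (hi q) (hi2 q') (lo p) = - (q' == sum_box q p)%:R.
Proof.
have E2 : (ckap (lo p) == ckap (hi q) + ckap (hi2 q')) = false.
  by apply: ckap_neq; move: p q' q => [[? ?] p2] [[? ?] ?] [[? ?] ?] /=; have := ltn_ord p2; lia.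
have E3 : (ckap (hi q) == ckap (hi2 q') + ckap (lo p)) = false.
  by apply: ckap_neq; move: p q' q {E2} => [[? ?] p2] [[? ?] ?] [[? q1] ?] /=; have := ltn_ord q1; lia.
rewrite /dlt E3 ckap_neq0 [ckap _ + ckap _ == ckap (lo p)]eq_sym E2.
by rewrite [_ == ckap (hi2 q')]eq_sym ckap_sum_box subr0 !add0r.
Qed.

Let dlt0 i j p : match i, j with
  | inr (inr _), inr (inl _) | inr (inl _), inr (inr _) => True | _, _ => dlt i j (lo p) = 0 end.
Proof.
have H i' j' : (ckap i' == ckap j' + ckap (lo p)) = false -> (ckap (lo p) == ckap i' + ckap j') = false ->
   (ckap j' == ckap i' + ckap (lo p)) = false -> dlt i' j' (lo p) = 0.
  move=> E1 E2 E3; rewrite /dlt ckap_neq0 E1 [ckap _ + ckap _ == ckap (lo p)]eq_sym E2.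
  by rewrite [_ == ckap j']eq_sym E3 !subr0 addr0.
case: p H => [[p0 p1] p2] H.
have := ltn_ord p0; have := ltn_ord p1; have := ltn_ord p2 => ? ? ?.
case: i => [[[k0 k1] k2]|[[[k0 k1] k2]|[[k0 k1] k2]]];
  case: j => [[[l0 l1] l2]|[[[l0 l1] l2]|[[l0 l1] l2]]] //;
  have := ltn_ord k0; have := ltn_ord k1; have := ltn_ord k2;
  have := ltn_ord l0; have := ltn_ord l1; have := ltn_ord l2 => ? ? ? ? ? ?;
  by apply: H; apply: ckap_neq => /=; apply/orP; lia.
Qed.

Let ts (i j k : modes) : R := dotv (A i) (freq (ckap j)) * dotv (A j) (A k).

Let gain (q p : box) : R := ts (hi q) (hi2 (sum_box q p)) (lo p) - ts (hi2 (sum_box q p)) (hi q) (lo p).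

(** A low wave [p] only resonates with the pairs made of a wave [q] of the first
    high box and of the wave [p + q] of the second one: comparing the sizes of the
    coordinates along [e_1] and [e_2] excludes every other triad. *)
Lemma transfer_sum : transfer = P / 4 * \sum_q \sum_p gain q p.
Proof.
rewrite /transfer /low_flow /cflow triad_sum -mulrN; congr (_ * _).
have AE k : amp ckap (fun i => (if is_low i then 1 else 0 : R) *: cM i) k = (if is_low k then 1 else 0 : R) *: A k.
  exact: (ampZ ckap cM (fun i => if is_low i then 1 else 0)).
have dotvZ (c : R) (x y : 'rV[R]_d.+3) : dotv x (c *: y) = c * dotv x y.
  by rewrite /dotv mulr_sumr; apply: eq_bigr => u _; rewrite mxE mulrCA.
transitivity (- \sum_i \sum_j \sum_p ts i j (lo p) * dlt i j (lo p)).
  congr (- _); apply: eq_bigr => i _; apply: eq_bigr => j _.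
  rewrite big_sumType /= [X in _ + X]big1 ?addr0 => [|k _]; last first.
    by rewrite AE /= dotvZ mul0r mulr0 mul0r.
  by apply: eq_bigr => p _; rewrite AE /= dotvZ mul1r.
pose G i j := \sum_p ts i j (lo p) * dlt i j (lo p).
rewrite -[\sum_i \sum_j _]/(\sum_i \sum_j G i j).
have G0 i j : match i, j with
  | inr (inr _), inr (inl _) | inr (inl _), inr (inr _) => True | _, _ => G i j = 0 end.
  have H : (forall p, dlt i j (lo p) = 0) -> G i j = 0.
    by move=> E; rewrite /G big1 // => p _; rewrite E mulr0.
  by case: i H => [?|[?|?]]; case: j => [?|[?|?]] // H; apply: H => p;
    [exact: (dlt0 (inl _) (inl _))|exact: (dlt0 (inl _) (inr (inl _)))|exact: (dlt0 (inl _) (inr (inr _)))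
    |exact: (dlt0 (inr (inl _)) (inl _))|exact: (dlt0 (inr (inl _)) (inr (inl _)))
    |exact: (dlt0 (inr (inr _)) (inl _))|exact: (dlt0 (inr (inr _)) (inr (inr _)))].
have S1 : \sum_i \sum_j G i j = \sum_q \sum_q' G (hi q) (hi2 q') + \sum_q' \sum_q G (hi2 q') (hi q).
  rewrite big_sumType /= big1 ?add0r => [|p _]; last by rewrite big1 // => -[?|[?|?]] _; exact: (G0 (inl p) _).
  rewrite big_sumType /=; congr (_ + _); apply: eq_bigr => q _.
    rewrite big_sumType /= big1 ?add0r => [|p _]; last exact: (G0 (hi q) (inl p)).
    by rewrite big_sumType /= big1 ?add0r // => p _; exact: (G0 (hi q) (inr (inl p))).
  rewrite big_sumType /= big1 ?add0r => [|p _]; last exact: (G0 (hi2 q) (inl p)).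
  by rewrite big_sumType /= [X in _ + X]big1 ?addr0 // => p _; exact: (G0 (hi2 q) (inr (inr p))).
have S2 q : \sum_q' G (hi q) (hi2 q') = - \sum_p ts (hi q) (hi2 (sum_box q p)) (lo p).
  rewrite /G exchange_big -sumrN; apply: eq_bigr => p _ /=.
  rewrite (bigD1 (sum_box q p)) //= big1 ?addr0 => [|q' /negbTE qq].
    by rewrite dlt_main2 eqxx mulrN1.
  by rewrite dlt_main2 qq oppr0 mulr0.
have S3 : \sum_q' \sum_q G (hi2 q') (hi q) = \sum_q \sum_p ts (hi2 (sum_box q p)) (hi q) (lo p).
  rewrite exchange_big; apply: eq_bigr => q _ /=.
  rewrite /G exchange_big; apply: eq_bigr => p _ /=.
  rewrite (bigD1 (sum_box q p)) //= big1 ?addr0 => [|q' /negbTE qq].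
    by rewrite dlt_main eqxx mulr1.
  by rewrite dlt_main qq mulr0.
rewrite S1 S3 (eq_bigr _ (fun q _ => S2 q)) sumrN opprD opprK -sumrB.
by apply: eq_bigr => q _; rewrite -sumrB.
Qed.

Let gain_bounds q p : al * be ^+ 2 * (h%:R ^+ 2 * lam%:R ^+ 2) / 2 <= gain q p
  <= 16 * (al * be ^+ 2 * (h%:R ^+ 2 * lam%:R ^+ 2)).
Proof.
rewrite /gain /ts.
rewrite (@camp_low R d N lam h a (lo p)) // (@camp_high R d N lam h a (hi q)) //.
rewrite (@camp_high R d N lam h a (hi2 _)) //.
rewrite !cfreq !dotv_vec3 /=.
case: p q => [[p0 p1] p2] [[q0 q1] q2] /=; rewrite !natrD -/al -/be.
have B (i : 'I_N) : (0 : R) <= (nat_of_ord i)%:R <= (N%:R : R) by rewrite ler0n ler_nat ltnW.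
have /andP[] := B p0; have /andP[] := B p1; have /andP[] := B p2.
have /andP[] := B q0; have /andP[] := B q1; have /andP[] := B q2.
have Nl : 4 * N%:R <= lam%:R :> R by rewrite -natrM ler_nat.
have lh : 2 * lam%:R <= h%:R :> R by rewrite -natrM ler_nat.
have al0 : 0 < al by rewrite divr_gt0 // mulr_gt0.
have be0 : 0 < be by rewrite divr_gt0 // mulr_gt0.
move: (p0%:R : R) (p1%:R : R) (p2%:R : R) (q0%:R : R) (q1%:R : R) (q2%:R : R) => x0 x1 x2 y0 y1 y2.
move=> c1 c2 c3 c4 c5 c6 c7 c8 c9 c10 c11 c12.
move: lamR hR NR Nl lh al0 be0; move: (lam%:R : R) (h%:R : R) (N%:R : R) c2 c4 c6 c8 c10 c12 => L H n.
move=> c2 c4 c6 c8 c10 c12 L0 H0 n0 nL LH al0 be0.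
(* The leading parts of the factors are H L, L and 2 H.  The offsets inside the
   boxes are at most n <= L / 4 and cannot change the signs. *)
pose X := (H + y2) * (x0 + (L + x1)) - x2 * (y0 + y1).
pose Y := L + x1 - x0. pose Z := (H + y2) + (H + y2 + x2).
set g := (X in _ <= X <= _).
have -> : g = al * be ^+ 2 * (X * Y * Z) by rewrite /g /X /Y /Z; ring.
have nn : x2 * (y0 + y1) <= H * L / 16.
  apply: (@le_trans _ _ (n * (2 * n))); first by apply: ler_pM; lra.
  nra.
have X1 : H * L / 2 <= X.
  have : H * L <= (H + y2) * (x0 + (L + x1)) by apply: ler_pM; lra.
  have : 0 < H * L by rewrite mulr_gt0.
  rewrite /X; lra.
have X2 : X <= 2 * (H * L).
  have : (H + y2) * (x0 + (L + x1)) <= (H * 9 / 8) * (L * 3 / 2) by apply: ler_pM; lra.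
  have : 0 <= x2 * (y0 + y1) by rewrite mulr_ge0 //; lra.
  have : 0 < H * L by rewrite mulr_gt0.
  by rewrite /X; lra.
have Y1 : L / 2 <= Y by rewrite /Y; lra.
have Y2 : Y <= 2 * L by rewrite /Y; lra.
have Z1 : 2 * H <= Z by rewrite /Z; lra.
have Z2 : Z <= 4 * H by rewrite /Z; lra.
have W0 : 0 <= al * be ^+ 2 by rewrite mulr_ge0 ?sqr_ge0 // ltW.
have HL : 0 < H * L by rewrite mulr_gt0.
apply/andP; split.
  rewrite -mulrA ler_wpM2l //.
  have -> : H ^+ 2 * L ^+ 2 / 2 = (H * L / 2) * (L / 2) * (2 * H) by field.
  have XY : H * L / 2 * (L / 2) <= X * Y by apply: ler_pM => //; lra.
  apply: ler_pM => //; last lra.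
  by apply: mulr_ge0; lra.
rewrite [leRHS]mulrCA ler_wpM2l //.
have -> : 16 * (H ^+ 2 * L ^+ 2) = (2 * (H * L)) * (2 * L) * (4 * H) by ring.
have XY : X * Y <= 2 * (H * L) * (2 * L) by apply: ler_pM => //; lra.
apply: ler_pM => //; last lra.
by apply: mulr_ge0; lra.
Qed.

(** All the [N^6] triads contribute with the same sign and the same order of
    magnitude [al be^2 h^2 lam^2]. *)
Lemma transfer_bounds : P / 8 * (a ^+ 3 * lam%:R / N%:R ^+ 3) <= transfer
  <= 4 * P * (a ^+ 3 * lam%:R / N%:R ^+ 3).
Proof.
rewrite transfer_sum.
have E (c : R) : \sum_(q : box) \sum_(p : box) c = N%:R ^+ 6 * c.
  rewrite !sumr_const !card_prod !card_ord -mulrnA -[c *+ _]mulr_natl; congr (_ * _).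
  by rewrite -natrX; congr (_%:R); ring.
have K : al * be ^+ 2 * (h%:R ^+ 2 * lam%:R ^+ 2) * N%:R ^+ 6 = a ^+ 3 * lam%:R / N%:R ^+ 3.
  by rewrite /al /be; field; rewrite !gt_eqF.
set w := al * be ^+ 2 * (h%:R ^+ 2 * lam%:R ^+ 2) in K.
rewrite -K; apply/andP; split.
  have -> : P / 8 * (w * N%:R ^+ 6) = P / 4 * (N%:R ^+ 6 * (w / 2)) by field.
  rewrite ler_pM2l ?divr_gt0 // -E; apply: ler_sum => q _; apply: ler_sum => p _.
  by have /andP[] := gain_bounds q p.
have -> : 4 * P * (w * N%:R ^+ 6) = P / 4 * (N%:R ^+ 6 * (16 * w)) by field.
rewrite ler_pM2l ?divr_gt0 // -E; apply: ler_sum => q _; apply: ler_sum => p _.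
by have /andP[] := gain_bounds q p.
Qed.

End cluster_bounds.

(** * Flux of the cluster flow through a dyadic frequency *)

Section cutoff_lipschitz.
Context {R : realType} {d : nat}.
Variable chi : 'rV[R]_d.+1 -> R.
Hypothesis hchi : LP_cutoff chi.

Lemma enorm_unit_vec (j : 'I_d.+1) : enorm (unit_vec j : 'rV[R]_d.+1) = 1.
Proof.
rewrite /enorm big_ord1 (bigD1 j) //= big1 => [|i ij]; first by rewrite mxE !eqxx expr1n addr0 sqrtr1.
by rewrite mxE (negbTE ij) andbF expr0n.
Qed.

(** At the sphere where the cutoff leaves its plateau it is differentiable, so it
    deviates from 1 at most linearly in the distance to the plateau as long as this
    distance is small; otherwise the deviation is at most 1 anyway.  Being radial
    it may be tested along a single ray. *)
Lemma LP_low_lipschitz : exists2 C : R, 0 < C & forall q (xi : 'rV[R]_d.+1), 2 ^+ q <= enorm xi ->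
  `|LP_low chi q xi - 1| <= C * (enorm xi / 2 ^+ q - 1).
Proof.
have [chis _ chi1 chi0] := hchi.
pose e := unit_vec (ord0 : 'I_d.+1) : 'rV[R]_d.+1.
have enormsE (s : R) : 0 <= s -> enorm (s *: e) = s.
  by move=> s0; rewrite enormZ enorm_unit_vec mulr1 ger0_norm.
have fh : chi (2^-1 *: e) = 1 by apply: chi1; rewrite enormsE.
have : derivable chi (2^-1 *: e) e by apply: diff_derivable; exact: smooth_on_diff chis _.
move=> /cvg_ex[l /cvgrPdist_le /(_ 1 ltr01)] /nbhs_ballP[r /= r0 Hr].
have r0' : 0 < r by [].
pose C := `|l| + 1 + r^-1.
have C0 : 0 < C by rewrite /C !ltr_pwDr ?invr_gt0 // ltr_pwDr.
exists C => // q xi xq.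
set t := enorm xi / 2 ^+ q - 1.
have q0 : 0 < 2 ^+ q :> R by rewrite exprn_gt0.
have t0 : 0 <= t by rewrite subr_ge0 ler_pdivlMr // mul1r.
have E : LP_low chi q xi = chi ((t / 2) *: e + 2^-1 *: e).
  rewrite /LP_low; apply: (chi_radial hchi); rewrite -scalerDl enormsE ?addr_ge0 ?divr_ge0 //.
  rewrite enormZ ger0_norm ?invr_ge0 ?exprn_ge0 // exprS /t.
  by field; rewrite gt_eqF.
have [tr|tr] := ltP (t / 2) r; last first.
  have /andP[h0 h1] := LP_low_itv hchi q xi.
  apply: (@le_trans _ _ 1); first by rewrite distrC ger0_norm ?subr_ge0 // lerBlDr lerDl.
  apply: (@le_trans _ _ (r^-1 * t)).
    by rewrite -ler_pdivrMl ?invr_gt0 // invrK mulr1; lra.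
  by rewrite ler_wpM2r // /C lerDr.
have [t00|tn0] := eqVneq t 0.
  by rewrite E t00 mul0r scale0r add0r fh subrr normr0 mulr0.
have t2n0 : t / 2 != 0 by rewrite mulf_neq0 // invr_eq0.
have tb : ball (0 : R) r (t / 2).
  by rewrite -ball_normE /= sub0r normrN ger0_norm ?divr_ge0.
have := Hr (t / 2) tb t2n0.
rewrite -E fh => H.
have H2 : `|(t / 2)^-1 *: (LP_low chi q xi - 1)| <= `|l| + 1.
  have -> : (t / 2)^-1 *: (LP_low chi q xi - 1) = l - (l - (t / 2)^-1 *: (LP_low chi q xi - 1)).
    by rewrite subKr.
  by rewrite (le_trans (ler_normB _ _)) // lerD2l.
have t20 : 0 < t / 2 by rewrite lt_def t2n0 divr_ge0.
rewrite normrZ gtr0_norm ?invr_gt0 // ler_pdivrMl // in H2.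
apply: (le_trans H2); rewrite mulrC.
have : `|l| + 1 <= C by rewrite /C lerDl invr_ge0 ltW.
have : 0 <= `|l| + 1 by rewrite addr_ge0.
nra.
Qed.
End cutoff_lipschitz.

Section sflow_linear.
Context {R : realType} {d : nat} {I : finType}.
Variable kap : I -> 'rV[int]_d.
Implicit Types (M : I -> 'M[R]_d) (c : I -> R).

Lemma sflow_scaleE M c u x : sflow kap (fun i => c i *: M i) x 0 u =
  \sum_i c i * amp kap M i 0 u * sink (kap i) x.
Proof.
rewrite mxE; apply: eq_bigr => i _; congr (_ * _).
by have /rowP/(_ u) := ampZ kap M c i; rewrite [X in _ = X -> _]mxE.
Qed.

Lemma inner_sflowD (v : 'rV[R]_d -> 'rV[R]_d) M c c' : tf_vec v ->
  inner v (sflow kap (fun i => (c i + c' i) *: M i)) =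
  inner v (sflow kap (fun i => c i *: M i)) + inner v (sflow kap (fun i => c' i *: M i)).
Proof.
move=> tv.
have C c1 : torus_cont (fun x => \sum_u v x 0 u * sflow kap (fun i => c1 i *: M i) x 0 u).
  apply: torus_cont_sum => u _; apply: torus_contM; apply: tf_torus_cont; first exact: tv.
  exact: (tf_sflow _ _ u).
rewrite !inner_tint -tintD //; apply: eq_tint => x; rewrite -big_split; apply: eq_bigr => u _ /=.
rewrite !sflow_scaleE -mulrDr -big_split /=; congr (_ * _); apply: eq_bigr => i _; ring.
Qed.

Lemma inner_sflow0 (v : 'rV[R]_d -> 'rV[R]_d) M c : (forall i, c i = 0) ->
  inner v (sflow kap (fun i => c i *: M i)) = 0.
Proof.
move=> c0; rewrite inner_tint -[RHS](@tint0 R d); apply: eq_tint => x; rewrite big1 // => u _.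
by rewrite sflow_scaleE big1 ?mulr0 // => i _; rewrite c0 !mul0r.
Qed.

Lemma eq_sflow M M' : M =1 M' -> sflow kap M = sflow kap M'.
Proof. by move=> MM; congr sflow; apply/funext. Qed.

(** The sines are eigenfunctions of the square of the Laplacian, with eigenvalues
    at least [lam^4]; moving it onto the test function gains this factor. *)
Lemma sflow_test_pairing M u (S B lam : R) (phi : 'rV[R]_d -> R) :
  test_function phi -> 0 < lam -> (\sum_i `|amp kap M i 0 u| <= S) -> 0 <= B ->
  (forall i, lam <= enorm (freq (kap i) : 'rV[R]_d)) ->
  (forall x, `|\sum_j partial j (partial j (fun y => \sum_k partial k (partial k phi) y)) x| <= B) ->
  `|tint (fun x => sflow kap M x 0 u * phi x)| <= S * ((2 * pi) ^+ d * B / lam ^+ 4).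
Proof.
move=> tphi lam0 MS B0 kl HB.
have tl (g : 'rV[R]_d -> R) : test_function g -> test_function (fun x => \sum_j partial j (partial j g) x).
  by move=> tg; apply: tf_sum => j _; do 2!apply: tf_partial.
pose P : R := (2 * pi) ^+ d.
have P0 : 0 < P by rewrite exprn_gt0 // mulr_gt0 // pi_gt0.
have H i : `|tint (fun x => sink (kap i) x * phi x)| <= P * B / lam ^+ 4.
  have e0 : 0 < enorm (freq (kap i) : 'rV[R]_d) by exact: lt_le_trans (kl i).
  have E : tint (fun x => sink (kap i) x * (\sum_j partial j (partial j (fun y => \sum_k partial k (partial k phi) y)) x)) =
     enorm (freq (kap i) : 'rV[R]_d) ^+ 4 * tint (fun x => sink (kap i) x * phi x).
    by rewrite (tint_sink_lap (kap i) (tl _ tphi)) (tint_sink_lap (kap i) tphi) mulrA; congr (_ * _); ring.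
  have C1 := torus_contM (tf_torus_cont (tf_sink (kap i))) (tf_torus_cont (tl _ (tl _ tphi))).
  have Q : `|tint (fun x => sink (kap i) x * (\sum_j partial j (partial j (fun y => \sum_k partial k (partial k phi) y)) x))| <= P * B.
    have PB : tint ((fun=> B) : 'rV[R]_d -> R) = P * B by exact: tint_cst.
    have Cb := @torus_cont_cst R d B.
    have W x : `|sink (kap i) x * (\sum_j partial j (partial j (fun y => \sum_k partial k (partial k phi) y)) x)| <= B.
      by rewrite normrM -[B]mul1r ler_pM // abs_sink.
    rewrite -PB ler_norml -tintN //; apply/andP; split; apply: le_tint => //.
    - exact: torus_contN.
    - by move=> x; have := W x; rewrite ler_norml => /andP[].
    - by move=> x; have := W x; rewrite ler_norml => /andP[].
  rewrite E normrM ger0_norm ?exprn_ge0 ?enorm_ge0 // in Q.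
  rewrite ler_pdivlMr ?exprn_gt0 // mulrC; apply: le_trans Q.
  by rewrite ler_wpM2r // ler_pXn2r ?nnegrE ?enorm_ge0 // ltW.
have C i : torus_cont (fun x => sink (kap i) x * phi x).
  by apply: torus_contM; apply: tf_torus_cont => //; exact: tf_sink.
have -> : tint (fun x => sflow kap M x 0 u * phi x) =
   \sum_i amp kap M i 0 u * tint (fun x => sink (kap i) x * phi x).
  transitivity (tint (fun x => \sum_i amp kap M i 0 u * (sink (kap i) x * phi x))).
    by apply: eq_tint => x; rewrite mxE mulr_suml; apply: eq_bigr => i _; rewrite mulrA.
  rewrite tint_sum; last by move=> i _; exact: torus_contZ.
  by apply: eq_bigr => i _; rewrite tintZ.
apply: (le_trans (ler_norm_sum _ _ _)).
apply: (@le_trans _ _ (\sum_i `|amp kap M i 0 u| * (P * B / lam ^+ 4))).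
  by apply: ler_sum => i _; rewrite normrM ler_wpM2l.
rewrite -mulr_suml -/P; apply: ler_wpM2r => //; apply: divr_ge0.
  by apply: mulr_ge0 => //; exact: ltW.
by apply: exprn_ge0; exact: ltW.
Qed.

End sflow_linear.

Section block_flux.
Context {R : realType} {d : nat}.
Variable chi : 'rV[R]_d.+3 -> R.
Hypothesis hchi : LP_cutoff chi.
Variables (N p p' : nat) (a : R).
Local Notation lam := (2 ^ p)%N.
Local Notation h := (2 ^ p')%N.
Hypotheses (N0 : (0 < N)%N) (Nlam : (4 * N <= lam)%N) (pp : (p < p')%N) (a0 : 0 < a).

Let lamh : (2 * lam <= h)%N.
Proof. by rewrite -expnS leq_pexp2l. Qed.

Local Notation modes := (modes N).
Local Notation cM := (@cM R d N lam h a).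
Local Notation ckap := (@ckap d N lam h).
Local Notation U := (@cflow R d N lam h a).
Let P : R := (2 * pi) ^+ d.+3.
Let D : R := d.+3%:R.
Let D1 : 1 <= D. Proof. by rewrite ler1n. Qed.
Let NR : (0 : R) < N%:R. Proof. by rewrite ltr0n. Qed.
Let Y := a ^+ 2 / N%:R ^+ 3.
Let sg q i := LP_low chi q (freq (ckap i)).

Let tfU : tf_vec U. Proof. exact: tf_sflow. Qed.
Let dfU : div_free U. Proof. exact/div_free_sflow/cM_antisym. Qed.

Let fluxE q : flux chi q U = inner (convection U) (sflow ckap (fun i => sg q i ^+ 2 *: cM i)).
Proof. exact: sflow_flux. Qed.

Let enorm_bnd i : (2 ^+ p : R) <= enorm (freq (ckap i) : 'rV[R]_d.+3) <= 2 ^+ p'.+1.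
Proof.
have := @enorm_all R d N lam h N0 Nlam lamh i.
by rewrite !natrX exprS.
Qed.

Let inner_UU : inner (convection U) (sflow ckap (fun i => (1 : R) *: cM i)) = 0.
Proof.
rewrite -[RHS](convection_orth tfU dfU) /U; congr inner.
by apply: eq_sflow => i; rewrite scale1r.
Qed.

Lemma flux_small q : (q < p)%N -> flux chi q U = 0.
Proof.
move=> qp; rewrite fluxE inner_sflow0 // => i; rewrite /sg (LP_low0 hchi) ?expr0n //.
have /andP[H _] := enorm_bnd i; apply: le_trans H.
by rewrite ler_eXn2l // ltr1n.
Qed.

(** Above all the frequencies of the flow the flux is its full nonlinear work,
    which is zero. *)
Lemma flux_large q : (p' < q)%N -> flux chi q U = 0.
Proof.
move=> qp; rewrite fluxE -[RHS]inner_UU; congr inner; apply: eq_sflow => i.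
rewrite /sg (LP_low1 hchi) ?expr1n //.
have /andP[_ H] := enorm_bnd i; apply: (le_trans H).
by rewrite ler_eXn2l // ltr1n.
Qed.

Let low1 q i : is_low i -> (p < q)%N -> sg q i = 1.
Proof.
move=> li pq; rewrite /sg (LP_low1 hchi) //.
have /andP[_ H] := @enorm_low R d N lam h N0 Nlam lamh i li; apply: (le_trans H).
apply: (@le_trans _ _ (2 ^+ p.+1)); last by rewrite ler_eXn2l // ltr1n.
rewrite exprS -natrX; have : 4 * N%:R <= lam%:R :> R by rewrite -natrM ler_nat.
by have := NR; lra.
Qed.

Let high0 q i : ~~ is_low i -> (q < p')%N -> sg q i = 0.
Proof.
move=> li pq; rewrite /sg (LP_low0 hchi) //.
have /andP[H _] := @enorm_high R d N lam h N0 Nlam lamh i li; apply: le_trans H.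
by rewrite natrX ler_eXn2l // ltr1n.
Qed.

(** Strictly between the clusters the projection is exactly the restriction to
    the low waves. *)
Lemma flux_mid q : (p < q)%N -> (q < p')%N -> flux chi q U = - @transfer R d N lam h a.
Proof.
move=> pq qp; rewrite fluxE /transfer opprK; congr inner; apply: eq_sflow => i.
have [li|li] := boolP (is_low i); first by rewrite low1 // expr1n.
by rewrite high0 // expr0n.
Qed.

(** How much the flux changes when the multipliers of the waves change by at most
    [e]. *)
Let perturb (c : modes -> R) (e : R) : 0 < e -> (forall i, `|c i| <= e) ->
  `|inner (convection U) (sflow ckap (fun i => c i *: cM i))| <=
  1000 * D ^+ 2 * P * (a * Y * h%:R * e).
Proof.
move=> e0 ce.
(* The weight that balances the enstrophy h^2 Y and the energy e^2 Y. *)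
have dl0 : 0 < e / h%:R by rewrite divr_gt0.
have S0 : 0 <= 20 * a by rewrite mulr_ge0 // ltW.
apply: (le_trans (convection_bound tfU (tf_sflow ckap _) dl0 S0 _)).
  by move=> x u; exact: cflow_sup.
have E1 := @cflow_enstrophy R d N lam h a N0 Nlam lamh a0.
have E2 := @scaled_energy R d N lam h a N0 Nlam lamh a0 c e ce.
rewrite -/P -/D -/Y in E1 E2.
have -> : 1000 * D ^+ 2 * P * (a * Y * h%:R * e) =
   20 * a / 2 * (e / h%:R * (80 * D ^+ 2 * P * h%:R ^+ 2 * Y) +
     D / (e / h%:R) * (20 * D * P * e ^+ 2 * Y)).
  by field; rewrite !gt_eqF.
apply: ler_wpM2l; first by rewrite divr_ge0.
by apply: lerD; apply: ler_wpM2l => //; rewrite ?divr_ge0 // ltW // (lt_le_trans _ D1).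
Qed.

Let sq_dev (s e : R) : 0 <= s <= 1 -> `|s - 1| <= e -> `|s ^+ 2 - 1| <= 2 * e.
Proof.
move=> /andP[s0 s1]; rewrite -[s ^+ 2 - 1]opprB -[s - 1]opprB !normrN => H.
rewrite ger0_norm ?subr_ge0 ?expr_le1 //.
by rewrite ger0_norm ?subr_ge0 // in H; nra.
Qed.

Variables (C : R).
Hypotheses (C0 : 0 < C) (HC : forall q (xi : 'rV[R]_d.+3), 2 ^+ q <= enorm xi ->
    `|LP_low chi q xi - 1| <= C * (enorm xi / 2 ^+ q - 1)).

(** At the scale of the low cluster the projection is not exactly 1 on the low
    waves, as their lengths exceed [lam], but by at most [3 N]. *)
Lemma flux_bottom : `|flux chi p U + @transfer R d N lam h a| <=
  1000 * D ^+ 2 * P * (a * Y * h%:R * (6 * C * (N%:R / lam%:R))).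
Proof.
have -> : flux chi p U + @transfer R d N lam h a =
   inner (convection U) (sflow ckap (fun i => (sg p i ^+ 2 - (if is_low i then 1 else 0)) *: cM i)).
  have E := @inner_sflowD R d.+3 modes ckap (convection U) cM
    (fun i => sg p i ^+ 2 - (if is_low i then 1 else 0)) (fun i => if is_low i then 1 else 0) (fun u => tf_convection u tfU).
  rewrite fluxE /transfer /low_flow -[RHS](addrK (inner (convection U)
     (sflow ckap (fun i => (if is_low i then 1 else 0) *: cM i)))) -E.
  by congr (_ - _); congr inner; apply: eq_sflow => i; rewrite subrK.
apply: perturb; first by rewrite !mulr_gt0 // invr_gt0.
move=> i; have [li|li] := boolP (is_low i); last first.
  rewrite high0 // expr0n subrr normr0 !mulr_ge0 ?invr_ge0 // ltW //.
have /andP[l1 l2] := @enorm_low R d N lam h N0 Nlam lamh i li.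
have -> : 6 * C * (N%:R / lam%:R) = 2 * (3 * C * (N%:R / lam%:R)) by ring.
apply: sq_dev; first exact: LP_low_itv.
apply: (le_trans (HC _)); first by rewrite -natrX.
have -> : 3 * C * (N%:R / lam%:R) = C * ((lam%:R + 3 * N%:R) / lam%:R - 1).
  by field; rewrite gt_eqF.
by rewrite ler_pM2l // lerD2r -natrX ler_pM2r ?invr_gt0.
Qed.

(** At the scale of the high cluster the projection is almost 1 on the high waves
    and the full nonlinear work is zero; the error comes from the excess lengths in
    [enorm_high]. *)
Lemma flux_top : `|flux chi p' U| <=
  1000 * D ^+ 2 * P * (a * Y * h%:R * (4 * C * (N%:R / h%:R + lam%:R ^+ 2 / h%:R ^+ 2))).
Proof.
have -> : flux chi p' U =
   inner (convection U) (sflow ckap (fun i => (sg p' i ^+ 2 - 1) *: cM i)).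
  have E := @inner_sflowD R d.+3 modes ckap (convection U) cM
    (fun i => sg p' i ^+ 2 - 1) (fun i => 1) (fun u => tf_convection u tfU).
  rewrite fluxE -[RHS]addr0 -inner_UU -E.
  by congr inner; apply: eq_sflow => i; rewrite subrK.
apply: perturb.
  by rewrite !mulr_gt0 // addr_gt0 // divr_gt0 // exprn_gt0.
move=> i; have [li|li] := boolP (is_low i).
  rewrite low1 // expr1n subrr normr0 !mulr_ge0 ?addr_ge0 ?divr_ge0 ?exprn_ge0 // ltW //.
have /andP[l1 l2] := @enorm_high R d N lam h N0 Nlam lamh i li.
have -> (x : R) : 4 * C * x = 2 * (2 * C * x) by ring.
apply: sq_dev; first exact: LP_low_itv.
apply: (le_trans (HC _)); first by rewrite -natrX.
have -> : 2 * C * (N%:R / h%:R + lam%:R ^+ 2 / h%:R ^+ 2) =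
    C * ((h%:R + 2 * N%:R + 2 * lam%:R ^+ 2 / h%:R) / h%:R - 1).
  by field; rewrite gt_eqF.
by rewrite ler_pM2l // lerD2r -[2 ^+ p']natrX ler_pM2r ?invr_gt0.
Qed.

End block_flux.

(** * Gluing pulses in time *)

Section time_bump.
Context {R : realType} {d : nat}.
Variable chi : 'rV[R]_d.+1 -> R.
Hypothesis hchi : LP_cutoff chi.

Let e0 : 'rV[R]_d.+1 := unit_vec ord0.

(** The given cutoff along a line serves as the profile of the pulses. *)
Definition time_bump (s : R) : R := chi (s *: e0).
Definition dtime_bump (s : R) : R := 'D_1 time_bump s.

Let enorm_time_bump s : enorm (s *: e0) = `|s|.
Proof.
rewrite enormZ /enorm big_ord1 (bigD1 ord0) //= big1 ?addr0; last first.
  by move=> j j0; rewrite /e0 /unit_vec mxE eqxx (negbTE j0) expr0n.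
by rewrite /e0 /unit_vec mxE !eqxx expr1n sqrtr1 mulr1.
Qed.

Lemma time_bump_smooth : smooth_on setT time_bump.
Proof.
have [cs _ _ _] := hchi.
have dA (y : R) : is_diff y (fun s : R => s *: e0) (fun s : R => s *: e0).
  exact: is_diff_scalel.
have H := smooth_on_comp_affine (@openT R) dA _ cs.
by have := H (fun _ _ => I).
Qed.

Lemma time_bump_itv s : 0 <= time_bump s <= 1.
Proof. exact: chi_itv. Qed.

Lemma time_bump1 s : `|s| <= 2^-1 -> time_bump s = 1.
Proof. by move=> s2; have [_ _ h _] := hchi; apply: h; rewrite enorm_time_bump. Qed.

Lemma time_bump0 s : 1 <= `|s| -> time_bump s = 0.
Proof. by move=> s2; have [_ _ _ h] := hchi; apply: h; rewrite enorm_time_bump. Qed.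

Lemma dtime_bump_smooth : smooth_on setT dtime_bump.
Proof. exact/smooth_on_derive/time_bump_smooth. Qed.

Lemma time_bump_is_derive (s : R) : is_derive s (1 : R) time_bump (dtime_bump s).
Proof.
split => //; apply: diff_derivable.
by apply: (smooth_on_diff time_bump_smooth).
Qed.

Lemma dtime_bump0 s : 1 < `|s| -> dtime_bump s = 0.
Proof.
move=> s1; have E : \forall y \near s, (fun=> 0 : R) y = time_bump y.
  have : \forall y \near s, 1 < `|y|.
    exact: (cvgr_gt _ (@norm_continuous _ _ s) _ s1).
  by apply: filterS => y y1; rewrite time_bump0 // ltW.
by rewrite /dtime_bump -(near_eq_derive (1 : R) E) derive_cst.
Qed.

Lemma dtime_bump_bounded : exists2 C, 0 < C & forall s, `|dtime_bump s| <= C.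
Proof.
have c : {within `[(-1 : R), 1], continuous (fun s => `|dtime_bump s|)}.
  apply: continuous_subspaceT => s; apply: continuous_comp; last exact: norm_continuous.
  exact: (dtime_bump_smooth 0).
have [s0 _ H] := EVT_max (ltW (gtrN (@ltr01 R))) c.
exists (`|dtime_bump s0| + 1); first by rewrite ltr_pwDr.
move=> s; have [s1|s1] := leP `|s| 1; last by rewrite dtime_bump0 // normr0 addr_ge0.
by rewrite (le_trans (H s _)) ?lerDl // in_itv /= -ler_norml.
Qed.

End time_bump.

Section gluing.
Context {R : realType}.
Variables (T : R) (tau : nat -> R).
Hypotheses (T0 : 0 < T).

(** The lengths of the cells [cell_left n, cell_left n.+1[ are halved at each
    step and the cells fill [T / 2, T[.  The smallness of [tau n] keeps the pulse
    around the middle of its cell away from the ends. *)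
Let x_ (n : nat) : R := 2^-1 ^+ n.+1.
Definition cell_left (n : nat) : R := T * (1 - x_ n).
Definition cell_mid (n : nat) : R := T * (1 - 3 / 4 * x_ n).

Hypothesis tau_small : forall n, 0 < tau n <= T * x_ n / 16.

Let x_gt0 n : 0 < x_ n. Proof. by rewrite exprn_gt0. Qed.
Let x_S n : x_ n.+1 = x_ n / 2. Proof. by rewrite /x_ exprSr. Qed.
Let x_0 : x_ 0 = 2^-1. Proof. by rewrite /x_ expr1. Qed.

Definition rests (n : nat) (t : R) := tau n < `|t - cell_mid n|.
Definition in_cell (t : R) : set nat := [set n | cell_left n <= t < cell_left n.+1].
(** Times outside of [T / 2, T[ are assigned to the cell 0, whose pulse is then
    at rest. *)
Definition cell_idx (t : R) : nat := xget 0%N (in_cell t).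
Definition piecewise (X : Type) (F : nat -> R -> X) : R -> X := fun t => F (cell_idx t) t.

Lemma cell_leftS n : cell_left n < cell_left n.+1.
Proof. by rewrite /cell_left x_S ltr_pM2l //; have := x_gt0 n; lra. Qed.

Lemma cell_left_le n m : (n <= m)%N -> cell_left n <= cell_left m.
Proof.
move=> /subnK <-; elim: (m - n)%N => // k IH.
by rewrite addSn (le_trans IH) // ltW // cell_leftS.
Qed.

Lemma cell_left_lt n : cell_left n < T.
Proof. by rewrite /cell_left -[ltRHS]mulr1 ltr_pM2l // ltrBlDr ltrDl. Qed.

Lemma cell_left_cvg : cell_left @ \oo --> T.
Proof.
rewrite /cell_left -[X in _ --> X]mulr1; apply: cvgM; first exact: cvg_cst.
rewrite -[X in _ --> X]subr0; apply: cvgB; first exact: cvg_cst.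
have -> : x_ = (fun n => 2^-1 * 2^-1 ^+ n) by apply/funext => n; rewrite /x_ exprS.
rewrite -[X in _ --> X](mulr0 2^-1); apply: cvgM; first exact: cvg_cst.
by apply: cvg_expr; rewrite ger0_norm //; lra.
Qed.

Lemma cell_idxP t n : cell_left n <= t < cell_left n.+1 -> cell_idx t = n.
Proof.
move=> tn; rewrite /cell_idx; case: xgetP => [m _|/(_ n)]; last by case.
move=> /= /andP[m1 m2]; move: tn => /andP[n1 n2].
have [mn|nm|//] := ltngtP m n.
- by have := lt_le_trans m2 (le_trans (cell_left_le mn) n1); rewrite ltxx.
- by have := lt_le_trans n2 (le_trans (cell_left_le nm) m1); rewrite ltxx.
Qed.

Lemma cell_idx_lt0 t : t < cell_left 0 -> cell_idx t = 0%N.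
Proof.
move=> tn; rewrite /cell_idx; case: xgetP => [m _|//] /= /andP[m1 _].
by have := le_lt_trans m1 tn; rewrite ltNge cell_left_le.
Qed.

Lemma cell_idx_geT t : T <= t -> cell_idx t = 0%N.
Proof.
move=> tn; rewrite /cell_idx; case: xgetP => [m _|//] /= /andP[_ m1].
by have := lt_trans (le_lt_trans tn m1) (cell_left_lt _); rewrite ltxx.
Qed.

Lemma cell_exists t : cell_left 0 <= t < T -> exists n, cell_left n <= t < cell_left n.+1.
Proof.
move=> /andP[t0 tT].
have ex : exists n, t < cell_left n.
  have [n _ H] := cvgr_gt _ cell_left_cvg _ tT.
  by exists n; exact: (H n (leqnn n)).
case: (ex_minnP ex) => -[|n] tn H.
  by move: tn; rewrite ltNge t0.
exists n; rewrite tn andbT leNgt; apply/negP => /H.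
by rewrite ltnn.
Qed.

Lemma rests_left n t : t <= cell_left n + T * x_ n / 16 -> rests n t.
Proof.
rewrite /rests /cell_mid /cell_left => H; have /andP[_ tn] := tau_small n.
have : 0 < T * x_ n by rewrite mulr_gt0.
rewrite ltr_normr; move: tn H; have := mulrBr T 1 (x_ n); rewrite mulr1 => ->.
have -> : T * (1 - 3 / 4 * x_ n) = T - 3 / 4 * (T * x_ n) by ring.
move=> *; apply/orP; right; lra.
Qed.

Lemma rests_right n t : cell_left n.+1 - T * x_ n / 16 <= t -> rests n t.
Proof.
rewrite /rests /cell_mid /cell_left => H; have /andP[_ tn] := tau_small n.
have : 0 < T * x_ n by rewrite mulr_gt0.
move: H tn; rewrite ltr_normr x_S.
have -> : T * (1 - 3 / 4 * x_ n) = T - 3 / 4 * (T * x_ n) by ring.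
have -> : T * (1 - x_ n / 2) = T - (T * x_ n) / 2 by ring.
move=> *; apply/orP; left; lra.
Qed.

(** At a common end of two cells one of the two pieces serves on both sides,
    since both are at rest there.  Hence glued functions inherit from the pieces
    whatever is local. *)
Lemma piecewise_near t : t < T -> exists n, \forall s \near t,
  cell_idx s = n \/ (rests (cell_idx s) s /\ rests n s).
Proof.
move=> tT; have [t0|t0] := ltP t (cell_left 0).
  exists 0%N; near=> s; left; apply: cell_idx_lt0.
  by near: s; exact: lt_nbhsl.
have [|n /andP[n1 n2]] := @cell_exists t; first by rewrite t0.
have := n1; rewrite le_eqVlt => /orP[/eqP nt|nt]; last first.
  exists n; near=> s; left; apply: cell_idxP; rewrite ltW /=.
  - by near: s; exact: lt_nbhsl.
  - by near: s; exact: lt_nbhsr.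
exists n; case: n => [|n] in n1 n2 nt *.
  near=> s; left; have [ts|st] := ltP s t; first by apply: cell_idx_lt0; rewrite nt.
  by apply: cell_idxP; rewrite nt st /=; near: s; exact: lt_nbhsl.
have TX : 0 < T * x_ n.+1 by rewrite mulr_gt0.
near=> s.
have s1 : t - T * x_ n.+1 / 16 < s.
  by near: s; apply: lt_nbhsr; rewrite ltrBlDr ltrDl divr_gt0.
have s2 : cell_left n < s by near: s; apply: lt_nbhsr; rewrite -nt cell_leftS.
have s3 : s < cell_left n.+2 by near: s; exact: lt_nbhsl.
have [st|ts] := leP t s; first by left; apply: cell_idxP; rewrite nt st.
right; split; last by apply: rests_left; rewrite nt (le_trans (ltW ts)) // lerDl divr_ge0 // ltW.
rewrite (@cell_idxP s n); last by rewrite (ltW s2) nt.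
apply: rests_right; rewrite nt; apply: le_trans (ltW s1).
by rewrite lerD2l lerN2; rewrite x_S; have := mulr_gt0 T0 (x_gt0 n); lra.
Unshelve. all: by end_near. Qed.

Definition agrees (n : nat) (s : R) : Prop :=
  cell_idx s = n \/ (rests (cell_idx s) s /\ rests n s).

Lemma agrees_piecewise (X : Type) (F : nat -> R -> X) z n s :
  (forall m t, rests m t -> F m t = z) -> agrees n s -> piecewise F s = F n s.
Proof. by move=> Fz [ns|[h1 h2]]; rewrite /piecewise ?ns // !Fz. Qed.

Lemma piecewise_smooth_QT d (W : normedModType R) (F : nat -> R -> 'rV[R]_d -> W) :
  (forall n t, rests n t -> F n t = fun=> 0) ->
  (forall n, smooth_on setT (fun z : R * 'rV[R]_d => F n z.1 z.2)) ->
  (forall n t, torus_periodic (F n t)) -> smooth_QT T (piecewise F).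
Proof.
move=> F0 sF pF; split; last by move=> t _; exact: pF.
apply: smooth_on_local => -[t x] /= /andP[_ tT].
have [n nt] := piecewise_near tT.
exists [set z | (agrees n)^° z.1], (fun z => F n z.1 z.2); split => //.
- by apply: open_comp (@open_interior _ _) => z _; exact: cvg_fst.
- exact: smooth_on_sub (@subsetT _ _) (sF n).
- by move=> z Vz; rewrite (agrees_piecewise F0 (interior_subset Vz)).
Qed.

Let idx_set n : set R := [set t | cell_idx t = n].

Let measurable_idx n : measurable (idx_set n).
Proof.
have mS k : measurable (idx_set k.+1).
  suff -> : idx_set k.+1 = `[cell_left k.+1, cell_left k.+2[%classic by exact: measurable_itv.
  apply/seteqP; split => t /=; rewrite in_itv /=; last exact: cell_idxP.
  by rewrite /idx_set /= /cell_idx; case: xgetP => [m mE /= tm <-|].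
case: n => [|k]; last exact: mS.
suff -> : idx_set 0 = ~` (\bigcup_k idx_set k.+1) by apply/measurableC/bigcup_measurable.
apply/seteqP; split => t /=; first by move=> t0 [k _] /=; rewrite /idx_set /= t0.
case E : (cell_idx t) => [|k] // H; exfalso; apply: H; exists k => //.
Qed.

Let idx_cover : \bigcup_n idx_set n = setT.
Proof. by apply/seteqP; split => t // _; exists (cell_idx t). Qed.

Let idx_triv : trivIset setT idx_set.
Proof. by move=> i j _ _ [t [/= <- <-]]. Qed.

Lemma measurable_piecewise d (Y : measurableType d) (F : nat -> R -> Y) :
  (forall n, measurable_fun setT (F n)) -> measurable_fun setT (piecewise F).
Proof.
move=> mF; rewrite -idx_cover; apply/measurable_fun_bigcup => // n.
apply: (@eq_measurable_fun _ _ _ _ _ (F n)).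
  by move=> t; rewrite inE /piecewise /= => ->.
exact: measurable_funS (mF n).
Qed.

Let geometric_sum_le (K : R) n : 0 <= K -> \sum_(0 <= k < n) K * 2^-1 ^+ k <= 2 * K.
Proof.
move=> K0; have -> : \sum_(0 <= k < n) K * 2^-1 ^+ k = 2 * K - 2 * K * 2^-1 ^+ n.
  elim: n => [|n IH]; first by rewrite big_geq // expr0; ring.
  by rewrite big_nat_recr //= IH exprS; field.
by rewrite gerBl mulr_ge0 ?exprn_ge0 // mulr_ge0.
Qed.

(** The piece [n] is supported in an interval of length [2 tau n] and contributes
    at most [2 Y n tau n], which sums like a geometric series. *)
Lemma piecewise_integral_le (mu : {measure set (measurableTypeR R) -> \bar R})
    (F : nat -> R -> \bar R) (Y : nat -> R) (K : R) :
  (forall A, measurable A -> (mu A <= lebesgue_measure A)%E) ->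
  (forall n, measurable_fun setT (F n)) ->
  (forall n t, rests n t -> F n t = 0%E) ->
  (forall n t, (0 <= F n t <= (Y n)%:E)%E) ->
  (forall n, Y n * tau n <= K * 2^-1 ^+ n) ->
  (\int[mu]_t piecewise F t <= (4 * K)%:E)%E.
Proof.
move=> mul mF F0 FY YK.
have Y0 n : 0 <= Y n.
  by have /andP[/le_trans h /h] := FY n 0; rewrite lee_fin.
have K0 : 0 <= K.
  have := YK 0%N; rewrite expr0 mulr1; apply: le_trans.
  by have /andP[t0 _] := tau_small 0; rewrite mulr_ge0 // ltW.
rewrite -idx_cover ge0_integral_bigcup //; last 2 first.
- by rewrite idx_cover; exact: measurable_piecewise.
- by move=> t _; have /andP[] := FY (cell_idx t) t.
have B n : (\int[mu]_(t in idx_set n) piecewise F t <= (2 * K * 2^-1 ^+ n)%:E)%E.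
  pose J : set R := `[cell_mid n - tau n, cell_mid n + tau n]%classic.
  have mJ : measurable J by exact: measurable_itv.
  rewrite (_ : (\int[mu]_(t in idx_set n) piecewise F t = \int[mu]_(t in idx_set n) F n t)%E); last first.
    by apply: eq_integral => t; rewrite inE /piecewise /= => ->.
  apply: (@le_trans _ _ (\int[mu]_t F n t)%E).
    have h : forall t, [set: measurableTypeR R] t -> (0 <= F n t)%E.
      by move=> t _; have /andP[] := FY n t.
    exact: (@ge0_subset_integral _ _ _ mu _ _ (measurable_idx n) measurableT _ (mF n) h).
  apply: (@le_trans _ _ (\int[mu]_t ((Y n)%:E * (\1_J t)%:E))%E).
    apply: ge0_le_integral => //.
    - by move=> t _; have /andP[] := FY n t.
    - exact: mF.
    - by apply: measurable_funeM; apply/measurable_EFinP; exact: measurable_indic.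
    - move=> t _; have [tJ|tJ] := pselect (J t).
        by rewrite indicE mem_set // mule1; have /andP[] := FY n t.
      rewrite indicE memNset // mule0 F0 // /rests ltNge; apply/negP => H; apply: tJ.
      by rewrite /J /= in_itv /= -ler_distlC distrC.
  rewrite ge0_integralZl ?lee_fin //; last first.
  - by apply/measurable_EFinP; exact: measurable_indic.
  rewrite integral_indic // setIT.
  apply: (@le_trans _ _ ((Y n)%:E * (2 * tau n)%:E)%E).
    apply: lee_wpmul2l; first by rewrite lee_fin.
    apply: (le_trans (mul _ mJ)); rewrite lebesgue_measure_itv /= lte_fin.
    by have /andP[tn _] := tau_small n; case: ifPn => _; rewrite ?lee_fin; lra.
  by rewrite -EFinM lee_fin; have := YK n; nra.
apply: lime_le.
  by apply: is_cvg_nneseries => n _ _; apply: integral_ge0 => t _; have /andP[] := FY (cell_idx t) t.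
apply: nearW => n; apply: (le_trans (lee_sum _ (fun i _ => B i))).
rewrite sumEFin lee_fin; apply: (le_trans (geometric_sum_le _ _)); first by rewrite mulr_ge0.
by rewrite mulrA; lra.
Qed.

Lemma piecewise_start (X : Type) (F : nat -> R -> X) z t :
  (forall m s, rests m s -> F m s = z) -> t <= T / 2 -> piecewise F t = z.
Proof.
move=> Fz t2; have c0 : cell_left 0 = T / 2 by rewrite /cell_left x_0; field.
have r0 : rests 0 t.
  by apply: rests_left; rewrite c0 (le_trans t2) // lerDl divr_ge0 // mulr_ge0 ?ltW.
rewrite /piecewise (_ : cell_idx t = 0%N) ?Fz //.
move: t2; rewrite le_eqVlt => /orP[/eqP t2|t2]; last by apply: cell_idx_lt0; rewrite c0.
by apply: cell_idxP; rewrite -c0 in t2; rewrite t2 lexx cell_leftS.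
Qed.

Lemma piecewise_cvg_left (F : nat -> R -> R) (b : nat -> R) :
  (forall n t, `|F n t| <= b n) -> b @ \oo --> (0 : R) -> piecewise F @ T^'- --> (0 : R).
Proof.
move=> Fb b0; apply/cvgrPdist_lt => e e0.
have [M _ HM] := cvgr_lt _ b0 _ e0.
near=> t; rewrite sub0r normrN /piecewise; apply: (le_lt_trans (Fb _ _)); apply: HM => /=.
have tT : t < T by near: t; exact: nbhs_left_lt.
have Mt : cell_left M <= t.
  by near: t; apply: nbhs_left_ge; exact: cell_left_lt.
have [|n /andP[n1 n2]] := @cell_exists t; first by rewrite tT (le_trans _ Mt) // cell_left_le.
rewrite (@cell_idxP _ n) ?n1 // leqNgt; apply/negP => /cell_left_le h.
by have := lt_le_trans n2 (le_trans h Mt); rewrite ltxx.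
Unshelve. all: by end_near. Qed.

Let mu_T := mrestr lebesgue_measure (measurable_itv `]0%R, T[).

Let mu_T_le (A : set R) : measurable A -> (mu_T A <= lebesgue_measure A)%E.
Proof. by move=> mA; apply: le_measure; rewrite ?inE //; exact: measurableI. Qed.

Let mu_TT : mu_T setT = T%:E.
Proof. by rewrite /mu_T /mrestr setTI lebesgue_measure_itv /= lte_fin T0 oppr0 adde0. Qed.

Let mpow (g : R -> \bar R) (p : R) : measurable_fun setT g ->
  measurable_fun setT (fun t => (`|g t| `^ p)%E).
Proof.
move=> mg; apply: (measurableT_comp (f := fun x : \bar R => (x `^ p)%E)).
  exact: measurable_poweR.
by apply: (measurableT_comp (f := @abse R)); first exact: abse_measurable.
Qed.

Let le_pow (x y : \bar R) (p : R) : (0 <= x <= y)%E -> 0 <= p -> (x `^ p <= y `^ p)%E.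
Proof.
move=> /andP[x0 xy] p0; apply: gt0_ler_poweR; rewrite ?in_itv //= ?leey ?andbT //.
exact: le_trans xy.
Qed.

Lemma piecewise_in_LpX (X : Type) (N : X -> \bar R) (F : nat -> R -> X) (p : R)
    (Y : nat -> R) (K : R) : 0 < p ->
  (forall n, measurable_fun setT (fun t => N (F n t))) ->
  (forall n t, rests n t -> N (F n t) = 0%E) ->
  (forall n t, (0 <= N (F n t) <= (Y n)%:E)%E) ->
  (forall n, Y n `^ p * tau n <= K * 2^-1 ^+ n) ->
  in_LpX T p%:E N (piecewise F).
Proof.
move=> p0 mF F0 FY YK; split.
  apply: (@measurable_funTS _ _ _ _ `]0, T[%classic (piecewise (fun n t => N (F n t)))).
  exact: measurable_piecewise.
rewrite unlock /= poweR_lty //.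
apply: (@le_lt_trans _ _ (4 * K)%:E); last exact: ltry.
pose G n t := (`|N (F n t)| `^ p)%E.
apply: (@piecewise_integral_le mu_T G (fun n => Y n `^ p)) => //.
- by move=> n; exact: mpow.
- by move=> n t r; rewrite /G F0 // abse0 poweR0r // gt_eqF.
- move=> n t; have /andP[h0 h1] := FY n t; rewrite /G poweR_ge0 /= gee0_abs //.
  by rewrite -poweR_EFin; apply: le_pow (ltW p0); rewrite h0.
Qed.

Lemma piecewise_in_LpX_bounded (X : Type) (N : X -> \bar R) (F : nat -> R -> X) (p : \bar R)
    (K : R) : (0 < p)%E ->
  (forall n, measurable_fun setT (fun t => N (F n t))) ->
  (forall n t, (0 <= N (F n t) <= K%:E)%E) ->
  in_LpX T p N (piecewise F).
Proof.
move=> p0 mF FY; have mG : measurable_fun setT (fun t => N (piecewise F t)).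
  exact: (@measurable_piecewise _ _ (fun n t => N (F n t))).
split; first exact: measurable_funTS.
have GK t : (`|N (piecewise F t)| <= K%:E)%E.
  by have /andP[h0 h1] := FY (cell_idx t) t; rewrite gee0_abs.
have K0 : 0 <= K by have := le_trans (abse_ge0 _) (GK 0); rewrite lee_fin.
case: p p0 => [p|_|//]; rewrite ?lte_fin; last first.
  rewrite unlock /=; case: ifPn => _; last by [].
  by apply: le_lt_trans (ltry K); apply/ess_supP; apply: aeW => t /=; exact: GK.
move=> p0; rewrite unlock /=.
  rewrite poweR_lty //; apply: (@le_lt_trans _ _ (\int[mu_T]_t (K `^ p)%:E)%E).
    apply: ge0_le_integral => //.
    - by move=> t _; exact: poweR_ge0.
    - exact: mpow.
    - by move=> t _; rewrite -poweR_EFin; apply: le_pow; rewrite ?abse_ge0 ?GK ?ltW.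
  apply: (@le_lt_trans _ _ ((K `^ p)%:E * mu_T setT)%E); first by rewrite integral_cst.
  by rewrite mu_TT -EFinM ltry.
Qed.

End gluing.

(** * Improper integrals in time *)

Section time_primitives.
Context {R : realType}.
Implicit Types (g Phi e D : R -> R) (a b t : R).
Local Notation leb := (@lebesgue_measure R).

Lemma set_integral_cvg g Phi (t0 t1 : R) : t0 < t1 ->
  (forall a b, t0 < a -> a <= b -> b < t1 -> set_integral g (a, b) = Phi b - Phi a) ->
  Phi @ t0^'+ --> Phi t0 -> Phi @ t1^'- --> Phi t1 ->
  set_integral g @ filter_prod t0^'+ t1^'- --> Phi t1 - Phi t0.
Proof.
move=> t01 H P0 P1.
have C : (fun ab : R * R => Phi ab.2 - Phi ab.1) @ filter_prod t0^'+ t1^'- --> Phi t1 - Phi t0.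
  apply: cvgB.
  - apply: (cvg_comp _ _ (@cvg_snd _ _ _ _ _) P1).
  - apply: (cvg_comp _ _ (@cvg_fst _ _ _ _ _) P0).
apply: cvg_trans C; apply: near_eq_cvg.
pose m := (t0 + t1) / 2; have tm : t0 < m < t1 by rewrite /m; lra.
have /andP[m0 m1] := tm.
exists ([set a | t0 < a < m], [set b | m < b < t1]); first split => /=.
- near=> a; apply/andP; split; near: a; [exact: nbhs_right_gt|exact: nbhs_right_lt].
- near=> b; apply/andP; split; near: b; [exact: nbhs_left_gt|exact: nbhs_left_lt].
move=> [a b] /= [/andP[a0 am] /andP[bm b1]]; rewrite H //.
by rewrite ltW // (lt_trans am).
Unshelve. all: by end_near. Qed.

Lemma set_integral_cvg0 g t : set_integral g @ filter_prod t^'+ t^'- --> (0 : R).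
Proof.
apply: (@cvg_trans _ ((fun=> 0 : R) @ filter_prod t^'+ t^'-)); last exact: cvg_cst.
apply: near_eq_cvg.
exists ([set a | t < a], [set b | b < t]); first split => /=.
- exact: nbhs_right_gt.
- exact: nbhs_left_lt.
move=> [a b] /= [ta bt]; rewrite /set_integral /= set_itv_ge ?Rintegral_set0 //.
by rewrite bnd_simp -ltNge (lt_trans bt).
Qed.

Variable (T : R).
Hypothesis T0 : 0 < T.

Lemma time_integral_primitive g Phi :
  (forall a b, 0 < a -> a <= b -> b < T -> set_integral g (a, b) = Phi b - Phi a) ->
  (forall t, 0 < t < T -> {for t, continuous Phi}) ->
  Phi @ 0^'+ --> Phi 0 -> Phi @ T^'- --> Phi T ->
  forall t0 t1, 0 <= t0 <= T -> 0 <= t1 <= T -> time_integral g t0 t1 = Phi t1 - Phi t0.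
Proof.
move=> H C P0 PT.
have r t : 0 <= t < T -> Phi @ t^'+ --> Phi t.
  move=> /andP[]; rewrite le_eqVlt => /orP[/eqP <- //|t0 tT].
  by apply: cvg_at_right_filter; apply: C; rewrite t0.
have l t : 0 < t <= T -> Phi @ t^'- --> Phi t.
  move=> /andP[t0]; rewrite le_eqVlt => /orP[/eqP -> //|tT].
  by apply: cvg_at_left_filter; apply: C; rewrite t0.
have L t0 t1 : 0 <= t0 -> t0 < t1 -> t1 <= T ->
    lim (set_integral g @ filter_prod t0^'+ t1^'-) = Phi t1 - Phi t0.
  move=> h0 h1 h2; apply/cvg_lim => //; apply: set_integral_cvg => //.
  - by move=> a b ta ab bt; apply: H => //; [exact: le_lt_trans ta|exact: lt_le_trans h2].
  - by apply: r; rewrite h0 (lt_le_trans h1).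
  - by apply: l; rewrite h2 (le_lt_trans h0).
move=> t0 t1 /andP[a0 a1] /andP[b0 b1]; rewrite /time_integral.
have [t01|t10|->] := ltgtP t0 t1.
- exact: L.
- by rewrite L // opprB.
- by rewrite subrr; apply/cvg_lim => //; exact: set_integral_cvg0.
Qed.

Lemma continuous_locally_integrable g : (forall t, 0 < t < T -> {for t, continuous g}) ->
  locally_integrable `]0, T[ g.
Proof.
move=> C; split; last first.
- move=> K KD cK.
  have CK : {within K, continuous g}.
    apply: continuous_in_subspaceT => t; rewrite inE => /KD /=; rewrite in_itv /=; exact: C.
  by have /integrableP[] := continuous_compact_integrable cK CK.
- exact: interval_open.
- apply: open_continuous_measurable_fun; first exact: interval_open.
  by move=> t; rewrite inE /= in_itv /=; exact: C.
Qed.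

Lemma class_L_primitive g Phi :
  (forall t, 0 < t < T -> {for t, continuous g}) ->
  (forall a b, 0 < a -> a <= b -> b < T -> set_integral g (a, b) = Phi b - Phi a) ->
  Phi @ 0^'+ --> Phi 0 -> Phi @ T^'- --> Phi T -> class_L T g.
Proof.
move=> C H P0 PT; split; first exact: continuous_locally_integrable.
by exists (Phi T - Phi 0); exact: set_integral_cvg.
Qed.

Lemma set_integral_derive e g : (forall t, 0 < t < T -> is_derive t (1 : R) e (g t)) ->
  (forall t, 0 < t < T -> {for t, continuous g}) ->
  forall a b, 0 < a -> a <= b -> b < T -> set_integral g (a, b) = e b - e a.
Proof.
move=> de cg a b a0; rewrite le_eqVlt => /orP[/eqP <- _|ab bT].
  by rewrite subrr /set_integral /= set_itv1 Rintegral_set1.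
have I t : a <= t <= b -> 0 < t < T.
  by move=> /andP[h1 h2]; rewrite (lt_le_trans a0) // (le_lt_trans h2).
have ce t : a <= t <= b -> {for t, continuous e}.
  move=> /I /de [dt _]; apply: differentiable_continuous; exact/derivable1_diffP.
rewrite /set_integral /= /Rintegral (@continuous_FTC2 _ _ e) //.
- apply: continuous_in_subspaceT => t; rewrite inE /= in_itv /= => /I; exact: cg.
- split.
  + by move=> t; rewrite in_itv /= => /andP[h1 h2]; have [] := de t (I t _); rewrite ?ltW.
  + by apply: cvg_at_right_filter; apply: ce; rewrite lexx ltW.
  + by apply: cvg_at_left_filter; apply: ce; rewrite lexx ltW.
- move=> t; rewrite in_itv /= => /andP[h1 h2]; rewrite derive1E.
  by have tab : a <= t <= b; [rewrite !ltW|have [_ ->] := de t (I t tab)].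
Qed.

Lemma integrable_primitive D : leb.-integrable setT (EFin \o D) ->
  exists Phi, (forall t, 0 <= t <= T -> {for t, continuous Phi}) /\
    (forall a b, 0 < a -> a <= b -> b < T -> set_integral D (a, b) = Phi b - Phi a).
Proof.
(* Starting at -1 puts all of [0, T] in the interior of the domain of the
   primitive. *)
move=> iD; exists (fun t => parameterized_integral leb (-1) t D); split.
- move=> t /andP[t0 tT].
  have h : -1 < T + 1 :> R by move: T0; lra.
  have := @parameterized_integral_continuous R (-1) (T + 1) D (ltW h) (integrableS _ _ _ iD).
  move=> /(_ (@measurableT _ _) (measurable_itv _) (@subsetT _ _)) /(continuous_within_itvP _ h)[+ _ _].
  by apply; rewrite in_itv /=; lra.
- move=> a b a0 ab bT; rewrite /set_integral /= /parameterized_integral.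
  have a1 : -1 < a by move: a0; lra.
  have iS (A : set R) : measurable A -> leb.-integrable A (EFin \o D).
    move=> mA; have H := integrableS _ _ _ iD; exact: (H _ measurableT mA (@subsetT _ _)).
  have := @Rintegral_itvB R D (BLeft (-1)) (BRight b) a (iS _ (measurable_itv _)).
  rewrite !bnd_simp (ltW a1) ab => -> //.
  rewrite Rintegral_itv_obnd_cbnd //; apply: iS; exact: measurable_itv.
Qed.

End time_primitives.

(** * Flows made of pulses *)

Section separated_fields.
Context {R : realType} {d : nat}.
Implicit Types (v w : 'rV[R]_d -> 'rV[R]_d) (c : R).

Lemma smooth_time_field (a : R -> R) v : smooth_on setT a -> tf_vec v ->
  smooth_on setT (fun z : R * 'rV[R]_d => a z.1 *: v z.2).
Proof.
move=> sa tv.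
have -> : (fun z : R * 'rV[R]_d => a z.1 *: v z.2) =
    (fun z => \sum_i (a z.1 * component v i z.2) *: unit_vec i).
  apply/funext => z; rewrite [LHS]row_sum_delta; apply: eq_bigr => i _.
  by rewrite mxE.
have d1 (y : R * 'rV[R]_d) : is_diff y fst (fst : R * 'rV[R]_d -> R).
  by apply: DiffDef; [apply: linear_differentiable => ?; exact: cvg_fst|rewrite diff_lin // => ?; exact: cvg_fst].
have d2 (y : R * 'rV[R]_d) : is_diff y snd (snd : R * 'rV[R]_d -> 'rV[R]_d).
  by apply: DiffDef; [apply: linear_differentiable => ?; exact: cvg_snd|rewrite diff_lin // => ?; exact: cvg_snd].
apply: smooth_on_sum => [|i]; first exact: openT.
apply: smooth_onZl; first exact: openT.
apply: smooth_onM; first exact: openT.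
- exact: (smooth_on_comp_affine (@openT _) d1 (fun _ _ => I) sa).
- have [sv _] := tv i; exact: (smooth_on_comp_affine (@openT _) d2 (fun _ _ => I) sv).
Qed.

Lemma tf_vecZ c v : tf_vec v -> tf_vec (fun x => c *: v x).
Proof.
move=> tv i; have -> : component (fun x => c *: v x) i = (fun x => c * component v i x).
  by apply/funext => x; rewrite /component mxE.
exact: tfZ.
Qed.

Lemma tf_vec_periodic v : tf_vec v -> torus_periodic v.
Proof. by move=> tv j x; apply/rowP => i; have [_ h] := tv i; exact: h. Qed.

Lemma componentZ c v i : component (fun x => c *: v x) i = (fun x => c * component v i x).
Proof. by apply/funext => x; rewrite /component mxE. Qed.

Lemma gradientZ c v x : tf_vec v -> gradient (fun x => c *: v x) x = c *: gradient v x.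
Proof.
by move=> tv; apply/matrixP => i j; rewrite !mxE componentZ partialZ.
Qed.

Lemma convectionZ c v x : tf_vec v ->
  convection (fun x => c *: v x) x = c ^+ 2 *: convection v x.
Proof.
move=> tv; apply/rowP => i; rewrite !mxE mulr_sumr; apply: eq_bigr => j _.
by rewrite componentZ partialZ // mxE; ring.
Qed.

Lemma sumsqZ m n c (A : 'M[R]_(m, n)) : sumsq (c *: A) = c ^+ 2 * sumsq A.
Proof.
rewrite /sumsq mulr_sumr; apply: eq_bigr => i _; rewrite mulr_sumr; apply: eq_bigr => j _.
by rewrite mxE exprMn.
Qed.

Lemma tf_torus_cont_dot v w : tf_vec v -> tf_vec w ->
  torus_cont (fun x => \sum_i v x 0 i * w x 0 i).
Proof.
move=> tv tw; apply: torus_cont_sum => i _; apply: torus_contM; apply: tf_torus_cont.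
  exact: tv.
exact: tw.
Qed.

Lemma inner_self v : inner v v = tint (fun x => sumsq (v x)).
Proof.
by rewrite inner_tint; apply: eq_tint => x; rewrite /sumsq big_ord1; apply: eq_bigr => i _; rewrite expr2.
Qed.

Lemma innerC v w : inner v w = inner w v.
Proof. by rewrite !inner_tint; apply: eq_tint => x; apply: eq_bigr => i _; rewrite mulrC. Qed.

Lemma inner_lin3 c v (a b e : R) w1 w2 w3 : tf_vec v -> tf_vec w1 -> tf_vec w2 -> tf_vec w3 ->
  inner (fun x => c *: v x) (fun x => a *: w1 x - b *: w2 x + e *: w3 x) =
  c * a * inner v w1 - c * b * inner v w2 + c * e * inner v w3.
Proof.
move=> tv t1 t2 t3.
have C (k : R) w : tf_vec w -> torus_cont (fun x => k * \sum_i v x 0 i * w x 0 i).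
  by move=> tw; apply/torus_contZ/tf_torus_cont_dot.
rewrite !inner_tint -!tintZ; try exact: tf_torus_cont_dot.
rewrite -tintB; try exact: C.
rewrite -tintD; [|by apply: torus_contB; exact: C|exact: C].
apply: eq_tint => x; rewrite !mulr_sumr -sumrB -big_split /=; apply: eq_bigr => i _.
by rewrite !mxE; ring.
Qed.

Lemma sq_norm2Z m n c (w : 'rV[R]_d -> 'M[R]_(m, n)) : entries_cont w ->
  sq_norm2 (fun x => c *: w x) = c ^+ 2 * tint (fun x => sumsq (w x)).
Proof.
move=> cw; rewrite sq_norm2E; last first.
  move=> i j; have -> : (fun x => (c *: w x) i j) = (fun x => c * w x i j).
    by apply/funext => x; rewrite mxE.
  exact/torus_contZ/cw.
rewrite -tintZ; last exact: torus_cont_sumsq.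
by apply: eq_tint => x; rewrite sumsqZ.
Qed.

Lemma L2_sumsq_integrable w : in_L2 w ->
  (torus_measure d).-integrable setT (EFin \o (fun x => sumsq (w (torus_pt x)))).
Proof.
move=> [_ mw Lw]; apply/integrableP; split.
  apply/measurable_EFinP; rewrite /sumsq.
  under eq_fun do rewrite big_ord1.
  by apply: measurable_sum => i; apply: measurable_funX; exact: mw.
move: Lw; rewrite Lp_normE // => /lty_poweRy; rewrite invr_eq0 => /(_ _)/wrap[].
  by rewrite pnatr_eq0.
apply: le_lt_trans; rewrite le_eqVlt; apply/orP; left; apply/eqP; apply: eq_integral => x _ /=.
by rewrite ger0_norm ?sumsq_ge0 // powR_mulrn ?enorm_ge0 // enorm_sqr.
Qed.

(** The weight, to be chosen depending on [w], makes the pairing small as soon as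
    the energy of [v] is. *)
Lemma inner_young v w (dl : R) : tf_vec v -> in_L2 w -> 0 < dl ->
  `|inner v w| <= 2^-1 * (dl^-1 * tint (fun x => sumsq (v x)) + dl * tint (fun x => sumsq (w x))).
Proof.
move=> tv Lw dl0; have [_ mw _] := Lw.
have Iv := torus_cont_integrable (torus_cont_sumsq (entries_cont_vec tv)).
have Iw := L2_sumsq_integrable Lw.
pose h x := 2^-1 * (dl^-1 * sumsq (v x) + dl * sumsq (w x)).
have Ih1 : (torus_measure d).-integrable setT (EFin \o (fun x => dl^-1 * sumsq (v (torus_pt x)))).
  exact: integrableZl Iv.
have Ih2 : (torus_measure d).-integrable setT (EFin \o (fun x => dl * sumsq (w (torus_pt x)))).
  exact: integrableZl Iw.
have Ih3 : (torus_measure d).-integrable setT (EFin \o (fun x => dl^-1 * sumsq (v (torus_pt x)) + dl * sumsq (w (torus_pt x)))).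
  exact: integrableD Ih1 Ih2.
have Ih : (torus_measure d).-integrable setT (EFin \o (fun x => h (torus_pt x))).
  exact: integrableZl Ih3.
have W x : `|\sum_i v x 0 i * w x 0 i| <= h x.
  apply: (le_trans (ler_norm_sum _ _ _)).
  rewrite /h /sumsq !big_ord1 !mulr_sumr -big_split /= mulr_sumr; apply: ler_sum => i _.
  set a := v x 0 i; set b := w x 0 i; rewrite ler_norml.
  have -> : dl^-1 * a ^+ 2 + dl * b ^+ 2 = dl^-1 * (a ^+ 2 + (dl * b) ^+ 2).
    by field; rewrite gt_eqF.
  have E : a * b = dl^-1 * (a * (dl * b)) by field; rewrite gt_eqF.
  have i0 : 0 < dl^-1 by rewrite invr_gt0.
  rewrite E; apply/andP; split.
  - rewrite -subr_ge0.
    have -> : dl^-1 * (a * (dl * b)) - - (2^-1 * (dl^-1 * (a ^+ 2 + (dl * b) ^+ 2))) = dl^-1 * ((a + dl * b) ^+ 2 / 2) by field; rewrite gt_eqF.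
    by rewrite mulr_ge0 // ?divr_ge0 ?sqr_ge0 // ltW.
  - rewrite -subr_ge0.
    have -> : 2^-1 * (dl^-1 * (a ^+ 2 + (dl * b) ^+ 2)) - dl^-1 * (a * (dl * b)) = dl^-1 * ((a - dl * b) ^+ 2 / 2) by field; rewrite gt_eqF.
    by rewrite mulr_ge0 // ?divr_ge0 ?sqr_ge0 // ltW.
have mi : measurable_fun setT (fun x : d.-tuple R => \sum_i v (torus_pt x) 0 i * w (torus_pt x) 0 i).
  apply: measurable_sum => i; apply: measurable_funM; last exact: mw.
  by have [c _] := tf_torus_cont (tv i); exact: (measurable_continuous_torus c).
have Ii : (torus_measure d).-integrable setT (EFin \o (fun x => \sum_i v (torus_pt x) 0 i * w (torus_pt x) 0 i)).
  apply: (le_integrable _ _ _ Ih) => //; first exact/measurable_EFinP.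
  by move=> x _ /=; rewrite lee_fin; apply: (le_trans (W _)); exact: ler_norm.
have -> : 2^-1 * (dl^-1 * tint (fun x => sumsq (v x)) + dl * tint (fun x => sumsq (w x))) = tint h.
  by rewrite /tint RintegralZl // RintegralD // !RintegralZl.
apply: (le_trans (le_normr_Rintegral _ Ii)) => //.
by apply: le_Rintegral => //; exact: (integrable_norm Ii).
Qed.

End separated_fields.

Section pulses.
Context {R : realType} {d : nat}.
Variable chi : 'rV[R]_d.+1 -> R.
Hypothesis hchi : LP_cutoff chi.
Variables (T : R) (tau : nat -> R) (U : nat -> 'rV[R]_d.+1 -> 'rV[R]_d.+1).
Hypotheses (T0 : 0 < T) (tau_small : forall n, 0 < tau n <= T * 2^-1 ^+ n.+1 / 16).
Hypotheses (tfU : forall n, tf_vec (U n)) (dfU : forall n, div_free (U n)).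

Definition pulse n t : R := time_bump chi ((t - cell_mid T n) / tau n).
Definition dpulse n t : R := (tau n)^-1 * dtime_bump chi ((t - cell_mid T n) / tau n).

Definition velocity_piece n t : 'rV[R]_d.+1 -> 'rV[R]_d.+1 :=
  fun x => pulse n t *: U n x.
(** What the equation leaves with zero pressure; [dpulse] is the derivative of
    [pulse]. *)
Definition force_piece n t : 'rV[R]_d.+1 -> 'rV[R]_d.+1 :=
  fun x => dpulse n t *: U n x - pulse n t *: lap (U n) x + pulse n t ^+ 2 *: convection (U n) x.
Definition velocity := piecewise T velocity_piece.
Definition force := piecewise T force_piece.

Let tau_gt0 n : 0 < tau n. Proof. by case/andP: (tau_small n). Qed.

Let rests_gt1 n t : rests T tau n t -> 1 < `|(t - cell_mid T n) / tau n|.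
Proof.
rewrite /rests => H; rewrite normrM normfV (gtr0_norm (tau_gt0 n)).
by rewrite ltr_pdivlMr // mul1r.
Qed.

Lemma pulse_rests n t : rests T tau n t -> pulse n t = 0.
Proof. by move=> /rests_gt1/ltW; exact: time_bump0. Qed.

Lemma dpulse_rests n t : rests T tau n t -> dpulse n t = 0.
Proof. by move=> /rests_gt1 H; rewrite /dpulse dtime_bump0 // mulr0. Qed.

Lemma velocity_rests n t : rests T tau n t -> velocity_piece n t = fun=> 0.
Proof. by move=> H; apply/funext => x; rewrite /velocity_piece pulse_rests // scale0r. Qed.

Lemma force_rests n t : rests T tau n t -> force_piece n t = fun=> 0.
Proof.
move=> H; apply/funext => x; rewrite /force_piece pulse_rests // dpulse_rests //.
by rewrite expr0n !scale0r subrr addr0.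
Qed.

Let affine_diff n (t : R) :
  is_diff t (fun s : R => (s - cell_mid T n) / tau n) (fun s => (tau n)^-1 * s).
Proof.
have -> : (fun s : R => (s - cell_mid T n) / tau n) = (tau n)^-1 *: (id - cst (cell_mid T n)).
  by apply/funext => s; rewrite mulrC.
have -> : (fun s : R => (tau n)^-1 * s) = (tau n)^-1 *: (id - (0 : R -> R)).
  by apply/funext => s; rewrite subr0.
exact: is_diffZ.
Qed.

Lemma pulse_smooth n : smooth_on setT (pulse n).
Proof.
exact: (smooth_on_comp_affine (@openT _) (affine_diff n) (fun _ _ => I) (time_bump_smooth hchi)).
Qed.

Lemma dpulse_smooth n : smooth_on setT (dpulse n).
Proof.
apply: smooth_onM; first exact: openT; first exact: smooth_on_cst.
exact: (smooth_on_comp_affine (@openT _) (affine_diff n) (fun _ _ => I) (dtime_bump_smooth hchi)).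
Qed.

Lemma pulse_cont n : continuous (pulse n).
Proof. by move=> t; apply: (pulse_smooth n 0). Qed.

Lemma dpulse_cont n : continuous (dpulse n).
Proof. by move=> t; apply: (dpulse_smooth n 0). Qed.

Lemma pulse_itv n t : 0 <= pulse n t <= 1.
Proof. exact: time_bump_itv. Qed.

Lemma pulse_is_derive n (t : R) : is_derive t (1 : R) (pulse n) (dpulse n t).
Proof.
have -> : pulse n = time_bump chi \o (fun s => s * (tau n)^-1 + - cell_mid T n / tau n).
  by apply/funext => s; rewrite /pulse /= mulrBl mulNr.
have -> : dpulse n t = dtime_bump chi (t * (tau n)^-1 + - cell_mid T n / tau n) * (tau n)^-1.
  by rewrite /dpulse mulrC mulrBl mulNr.
apply: is_derive1_comp; last exact: is_derive_affine.
exact: time_bump_is_derive.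
Qed.

Lemma velocity_smooth : smooth_QT T velocity.
Proof.
apply: (piecewise_smooth_QT T0 tau_small velocity_rests).
- move=> n; exact: smooth_time_field (pulse_smooth n) (tfU n).
- by move=> n t j x; rewrite /velocity_piece (tf_vec_periodic (tfU n)).
Qed.

Lemma force_smooth : smooth_QT T force.
Proof.
apply: (piecewise_smooth_QT T0 tau_small force_rests).
- move=> n; have sm := smooth_onD (@openT _) (smooth_onD (@openT _)
   (smooth_time_field (dpulse_smooth n) (tfU n))
   (smooth_time_field (smooth_onM (@openT _) (smooth_on_cst setT (-1 : R)) (pulse_smooth n)) (fun i => tf_lap i (tfU n))))
   (smooth_time_field (smooth_onM (@openT _) (pulse_smooth n) (pulse_smooth n)) (fun i => tf_convection i (tfU n))).
  apply: (eq_smooth_on (@openT _) _ sm) => z _ /=.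
  by rewrite mulN1r scaleNr.
- move=> n t j x; rewrite /force_piece (tf_vec_periodic (tfU n)).
  rewrite (tf_vec_periodic (fun i => tf_lap i (tfU n))).
  by rewrite (tf_vec_periodic (fun i => tf_convection i (tfU n))).
Qed.

Lemma velocity_near t : t < T -> exists n, [/\ \forall s \near t, velocity s = velocity_piece n s,
  velocity t = velocity_piece n t & force t = force_piece n t].
Proof.
move=> tT; have [n nt] := piecewise_near T0 tau_small tT; exists n; split.
- by apply: filterS nt => s; exact: agrees_piecewise velocity_rests.
- by apply: (agrees_piecewise velocity_rests); exact: (nbhs_singleton nt).
- by apply: (agrees_piecewise force_rests); exact: (nbhs_singleton nt).
Qed.

Let lapZ c (v : 'rV[R]_d.+1 -> 'rV[R]_d.+1) i x : tf_vec v ->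
  \sum_j partial j (partial j (component (fun x => c *: v x) i)) x = c * lap v x 0 i.
Proof.
move=> tv; rewrite mxE mulr_sumr componentZ; apply: eq_bigr => j _.
have -> : partial j (fun x => c * component v i x) = (fun x => c * partial j (component v i) x).
  by apply/funext => y; rewrite partialZ.
by rewrite partialZ //; exact: tf_partial.
Qed.

Let div_freeZ c (v : 'rV[R]_d.+1 -> 'rV[R]_d.+1) : tf_vec v -> div_free v ->
  div_free (fun x => c *: v x).
Proof.
move=> tv dv x; transitivity (c * \sum_j partial j (component v j) x); last by rewrite dv mulr0.
by rewrite mulr_sumr; apply: eq_bigr => j _; rewrite componentZ partialZ.
Qed.

Lemma pulses_NSE t x : 0 < t < T -> NSE_at velocity force (fun _ _ => 0) t x.
Proof.
move=> /andP[_ tT]; have [n [near_u ut ft]] := velocity_near tT.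
have tv := tf_vecZ (pulse n t) (tfU n); have dv := div_freeZ (pulse n t) (tfU n) (dfU n).
split; last by rewrite ut; exact: dv.
move=> i; have -> : derive1 (fun s => velocity s x 0 i) t = dpulse n t * U n x 0 i.
  rewrite derive1E.
  have E : \forall s \near t, velocity s x 0 i = pulse n s * U n x 0 i.
    by apply: filterS near_u => s ->; rewrite /velocity_piece mxE.
  rewrite (near_eq_derive (1 : R) E).
  have := @is_deriveM R R (pulse n) (cst (U n x 0 i)) t (1 : R) _ _ (pulse_is_derive n t) (is_derive_cst _ _ _).
  rewrite (_ : (fun s => pulse n s * U n x 0 i) = pulse n * cst (U n x 0 i)) //.
  by case=> _ ->; rewrite scaler0 add0r /GRing.scale /= mulrC.
rewrite ut ft (div_tensor _ _ tv dv) (convectionZ _ _ (tfU n)) (lapZ _ _ _ (tfU n)) !mxE partial_cst addr0.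
by congr (_ - _ + _); rewrite mxE.
Qed.

(** The nonlinear term does no work, as [U n] is divergence free. *)
Lemma inner_pieces n t : inner (velocity_piece n t) (force_piece n t) =
  pulse n t * dpulse n t * tint (fun x => sumsq (U n x)) +
  pulse n t ^+ 2 * tint (fun x => sumsq (gradient (U n) x)).
Proof.
rewrite /force_piece (inner_lin3 _ _ _ _ (tfU n) (tfU n) (fun i => tf_lap i (tfU n))
  (fun i => tf_convection i (tfU n))).
by rewrite inner_self lap_energy // [inner (U n) (convection _)]innerC convection_orth //; ring.
Qed.

Section energy.
Variable K : R.
Let E n := tint (fun x => sumsq (U n x)).
Let G n := tint (fun x => sumsq (gradient (U n) x)).
Hypotheses (EK : forall n, E n <= K * 2^-1 ^+ n) (GK : forall n, G n * tau n <= K * 2^-1 ^+ n).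

Let E0 n : 0 <= E n. Proof. by apply: tint_ge0 => x; exact: sumsq_ge0. Qed.
Let G0 n : 0 <= G n. Proof. by apply: tint_ge0 => x; exact: sumsq_ge0. Qed.

Definition kinetic := piecewise T (fun n t => pulse n t ^+ 2 * tint (fun x => sumsq (U n x))).
Definition dissipation := piecewise T (fun n t => pulse n t ^+ 2 * tint (fun x => sumsq (gradient (U n) x))).
Definition kinetic_rate := piecewise T (fun n t => 2 * pulse n t * dpulse n t * tint (fun x => sumsq (U n x))).

Lemma sq_norm2_velocity t : sq_norm2 (velocity t) = kinetic t.
Proof. by rewrite /velocity /piecewise sq_norm2Z //; exact: entries_cont_vec. Qed.

Lemma sq_norm2_gradient_velocity t : sq_norm2 (gradient (velocity t)) = dissipation t.
Proof.
rewrite /velocity /piecewise /velocity_piece.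
rewrite (_ : gradient _ = fun x => pulse (cell_idx T t) t *: gradient (U (cell_idx T t)) x).
  by rewrite sq_norm2Z //; exact: entries_cont_gradient.
by apply/funext => x; rewrite gradientZ.
Qed.

Lemma inner_velocity_force t : inner (velocity t) (force t) = dissipation t + 2^-1 * kinetic_rate t.
Proof. by rewrite [LHS]inner_pieces addrC; congr (_ + _); rewrite /kinetic_rate /piecewise; field. Qed.

Let near_cont (F : nat -> R -> R) t : t < T -> (forall n s, rests T tau n s -> F n s = 0) ->
  (forall n, continuous (F n)) -> {for t, continuous (piecewise T F)}.
Proof.
move=> tT F0 cF; have [n nt] := piecewise_near T0 tau_small tT.
have e : \forall s \near t, F n s = piecewise T F s.
  by apply: filterS nt => s /(agrees_piecewise F0).
have := cF n t; rewrite /prop_for /continuous_at -(nbhs_singleton e).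
by apply: cvg_trans; exact: near_eq_cvg.
Qed.

Lemma dissipation_cont t : t < T -> {for t, continuous dissipation}.
Proof.
move=> tT; apply: near_cont => //.
- by move=> n s r; rewrite pulse_rests // expr0n mul0r.
- move=> n s; apply: cvgM; last exact: cvg_cst.
  by apply: cvgM; exact: pulse_cont.
Qed.

Lemma kinetic_rate_cont t : t < T -> {for t, continuous kinetic_rate}.
Proof.
move=> tT; apply: near_cont => //.
- by move=> n s r; rewrite pulse_rests // mulr0 !mul0r.
- move=> n s; apply: cvgM; last exact: cvg_cst.
  apply: cvgM; last exact: dpulse_cont.
  by apply: cvgM; [exact: cvg_cst|exact: pulse_cont].
Qed.

Lemma kinetic_is_derive t : t < T -> is_derive t (1 : R) kinetic (kinetic_rate t).
Proof.
move=> tT; have [n nt] := piecewise_near T0 tau_small tT.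
have k0 m s : rests T tau m s -> pulse m s ^+ 2 * E m = 0.
  by move=> r; rewrite pulse_rests // expr0n mul0r.
have r0 m s : rests T tau m s -> 2 * pulse m s * dpulse m s * E m = 0.
  by move=> r; rewrite pulse_rests // mulr0 !mul0r.
have e : \forall s \near t, pulse n s * pulse n s * E n = kinetic s.
  by apply: filterS nt => s H; rewrite /kinetic (agrees_piecewise k0 H) expr2.
rewrite /kinetic_rate (agrees_piecewise r0 (nbhs_singleton nt)).
have D := is_deriveM (is_deriveM (pulse_is_derive n t) (pulse_is_derive n t)) (is_derive_cst (E n) t (1 : R)).
have [D1 D2] := D; split.
  exact: near_eq_derivable e D1.
by rewrite -(near_eq_derive (1 : R) e) D2 scaler0 add0r /GRing.scale /=; ring.
Qed.

Lemma kinetic_start t : t <= T / 2 -> kinetic t = 0.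
Proof.
by apply: (piecewise_start T0 tau_small) => n s r; rewrite pulse_rests // expr0n mul0r.
Qed.

Let K2_cvg : (fun n => K * 2^-1 ^+ n) @ \oo --> (0 : R).
Proof.
rewrite -[X in _ --> X](mulr0 K); apply: cvgM; first exact: cvg_cst.
by apply: cvg_expr; rewrite ger0_norm //; lra.
Qed.

Lemma kinetic_left : kinetic @ T^'- --> (0 : R).
Proof.
apply: (piecewise_cvg_left T0 _ K2_cvg) => n t.
have /andP[p0 p1] := pulse_itv n t.
rewrite ger0_norm ?mulr_ge0 ?exprn_ge0 ?E0 //; apply: le_trans (EK n).
by rewrite ler_piMl ?E0 // exprn_ile1.
Qed.

Lemma dissipation_integrable :
  (@lebesgue_measure R).-integrable setT (EFin \o dissipation).
Proof.
apply/integrableP; split.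
  apply/measurable_EFinP; apply: (measurable_piecewise T0) => n.
  apply: continuous_measurable_fun => s.
  by apply: cvgM; [apply: cvgM; exact: pulse_cont|exact: cvg_cst].
pose F n t := (pulse n t ^+ 2 * G n)%:E.
rewrite (_ : (fun t => `|(EFin \o dissipation) t|)%E = piecewise T F); last first.
  apply/funext => t; rewrite /piecewise /F /= /dissipation /piecewise ger0_norm //.
  by rewrite mulr_ge0 ?G0 // exprn_ge0 //; case/andP: (pulse_itv (cell_idx T t) t).
apply: (@le_lt_trans _ _ (4 * K)%:E); last exact: ltry.
apply: (@piecewise_integral_le _ _ _ T0 tau_small lebesgue_measure F G K) => //.
- move=> n; apply/measurable_EFinP; apply: continuous_measurable_fun => s.
  by apply: cvgM; [apply: cvgM; exact: pulse_cont|exact: cvg_cst].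
- by move=> n t r; rewrite /F pulse_rests // expr0n mul0r.
- move=> n t; rewrite /F !lee_fin; have /andP[p0 p1] := pulse_itv n t.
  by rewrite mulr_ge0 ?exprn_ge0 //= ler_piMl // exprn_ile1.
Qed.

Lemma velocity_start t : t <= T / 2 -> velocity t = fun=> 0.
Proof. by apply: (piecewise_start T0 tau_small) => n s; exact: velocity_rests. Qed.

Let velocity_T : velocity T = fun=> 0.
Proof.
rewrite /velocity /piecewise cell_idx_geT //; apply: velocity_rests.
apply: (rests_right T0 tau_small); apply: le_trans (ltW (cell_left_lt T0 1)).
by rewrite gerBl divr_ge0 // mulr_ge0 ?exprn_ge0 // ltW.
Qed.

Let zero_L2 : in_L2 ((fun=> 0) : 'rV[R]_d.+1 -> 'rV[R]_d.+1).
Proof.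
have e : entries_cont ((fun=> 0) : 'rV[R]_d.+1 -> 'rV[R]_d.+1).
  by move=> i j; have := @torus_cont_cst R d.+1 0; congr torus_cont; apply/funext => x; rewrite mxE.
by split => //; rewrite Lp_norm2E // ltry.
Qed.

Let inner0 (w : 'rV[R]_d.+1 -> 'rV[R]_d.+1) : inner (fun=> 0) w = 0.
Proof.
rewrite inner_tint -[RHS](@tint0 R d.+1); apply: eq_tint => x; rewrite big1 // => i _.
by rewrite mxE mul0r.
Qed.

Lemma velocity_weak_start : weak_limit 0^'+ velocity (fun=> 0).
Proof.
split => // w _; rewrite inner0; apply: (@cvg_trans _ ((fun=> 0 : R) @ 0^'+)); last exact: cvg_cst.
apply: near_eq_cvg; near=> t; rewrite velocity_start ?inner0 // ltW //.
by near: t; apply: nbhs_right_lt; rewrite divr_gt0.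
Unshelve. all: by end_near. Qed.

(** The energies of the pulses tend to zero, so the convergence is even strong. *)
Lemma velocity_weak_end : weak_limit T^'- velocity (fun=> 0).
Proof.
split => // w Lw; rewrite inner0; apply/cvgrPdist_lt => e e0.
pose W := tint (fun x => sumsq (w x)).
have W0 : 0 <= W by apply: tint_ge0 => x; exact: sumsq_ge0.
have W1 : 0 < W + 1 by rewrite ltr_pwDr.
pose dl := e / (W + 1); have dl0 : 0 < dl by rewrite divr_gt0.
near=> t; rewrite sub0r normrN.
have tv : tf_vec (velocity t) by exact: tf_vecZ.
apply: (le_lt_trans (inner_young tv Lw dl0)); rewrite -/W.
have -> : tint (fun x => sumsq (velocity t x)) = kinetic t.
  by rewrite -sq_norm2_velocity sq_norm2E //; exact: entries_cont_vec.
have kt : kinetic t < dl * e.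
  by near: t; exact: (cvgr_lt _ kinetic_left _ (mulr_gt0 dl0 e0)).
have h1 : dl^-1 * kinetic t < e by rewrite ltr_pdivrMl.
have h2 : dl * W <= e.
  by rewrite /dl mulrAC ler_pdivrMr // ler_pM2l // lerDl.
by move: h1 h2; lra.
Unshelve. all: by end_near. Qed.

(** The power of the force is the dissipation plus half the derivative of the
    squared norm.  The dissipation is integrable; the squared norm vanishes up to
    [T / 2] and tends to zero at [T].  Both parts thus have primitives that are
    continuous on [0, T], and the energy equality compares their values. *)
Lemma pulses_energy : energy_equality T velocity force /\
  class_L T (fun t => inner (velocity t) (force t)).
Proof.
have -> : (fun t => inner (velocity t) (force t)) = (fun t => dissipation t + 2^-1 * kinetic_rate t).
  by apply/funext => t; exact: inner_velocity_force.
have GE : (fun t => sq_norm2 (gradient (velocity t))) = dissipation.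
  by apply/funext => t; exact: sq_norm2_gradient_velocity.
have [Phi [Pc PE]] := integrable_primitive T0 dissipation_integrable.
have T_pos : 0 <= (0 : R) <= T by rewrite lexx ltW.
have T_T : 0 <= T <= T by rewrite lexx ltW.
have P0 : Phi @ 0^'+ --> Phi 0 by apply: cvg_at_right_filter; exact: Pc.
have PT : Phi @ T^'- --> Phi T by apply: cvg_at_left_filter; exact: Pc.
have Pi t : 0 < t < T -> {for t, continuous Phi}.
  by move=> /andP[h1 h2]; apply: Pc; rewrite !ltW.
have Dc t : 0 < t < T -> {for t, continuous dissipation}.
  by move=> /andP[_]; exact: dissipation_cont.
have Rc t : 0 < t < T -> {for t, continuous kinetic_rate}.
  by move=> /andP[_]; exact: kinetic_rate_cont.
have Kd t : 0 < t < T -> is_derive t (1 : R) kinetic (kinetic_rate t).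
  by move=> /andP[_]; exact: kinetic_is_derive.
have KE := set_integral_derive Kd Rc.
pose Psi t := Phi t + 2^-1 * kinetic t.
have kT : kinetic T = 0.
  by rewrite -sq_norm2_velocity velocity_T -[RHS](mul0r (kinetic T)); rewrite (_ : (fun=> 0) = (fun x => 0 *: velocity T x)) ?sq_norm2Z ?mul0r ?expr0n ?mul0r //; [exact/entries_cont_vec/tf_vecZ|apply/funext => x; rewrite scale0r].
have k0 : kinetic 0 = 0 by apply: kinetic_start; rewrite divr_ge0 // ltW.
have Kr : kinetic @ 0^'+ --> kinetic 0.
  rewrite k0; apply: (@cvg_trans _ ((fun=> 0 : R) @ 0^'+)); last exact: cvg_cst.
  apply: near_eq_cvg; near=> t; rewrite kinetic_start // ltW //.
  by near: t; apply: nbhs_right_lt; rewrite divr_gt0.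
have Kl : kinetic @ T^'- --> kinetic T by rewrite kT; exact: kinetic_left.
have Kc t : 0 < t < T -> {for t, continuous kinetic}.
  by move=> /Kd [dt _]; apply: differentiable_continuous; exact/derivable1_diffP.
have Qi t : 0 < t < T -> {for t, continuous Psi}.
  by move=> tT; apply: cvgD; [exact: Pi|apply: cvgM; [exact: cvg_cst|exact: Kc]].
have Q0 : Psi @ 0^'+ --> Psi 0 by apply: cvgD => //; apply: cvgM => //; exact: cvg_cst.
have QT : Psi @ T^'- --> Psi T by apply: cvgD => //; apply: cvgM => //; exact: cvg_cst.
have Ic t : 0 < t < T -> {for t, continuous (fun t => dissipation t + 2^-1 * kinetic_rate t)}.
  by move=> tT; apply: cvgD; [exact: Dc|apply: cvgM; [exact: cvg_cst|exact: Rc]].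
have QE a b : 0 < a -> a <= b -> b < T ->
    set_integral (fun t => dissipation t + 2^-1 * kinetic_rate t) (a, b) = Psi b - Psi a.
  move=> a0 ab bT.
  have iC g : (forall t, 0 < t < T -> {for t, continuous g}) ->
      (@lebesgue_measure R).-integrable `[a, b] (EFin \o g).
    move=> gc; apply: continuous_compact_integrable; first exact: segment_compact.
    apply: continuous_in_subspaceT => t; rewrite inE /= in_itv /= => /andP[h1 h2].
    by apply: gc; rewrite (lt_le_trans a0) // (le_lt_trans h2).
  rewrite /set_integral /= RintegralD //; [|exact: iC|]; last first.
    by apply: iC => t tT; apply: cvgM; [exact: cvg_cst|exact: Rc].
  rewrite RintegralZl //; last exact: iC.
  have := PE a b a0 ab bT; have := KE a b a0 ab bT; rewrite /set_integral /= => -> ->.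
  by rewrite /Psi; ring.
split; last exact: class_L_primitive T0 _ _ Ic QE Q0 QT.
exists (fun=> 0), (fun=> 0); split.
- exact: velocity_weak_start.
- exact: velocity_weak_end.
- by rewrite GE; exact: class_L_primitive T0 _ _ Dc PE P0 PT.
- have ub t : with_endpoints T (fun=> 0) (fun=> 0) velocity t = velocity t.
    rewrite /with_endpoints; case: eqP => [->|_].
      by rewrite velocity_start // divr_ge0 // ltW.
    by case: eqP => [->|//]; rewrite velocity_T.
  move=> /= t0 t1 t0T t1T; rewrite !ub !sq_norm2_velocity GE.
  rewrite (time_integral_primitive PE Pi P0 PT) //.
  have -> : (fun t => inner (velocity t) (force t)) = (fun t => dissipation t + 2^-1 * kinetic_rate t).
    by apply/funext => t; exact: inner_velocity_force.
  by rewrite (time_integral_primitive QE Qi Q0 QT) // /Psi; ring.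
Unshelve. all: by end_near. Qed.

End energy.

End pulses.

(** * Homogeneity and measurability in the amplitude *)

Section homogeneity.
Context {R : realType} {d : nat}.
Implicit Types (v w : 'rV[R]_d -> 'rV[R]_d) (c : R).

Lemma mode_partZ c (g : 'rV[R]_d -> R) k x : torus_cont g ->
  mode_part (fun y => c * g y) k x = c * mode_part g k x.
Proof.
move=> cg; rewrite /mode_part.
have C (t : 'rV[R]_d -> R) : torus_cont t -> tint (fun y => c * g y * t y) = c * tint (fun y => g y * t y).
  move=> ct; rewrite -tintZ; last exact: torus_contM.
  by apply: eq_tint => y; rewrite mulrA.
by rewrite !C; [ring|exact/tf_torus_cont/tf_sink|exact/tf_torus_cont/tf_cosk].
Qed.

Lemma multiplierZ n m c (g : 'rV[R]_d -> R) x : band_limited n m -> torus_cont g ->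
  multiplier m (fun y => c * g y) x = c * multiplier m g x.
Proof.
move=> mb cg; rewrite !(multiplierE _ _ mb) mulr_sumr; apply: eq_bigr => k _.
by rewrite mode_partZ // mulrCA.
Qed.

Variable chi : 'rV[R]_d -> R.
Hypothesis hchi : LP_cutoff chi.

Let symbol_band (q : int) : -1 <= q -> band_limited (LP_band `|q|%N) (LP_symbol chi q).
Proof. by move=> q1; apply: LP_symbol_band => //; lia. Qed.

Lemma LP_blockZ c v q x : tf_vec v -> -1 <= q ->
  LP_block chi q (fun y => c *: v y) x = c *: LP_block chi q v x.
Proof.
move=> tv q1; apply/rowP => i; rewrite !mxE componentZ.
by rewrite (multiplierZ _ _ (symbol_band q1)) //; exact/tf_torus_cont/tv.
Qed.

Lemma tf_LP_block v q : -1 <= q -> tf_vec (LP_block chi q v).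
Proof.
move=> q1 i; have -> : component (LP_block chi q v) i = multiplier (LP_symbol chi q) (component v i).
  by apply/funext => x; rewrite /component mxE.
exact: tf_multiplier (symbol_band q1).
Qed.

Lemma besov3_normZ (s c : R) v : tf_vec v ->
  besov3_norm chi s (fun x => c *: v x) = (`|c|%:E * besov3_norm chi s v)%E.
Proof.
move=> tv; rewrite /besov3_norm.
have E : [set ((2 `^ (q%:~R * s))%:E * Lp_norm 3%:E (LP_block chi q (fun x => c *: v x)))%E
    | q in [set q : int | -1 <= q]] = [set (`|c|%:E * x)%E | x in
    [set ((2 `^ (q%:~R * s))%:E * Lp_norm 3%:E (LP_block chi q v))%E | q in [set q : int | -1 <= q]]].
  have H q : -1 <= q -> Lp_norm 3%:E (LP_block chi q (fun x => c *: v x)) = (`|c|%:E * Lp_norm 3%:E (LP_block chi q v))%E.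
    move=> q1; rewrite (_ : LP_block chi q _ = fun x => c *: LP_block chi q v x).
      rewrite Lp_normZ ?lee_fin ?ler1n //; exact/entries_cont_vec/tf_LP_block.
    by apply/funext => x; exact: LP_blockZ.
  apply/seteqP; split => [_ [q q1 <-]|_ [_ [q q1 <-] <-]].
    exists ((2 `^ (q%:~R * s))%:E * Lp_norm 3%:E (LP_block chi q v))%E; first by exists q.
    by rewrite H // muleCA.
  by exists q => //; rewrite H // muleCA.
rewrite E; have [->|c0] := eqVneq c 0; last by rewrite ereal_sup_pZl // normr_gt0.
rewrite normr0 mul0e; apply/eqP; rewrite eq_le; apply/andP; split.
  by apply: ge_ereal_sup => _ [x _ <-]; rewrite mul0e.
apply: ereal_sup_ubound; exists ((2 `^ (0%:~R * s))%:E * Lp_norm 3%:E (LP_block chi 0 v))%E.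
  by exists 0.
by rewrite mul0e.
Qed.

Lemma LP_leZ c v q x : tf_vec v -> LP_le chi q (fun y => c *: v y) x = c *: LP_le chi q v x.
Proof.
move=> tv; rewrite /LP_le scaler_sumr; apply: eq_bigr => j _; apply: LP_blockZ => //.
by lia.
Qed.

Lemma fluxZ c v q : tf_vec v -> flux chi q (fun x => c *: v x) = c ^+ 3 * flux chi q v.
Proof.
move=> tv; have tc : tf_vec (convection v) by move=> i; exact: tf_convection.
have tL w : tf_vec (LP_le chi q w).
  move=> i; have -> : component (LP_le chi q w) i = multiplier (LP_low chi q) (component w i).
    by apply/funext => x; exact: LP_leE.
  exact: tf_multiplier (LP_low_band hchi (leqnn q)).
have FE z : flux chi q z = tint (fun x => \sum_i LP_le chi q (convection z) x 0 i * LP_le chi q z x 0 i).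
  exact: inner_tint.
rewrite !FE -(tintZ (c ^+ 3) (tf_torus_cont_dot (tL (convection v)) (tL v))).
apply: eq_tint => x; rewrite mulr_sumr; apply: eq_bigr => i _.
rewrite (LP_leZ _ _ _ tv) (_ : convection (fun y => c *: v y) = fun y => c ^+ 2 *: convection v y).
  by rewrite (LP_leZ _ _ _ tc) !mxE; ring.
by apply/funext => y; exact: convectionZ.
Qed.

End homogeneity.

Section measurable_Hm1.
Context {R : realType} {d : nat}.

Lemma measurable_esum (I : countType) (F : I -> R -> \bar R) :
  (forall k, measurable_fun setT (F k)) -> (forall k t, (0 <= F k t)%E) ->
  measurable_fun setT (fun t => \esum_(k in [set: I]) F k t)%E.
Proof.
move=> mF F0.
pose G n t : \bar R := if unpickle n is Some k then F k t else 0%E.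
pose P n : bool := `[< range (@pickle I) n >].
have -> : (fun t => \esum_(k in [set: I]) F k t)%E = (fun t => \sum_(n <oo | n \in P) G n t)%E.
  apply/funext => t; rewrite nneseries_esum; last by move=> n _; rewrite /G; case: unpickle.
  have -> : [set n | P n] = range (@pickle I) by apply/seteqP; split => n /asboolP.
  rewrite (@reindex_esum _ _ _ setT (range (@pickle I)) (@pickle I)).
    by apply: eq_esum => k _; rewrite /G pickleK.
  by split => [k _|k l _ _|//]; [exists k|exact: (pcan_inj pickleK)].
by apply: ge0_emeasurable_sum => n => [t _ _|_]; rewrite /G; case: unpickle.
Qed.

Implicit Types w : 'rV[R]_d -> 'rV[R]_d.

(** The Fourier coefficients are combinations of those of three fixed fields, and
    hence continuous in time. *)
Lemma measurable_Hm1_lin3 (a b e : R -> R) w1 w2 w3 :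
  continuous a -> continuous b -> continuous e -> tf_vec w1 -> tf_vec w2 -> tf_vec w3 ->
  measurable_fun setT (fun t => Hm1_norm (fun x => a t *: w1 x - b t *: w2 x + e t *: w3 x)).
Proof.
move=> ca cb ce t1 t2 t3.
apply: (measurableT_comp (f := fun x : \bar R => (x `^ 2^-1)%E)); first exact: measurable_poweR.
apply: measurable_esum => [k|k t]; last first.
  rewrite lee_fin mulr_ge0 ?invr_ge0 ?addr_ge0 ?sqr_ge0 // sumr_ge0 // => i _.
  by rewrite addr_ge0 // sqr_ge0.
apply/measurable_EFinP; apply: measurable_funM; first exact: measurable_cst.
apply: measurable_sum => i.
have L (h : 'rV[R]_d -> R) : torus_cont h -> continuous (fun t =>
    tint (fun x => component (fun x => a t *: w1 x - b t *: w2 x + e t *: w3 x) i x * h x)).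
  move=> hc.
  have C w : tf_vec w -> torus_cont (fun x => component w i x * h x).
    by move=> tw; apply: torus_contM => //; exact/tf_torus_cont/tw.
  have -> : (fun t => tint (fun x => component (fun x => a t *: w1 x - b t *: w2 x + e t *: w3 x) i x * h x)) =
     (fun t => a t * tint (fun x => component w1 i x * h x)
            - b t * tint (fun x => component w2 i x * h x) + e t * tint (fun x => component w3 i x * h x)).
    apply/funext => t; rewrite -!tintZ; try exact: C.
    rewrite -tintB; try (apply: torus_contZ; exact: C).
    rewrite -tintD; [|apply: torus_contB|]; try (apply: torus_contZ; exact: C).
    by apply: eq_tint => x; rewrite /component !mxE; ring.
  move=> t; apply: cvgD; last by apply: cvgM; [exact: ce|exact: cvg_cst].
  by apply: cvgB; apply: cvgM; [exact: ca|exact: cvg_cst|exact: cb|exact: cvg_cst].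
pose w t x := a t *: w1 x - b t *: w2 x + e t *: w3 x.
have mRe : measurable_fun setT (fun t => complex.Re (fourier (component (w t) i) k)).
  have -> : (fun t => complex.Re (fourier (component (w t) i) k)) =
      (fun t => ((2 * pi) ^+ d)^-1 * tint (fun x => component (w t) i x * cosk k x)) by [].
  apply: measurable_funM; first exact: measurable_cst.
  by apply: continuous_measurable_fun; exact: (L _ (tf_torus_cont (tf_cosk k))).
have mIm : measurable_fun setT (fun t => complex.Im (fourier (component (w t) i) k)).
  have -> : (fun t => complex.Im (fourier (component (w t) i) k)) =
      (fun t => - (((2 * pi) ^+ d)^-1 * tint (fun x => component (w t) i x * sink k x))) by [].
  apply: measurableT_comp => //; apply: measurable_funM; first exact: measurable_cst.
  by apply: continuous_measurable_fun; exact: (L _ (tf_torus_cont (tf_sink k))).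
by apply: measurable_funD; apply: measurable_funX.
Qed.

End measurable_Hm1.

(** * Function spaces, limits and flux of a pulsed flow *)

Section pulse_limits.
Context {R : realType} {d : nat}.
Variable chi : 'rV[R]_d.+1 -> R.
Hypothesis hchi : LP_cutoff chi.
Variables (T : R) (tau : nat -> R) (U : nat -> 'rV[R]_d.+1 -> 'rV[R]_d.+1).
Hypotheses (T0 : 0 < T) (tau_small : forall n, 0 < tau n <= T * 2^-1 ^+ n.+1 / 16).
Hypotheses (tfU : forall n, tf_vec (U n)) (dfU : forall n, div_free (U n)).

Local Notation pulse := (pulse chi T tau).
Local Notation dpulse := (dpulse chi T tau).
Local Notation velocity := (velocity chi T tau U).
Local Notation velocity_piece := (velocity_piece chi T tau U).
Local Notation force := (force chi T tau U).
Local Notation force_piece := (force_piece chi T tau U).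

Let tau_gt0 n : 0 < tau n. Proof. by case/andP: (tau_small n). Qed.

Let tau_leT n : tau n <= T.
Proof.
have /andP[_ h] := tau_small n; apply: (le_trans h).
have : 2^-1 ^+ n.+1 <= 1 :> R by rewrite exprn_ile1 //; lra.
have : 0 <= 2^-1 ^+ n.+1 :> R by rewrite exprn_ge0.
move: T0; nra.
Qed.

Let pulse_le1 n t : `|pulse n t| <= 1.
Proof. by have /andP[p0 p1] := pulse_itv hchi T tau n t; rewrite ger0_norm. Qed.

Section norms.
Variables (N : ('rV[R]_d.+1 -> 'rV[R]_d.+1) -> \bar R).
Hypotheses (NZ : forall n c, N (fun x => c *: U n x) = (`|c|%:E * N (U n))%E).
Hypotheses (N0 : forall n, (0 <= N (U n))%E).

Let meas n : measurable_fun setT (fun t => N (velocity_piece n t)).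
Proof.
rewrite (_ : (fun t => _) = (fun t => N (U n) * `|pulse n t|%:E)%E); last first.
  by apply/funext => t; rewrite NZ muleC.
apply: measurable_funeM; apply/measurable_EFinP; apply: continuous_measurable_fun => t.
by apply: continuous_comp; [exact: pulse_cont|exact: norm_continuous].
Qed.

Let bound n t (Y : R) : (N (U n) <= Y%:E)%E -> (0 <= N (velocity_piece n t) <= Y%:E)%E.
Proof.
move=> h; rewrite NZ mule_ge0 ?lee_fin //=; apply: le_trans h.
by rewrite -[leRHS]mul1e; apply: lee_wpmul2r => //; rewrite lee_fin.
Qed.

Lemma velocity_in_LpX (p : R) (Y : nat -> R) (K : R) : 0 < p ->
  (forall n, (N (U n) <= (Y n)%:E)%E) -> (forall n, Y n `^ p * tau n <= K * 2^-1 ^+ n) ->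
  in_LpX T p%:E N velocity.
Proof.
move=> p0 NY YK; apply: (piecewise_in_LpX T0 tau_small p0 meas _ _ YK) => n t.
  by move=> r; rewrite NZ pulse_rests // normr0 mul0e.
exact: bound.
Qed.

Lemma velocity_in_LpX_bounded (p : \bar R) (K : R) : (0 < p)%E ->
  (forall n, (N (U n) <= K%:E)%E) -> in_LpX T p N velocity.
Proof.
move=> p0 NK; apply: (piecewise_in_LpX_bounded T0 p0 meas (K := K)) => n t.
exact: bound.
Qed.

End norms.

Lemma force_in_LpHm1 (p : R) (Y : nat -> R) (K : R) : 0 < p ->
  (forall n t, (Hm1_norm (force_piece n t) <= (Y n)%:E)%E) ->
  (forall n, Y n `^ p * tau n <= K * 2^-1 ^+ n) ->
  in_LpX T p%:E (@Hm1_norm R d.+1) force.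
Proof.
move=> p0 NY YK; apply: (piecewise_in_LpX T0 tau_small p0 _ _ _ YK).
- move=> n.
  have c2 : continuous (fun t => pulse n t ^+ 2) by move=> t; apply: cvgM; exact: pulse_cont.
  have c0 : continuous (dpulse n) by exact: dpulse_cont.
  have c1 : continuous (pulse n) by exact: pulse_cont.
  exact: (measurable_Hm1_lin3 c0 c1 c2
    (tfU n) (fun i => tf_lap i (tfU n)) (fun i => tf_convection i (tfU n))).
- move=> n t r.
  have E : (Hm1_norm (force_piece n t) <= 0%:E)%E.
    have := @Hm1_norm_div R d.+1 (force_piece n t) (fun _ _ => fun=> 0).
    rewrite big1 ?mulr0 ?sqrtr0; last first.
      by move=> i _; rewrite big1 // => j _; rewrite -[RHS](@tint0 R d.+1); apply: eq_tint => x; rewrite expr0n.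
    apply => [i j|i x]; first exact: tf_cst.
    by rewrite force_rests // /component mxE big1 // => j _; rewrite partial_cst.
  by apply/eqP; rewrite eq_le E poweR_ge0.
- by move=> n t; rewrite NY poweR_ge0.
Qed.

Section force_limits.
Variable K : R.
Hypothesis EK : forall n, tint (fun x => sumsq (U n x)) <= K * 2^-1 ^+ n.
Hypothesis pairing : forall i phi, test_function phi -> exists C, forall n,
  `|tint (fun x => U n x 0 i * phi x)| <= C * (tau n * 2^-1 ^+ n).

Let zero_distribution : is_distribution ((fun=> 0) : ('rV[R]_d.+1 -> R) -> R).
Proof.
split=> [*|]; first by rewrite mulr0 addr0.
by exists 0%N, 0 => *; rewrite normr0 mul0r.
Qed.

Let tc := @tf_torus_cont R d.+1.

Let lap_pairing i phi n : test_function phi ->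
  tint (fun x => lap (U n) x 0 i * phi x) =
  tint (fun x => U n x 0 i * (\sum_j partial j (partial j phi) x)).
Proof.
move=> tphi.
have t1 j : test_function (partial j phi) by exact: tf_partial.
have t2 j : test_function (partial j (partial j phi)) by exact: tf_partial.
have t3 j : test_function (partial j (component (U n) i)) by apply: tf_partial; exact: tfU.
transitivity (\sum_j tint (fun x => partial j (partial j (component (U n) i)) x * phi x)).
  have cS j : torus_cont (fun x => partial j (partial j (component (U n) i)) x * phi x).
    exact: tc (tfM (tf_partial j (t3 j)) tphi).
  transitivity (tint (fun x => \sum_j partial j (partial j (component (U n) i)) x * phi x)).
    by apply: eq_tint => x; rewrite mxE mulr_suml.
  by apply: tint_sum => j _; exact: cS.
transitivity (\sum_j tint (fun x => component (U n) i x * partial j (partial j phi) x)).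
  apply: eq_bigr => j _; rewrite tint_by_parts // -[RHS]opprK; congr (- _).
  by apply: tint_by_parts => //; exact: tfU.
rewrite -tint_sum; last by move=> j _; exact: (tc (tfM (tfU n i) (t2 j))).
by apply: eq_tint => x; rewrite mulr_sumr.
Qed.

Let conv_pairing i phi : test_function phi -> exists2 C, 0 <= C & forall n,
  `|tint (fun x => convection (U n) x 0 i * phi x)| <= C * 2^-1 ^+ n.
Proof.
move=> tphi.
have [M M0 HM] : exists2 M, 0 <= M & forall j x, `|partial j phi x| <= M.
  have H j : exists M, 0 <= M /\ forall x, `|partial j phi x| <= M.
    by have [M M0 HM] := torus_cont_bounded (tc (tf_partial j tphi)); exists M.
  have [F HF] := choice H; exists (\sum_j F j); first by apply: sumr_ge0 => j _; case: (HF j).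
  move=> j x; have [_ h] := HF j; apply: (le_trans (h x)).
  by rewrite (bigD1 j) //= lerDl sumr_ge0 // => l _; case: (HF l).
exists (d.+1%:R * (M * K)) => [|n].
  have : 0 <= K * 2^-1 ^+ 0 by apply: le_trans (EK 0); apply: tint_ge0 => x; exact: sumsq_ge0.
  by rewrite expr0 mulr1 => K0; rewrite !mulr_ge0.
have tUU j : test_function (fun y => U n y 0 i * U n y 0 j) by apply: tfM; exact: tfU.
have -> : tint (fun x => convection (U n) x 0 i * phi x) =
    \sum_j - tint (fun x => U n x 0 i * U n x 0 j * partial j phi x).
  transitivity (\sum_j tint (fun x => partial j (fun y => U n y 0 i * U n y 0 j) x * phi x)).
    rewrite -tint_sum; last by move=> j _; apply: torus_contM; apply: tc => //; exact: tf_partial.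
    by apply: eq_tint => x; rewrite -mulr_suml div_tensor.
  by apply: eq_bigr => j _; rewrite tint_by_parts.
apply: (le_trans (ler_norm_sum _ _ _)).
have -> : d.+1%:R * (M * K) * 2^-1 ^+ n = \sum_(j < d.+1) M * (K * 2^-1 ^+ n).
  by rewrite sumr_const card_ord -[RHS]mulr_natl !mulrA.
apply: ler_sum => j _; rewrite normrN.
have cE := torus_cont_sumsq (entries_cont_vec (tfU n)).
apply: (@le_trans _ _ (tint (fun x => M * sumsq (U n x)))); last first.
  by rewrite tintZ // ler_wpM2l.
have W x : `|U n x 0 i * U n x 0 j * partial j phi x| <= M * sumsq (U n x).
  rewrite normrM mulrC; apply: ler_pM => //; rewrite normrM /sumsq big_ord1.
  have sq k : `|U n x 0 k| ^+ 2 <= \sum_l U n x 0 l ^+ 2.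
    by rewrite -normrX ger0_norm ?sqr_ge0 // (bigD1 k) //= lerDl sumr_ge0 // => l _; exact: sqr_ge0.
  have := sq i; have := sq j; set a := `|U n x 0 i|; set b := `|U n x 0 j|.
  by have := sqr_ge0 (a - b); rewrite sqrrB => *; nra.
have Cl : torus_cont (fun x => U n x 0 i * U n x 0 j * partial j phi x).
  by apply: torus_contM; apply: tc => //; exact: tf_partial.
have Cr : torus_cont (fun x => M * sumsq (U n x)) by exact: torus_contZ.
rewrite ler_norml -tintN //; apply/andP; split; apply: le_tint => //.
- exact: torus_contN.
- by move=> x; have := W x; rewrite ler_norml => /andP[].
- by move=> x; have := W x; rewrite ler_norml => /andP[].
Qed.

Lemma force_start t : t <= T / 2 -> force t = fun=> 0.
Proof. by apply: (piecewise_start T0 tau_small) => n s; exact: force_rests. Qed.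

Lemma force_limit_start : has_distribution_limit 0^'+ force.
Proof.
move=> i; exists (fun=> 0) => // phi tphi.
apply: (@cvg_trans _ ((fun=> 0 : R) @ 0^'+)); last exact: cvg_cst.
apply: near_eq_cvg; near=> t; rewrite force_start; last first.
  by rewrite ltW //; near: t; apply: nbhs_right_lt; rewrite divr_gt0.
transitivity (tint (fun x : 'rV[R]_d.+1 => (0 : 'rV[R]_d.+1) 0 i * phi x)); last by [].
by rewrite -[LHS](@tint0 R d.+1); apply: eq_tint => x; rewrite mxE mul0r.
Unshelve. all: by end_near. Qed.

(** Against a test function the pulse [n] of the force is of the order of [2^-n]:
    the factor [1 / tau n] of the time derivative is paid for by the oscillation of
    [U n], assumed in [pairing]; the Laplacian is moved to the test function; the
    convection is the divergence of a tensor bounded by the energy. *)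
Lemma force_limit_end : has_distribution_limit T^'- force.
Proof.
move=> i; exists (fun=> 0) => // phi tphi.
have tlap : test_function (fun x => \sum_j partial j (partial j phi) x).
  by apply: tf_sum => j _; do 2!apply: tf_partial.
have [C1 H1] := pairing i tphi; have [C2 H2] := pairing i tlap.
have [C3 C30 H3] := conv_pairing i tphi.
have [Cb Cb0 Hb] := dtime_bump_bounded hchi.
have x0 n : 0 <= 2^-1 ^+ n :> R by rewrite exprn_ge0.
pose F n t := tint (fun x => force_piece n t x 0 i * phi x).
have -> : (fun t => \int[torus_measure d.+1]_x (force t (torus_pt x) 0 i * phi (torus_pt x))) = piecewise T F by [].
pose Cs := Cb * `|C1| + `|C2| * T + C3.
apply: (piecewise_cvg_left T0 (b := fun n => Cs * 2^-1 ^+ n)); last first.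
  rewrite -[X in _ --> X](mulr0 Cs); apply: cvgM; first exact: cvg_cst.
  by apply: cvg_expr; rewrite ger0_norm //; lra.
move=> n t; rewrite /F.
have c1 : torus_cont (fun x => U n x 0 i * phi x).
  exact: (tc (tfM (tfU n i) tphi)).
have c2 : torus_cont (fun x => lap (U n) x 0 i * phi x).
  exact: (tc (tfM (tf_lap i (tfU n)) tphi)).
have c3 : torus_cont (fun x => convection (U n) x 0 i * phi x).
  exact: (tc (tfM (tf_convection i (tfU n)) tphi)).
have -> : tint (fun x => force_piece n t x 0 i * phi x) =
   dpulse n t * tint (fun x => U n x 0 i * phi x)
   - pulse n t * tint (fun x => lap (U n) x 0 i * phi x)
   + pulse n t ^+ 2 * tint (fun x => convection (U n) x 0 i * phi x).
  rewrite -(tintZ _ c1) -(tintZ _ c2) -(tintZ _ c3) -tintB; [|exact: torus_contZ..].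
  rewrite -tintD; [|apply: torus_contB; exact: torus_contZ|exact: torus_contZ].
  apply: eq_tint => x; rewrite /force_piece !mxE -/(lap (U n) x) -/(convection (U n) x); ring.
rewrite lap_pairing //.
have p1 := pulse_le1 n t.
have B1 : `|dpulse n t * tint (fun x => U n x 0 i * phi x)| <= Cb * `|C1| * 2^-1 ^+ n.
  rewrite normrM /dpulse normrM normfV (gtr0_norm (tau_gt0 n)).
  have -> : Cb * `|C1| * 2^-1 ^+ n = ((tau n)^-1 * Cb) * (`|C1| * (tau n * 2^-1 ^+ n)).
    by field; rewrite gt_eqF.
  apply: ler_pM => //.
  - by rewrite mulr_ge0 // invr_ge0 ltW.
  - by rewrite ler_wpM2l // invr_ge0 ltW.
  - apply: (le_trans (H1 n)); apply: ler_wpM2r; first by rewrite mulr_ge0 // ltW.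
    exact: ler_norm.
have B2 : `|pulse n t * tint (fun x => U n x 0 i * \sum_j partial j (partial j phi) x)| <= `|C2| * T * 2^-1 ^+ n.
  rewrite normrM -[leRHS]mul1r; apply: ler_pM => //; apply: (le_trans (H2 n)).
  apply: (@le_trans _ _ (`|C2| * (tau n * 2^-1 ^+ n))).
    by apply: ler_wpM2r; [rewrite mulr_ge0 // ltW|exact: ler_norm].
  by rewrite -mulrA; apply: ler_wpM2l => //; apply: ler_wpM2r.
have B3 : `|pulse n t ^+ 2 * tint (fun x => convection (U n) x 0 i * phi x)| <= C3 * 2^-1 ^+ n.
  rewrite normrM -[leRHS]mul1r; apply: ler_pM => //.
  by rewrite normrX exprn_ile1.
apply: (le_trans (ler_normD _ _)); rewrite /Cs !mulrDl; apply: lerD => //.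
by apply: (le_trans (ler_normB _ _)); exact: lerD.
Unshelve. all: by end_near. Qed.

End force_limits.

Section flux_limit.
Local Notation leb := (@lebesgue_measure R).

Let Rintegral_lincomb (D : set R) (c : nat -> R) (g : nat -> R -> R) k : measurable D ->
  (forall m, leb.-integrable D (EFin \o g m)) ->
  leb.-integrable D (EFin \o (fun t => \sum_(m < k) c m * g m t)) /\
  \int[leb]_(t in D) \sum_(m < k) c m * g m t = \sum_(m < k) c m * \int[leb]_(t in D) g m t.
Proof.
move=> mD ig; elim: k => [|k [IH1 IH2]].
  split; last by rewrite big_ord0; under eq_Rintegral do rewrite big_ord0; rewrite Rintegral_cst // mul0r.
  by under eq_fun do rewrite big_ord0; exact: integrable0.
have Z : leb.-integrable D (EFin \o (fun t => c k * g k t)) by exact: integrableZl (ig k).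
split; last first.
  under eq_Rintegral do rewrite big_ord_recr /=.
  by rewrite RintegralD // IH2 big_ord_recr /= RintegralZl.
have -> : EFin \o (fun t => \sum_(m < k.+1) c m * g m t) =
   ((EFin \o (fun t => \sum_(m < k) c m * g m t)%R) \+ (EFin \o (fun t => c k * g k t)%R))%E.
  by apply/funext => t /=; rewrite big_ord_recr.
exact: integrableD.
Qed.

(** The limit of the flux, which is cubic in the velocity. *)
Let c0 : R := \int[leb]_(s in `[-1, 1]) time_bump chi s ^+ 3.

Let cube_cont : continuous (fun s => time_bump chi s ^+ 3).
Proof. by move=> s; apply: (continuous_comp (f := time_bump chi) (g := fun x => x ^+ 3)); [exact: (time_bump_smooth hchi 0)|exact: exprn_continuous]. Qed.

Let cube_itv s : 0 <= time_bump chi s ^+ 3 <= 1.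
Proof. by have /andP[h0 h1] := time_bump_itv hchi s; rewrite exprn_ge0 //= exprn_ile1. Qed.

Let itv_integrable a b (g : R -> R) : continuous g -> leb.-integrable `[a, b] (EFin \o g).
Proof.
move=> gc; apply: continuous_compact_integrable; first exact: segment_compact.
exact: continuous_subspaceT.
Qed.

Let c0_gt0 : 0 < c0.
Proof.
have i1 : leb.-integrable `[-1, 1] (EFin \o (fun s => time_bump chi s ^+ 3)) by exact: itv_integrable.
have J1 : `[- 2^-1, 2^-1] `<=` (`[-1, 1] : set R).
  by move=> s /=; rewrite !in_itv /=; lra.
have i2 : leb.-integrable `[- 2^-1, 2^-1] (EFin \o (fun s => time_bump chi s ^+ 3)) by exact: itv_integrable.
apply: (@lt_le_trans _ _ 1) => //.
rewrite -lee_fin /c0 /Rintegral fineK; last exact: integrable_fin_num.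
have A1 : (1%:E = \int[leb]_(s in `[(- 2^-1)%R, 2^-1%R]) (time_bump chi s ^+ 3)%:E)%E.
  transitivity (\int[leb]_(s in `[(- 2^-1)%R, 2^-1%R]) 1%:E)%E.
    rewrite integral_cst //= lebesgue_measure_itv /= lte_fin mul1e.
    have -> : (- 2^-1 < 2^-1 :> R) by lra.
    by rewrite -EFinB; congr (_%:E); lra.
  apply: eq_integral => s; rewrite inE /= in_itv /= => sb.
  by rewrite time_bump1 ?expr1n // ler_norml.
rewrite A1; apply: (@ge0_subset_integral _ _ _ leb _ _ (measurable_itv _) (measurable_itv _)) => //.
- exact: measurable_int i1.
- by move=> s _; rewrite lee_fin; case/andP: (cube_itv s).
Qed.

Let pulse_cube_cont n : continuous (fun t => pulse n t ^+ 3).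
Proof.
by move=> t; apply: (continuous_comp (f := pulse n) (g := fun x => x ^+ 3)); [exact: pulse_cont|exact: exprn_continuous].
Qed.

Lemma pulse_cube_integral n : \int[leb]_(t in `]T / 2, T[) pulse n t ^+ 3 = tau n * c0.
Proof.
pose c := cell_mid T n; pose J : set R := `[c - tau n, c + tau n]%classic.
have tn := tau_gt0 n.
have JT : J `<=` (`]T / 2, T[ : set R).
  move=> t; rewrite /J /= !in_itv /= /c /cell_mid.
  have /andP[_] := tau_small n.
  have : 0 < T * 2^-1 ^+ n.+1 by rewrite mulr_gt0 // exprn_gt0.
  have : T * 2^-1 ^+ n.+1 <= T / 2.
    have h : 2^-1 ^+ n <= 1 :> R by rewrite exprn_ile1 //; lra.
    by rewrite exprS mulrA; apply: ler_piMr => //; rewrite divr_ge0 // ltW.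
  have -> : T * (1 - 3 / 4 * 2^-1 ^+ n.+1) = T - 3 / 4 * (T * 2^-1 ^+ n.+1) by ring.
  by move: (T * 2^-1 ^+ n.+1) T0 => X; lra.
transitivity (\int[leb]_(t in J) pulse n t ^+ 3).
  rewrite -[in RHS](setIidr JT) Rintegral_mkcondr; apply: eq_Rintegral => t _.
  rewrite patchE; case: ifPn => //; rewrite notin_setE => Jt.
  rewrite pulse_rests ?expr0n // /rests ltNge; apply/negP => H; apply: Jt.
  by rewrite /J /= in_itv /= -ler_distlC distrC.
pose F t := (t - c) / tau n.
have Fa : F (c - tau n) = -1 by rewrite /F; field; rewrite gt_eqF.
have Fb : F (c + tau n) = 1 by rewrite /F; field; rewrite gt_eqF.
have dF (t : R) : is_derive t (1 : R) F (tau n)^-1.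
  have -> : F = (fun s => s * (tau n)^-1 + - c / tau n).
    by apply/funext => s; rewrite /F mulrBl mulNr.
  exact: is_derive_affine.
have F'E : F^`()%classic = cst (tau n)^-1.
  by apply/funext => t; rewrite derive1E; have [_ ->] := dF t.
have Fc : continuous F.
  move=> t; apply: differentiable_continuous; apply/derivable1_diffP; by case: (dF t).
have ab : c - tau n <= c + tau n by move: tn; lra.
have := @integration_by_substitution_increasing R F (fun s => time_bump chi s ^+ 3) _ _ ab.
rewrite F'E Fa Fb => S.
have {}S : (\int[leb]_(x in `[(-1)%R, 1%R]) (time_bump chi x ^+ 3)%:E =
   \int[leb]_(x in J) (pulse n x ^+ 3 * (tau n)^-1)%R%:E)%E.
  apply: S.
  - by move=> x y _ _ xy; rewrite /F ltr_pM2r ?invr_gt0 // ltrD2r.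
  - by move=> x _; exact: cvg_cst.
  - exact: is_cvg_cst.
  - exact: is_cvg_cst.
  - split.
    + by move=> x _; case: (dF x).
    + by apply: cvg_at_right_filter; exact: Fc.
    + by apply: cvg_at_left_filter; exact: Fc.
  - exact: continuous_subspaceT.
rewrite /c0 /Rintegral S -/(Rintegral _ _ _).
transitivity (tau n * \int[leb]_(x in J) ((tau n)^-1 * pulse n x ^+ 3)).
  rewrite RintegralZl; [|exact: measurable_itv|exact: itv_integrable].
  by rewrite mulrA divff ?gt_eqF // mul1r.
by congr (_ * _); apply: eq_Rintegral => x _; rewrite mulrC.
Qed.

(** The pulse [n] moves energy from the frequency [2^(p_ n)] to [2^(p_ n.+1)], and
    [tau n] normalises its flux through the frequencies in between. *)
Variables (p_ : nat -> nat) (dl : nat -> R).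
Hypotheses (p_lt : forall n, (p_ n < p_ n.+1)%N).
Hypothesis flux0 : forall n q, (q < p_ n)%N || (p_ n.+1 < q)%N -> flux chi q (U n) = 0.
Hypothesis flux_mid : forall n q, (p_ n < q)%N -> (q < p_ n.+1)%N -> tau n * flux chi q (U n) = -1.
Hypothesis flux_bottom : forall n, `|tau n * flux chi (p_ n) (U n) + 1| <= dl n.
Hypothesis flux_top : forall n, `|tau n * flux chi (p_ n.+1) (U n)| <= dl n.
Hypothesis dl0 : dl @ \oo --> (0 : R).

Let p_le m n : (m <= n)%N -> (p_ m <= p_ n)%N.
Proof.
by move=> /subnK <-; elim: (n - m)%N => // k IH; rewrite addSn (leq_trans IH) // ltnW.
Qed.

Let p_ge n : (n <= p_ n)%N.
Proof. by elim: n => // n IH; exact: leq_ltn_trans (p_lt n). Qed.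

Let level q : (p_ 0 <= q)%N -> exists n, (p_ n <= q)%N && (q < p_ n.+1)%N.
Proof.
move=> p0; have ex : exists n, (q < p_ n)%N by exists q.+1; apply: leq_trans (p_ge _).
case: (ex_minnP ex) => -[|n] qn H; first by rewrite ltnNge p0 in qn.
by exists n; rewrite qn andbT leqNgt; apply/negP => /H; rewrite ltnn.
Qed.

Let rests_other t m : T / 2 < t < T -> m <> cell_idx T t -> rests T tau m t.
Proof.
move=> /andP[t2 tT] mt.
have c00 : cell_left T 0 = T / 2 by rewrite /cell_left expr1; field.
have [|k kt] := @cell_exists R T t; first by rewrite c00 (ltW t2).
rewrite (cell_idxP T0 kt) in mt; move: kt => /andP[k1 k2].
have := T0; have : 0 <= T * 2^-1 ^+ m.+1 / 16 by rewrite divr_ge0 // mulr_ge0 ?ltW // exprn_ge0.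
have [km|mk|//] := ltngtP m k.
- move=> h _; apply: (rests_right T0 tau_small); have := cell_left_le T0 km; move: h k1; lra.
- move=> h _; apply: (rests_left T0 tau_small); have := cell_left_le T0 mk; move: h k2; lra.
Qed.

Let flux_velocity q n t : (q < p_ n.+1)%N -> T / 2 < t < T ->
  flux chi q (velocity t) = \sum_(m < n.+1) flux chi q (U m) * pulse m t ^+ 3.
Proof.
move=> qn tT; rewrite [LHS]fluxZ //; set k := cell_idx T t.
have Z m : m <> k -> pulse m t = 0.
  by move=> mk; apply: pulse_rests => //; exact: rests_other.
have [kn|nk] := ltnP k n.+1.
  rewrite (bigD1 (Ordinal kn)) //= big1 ?addr0 1?mulrC // => m mk.
  rewrite Z ?expr0n ?mulr0 // => E; move/eqP: mk; apply; exact/val_inj.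
rewrite flux0 ?mulr0; last by rewrite (leq_trans qn) // p_le.
rewrite big1 // => m _; rewrite Z ?expr0n ?mulr0 // => E.
by move: (ltn_ord m); rewrite E ltnNge nk.
Qed.

Let flux_integral q n : (q < p_ n.+1)%N ->
  \int[leb]_(t in `]T / 2, T[) flux chi q (velocity t) =
  c0 * \sum_(m < n.+1) tau m * flux chi q (U m).
Proof.
move=> qn.
have iP m : leb.-integrable `]T / 2, T[ (EFin \o (fun t => pulse m t ^+ 3)).
  have H := @itv_integrable (T / 2) T _ (pulse_cube_cont (n := m)).
  by apply: integrableS H => //; exact: subset_itv_oo_cc.
transitivity (\int[leb]_(t in `]T / 2, T[) \sum_(m < n.+1) flux chi q (U m) * pulse m t ^+ 3).
  by apply: eq_Rintegral => t; rewrite inE /= in_itv /=; exact: flux_velocity.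
rewrite (proj2 (Rintegral_lincomb (fun m => flux chi q (U m)) n.+1 (measurable_itv _) iP)).
by rewrite mulr_sumr; apply: eq_bigr => m _; rewrite pulse_cube_integral; ring.
Qed.

(** The frequency [2^q] lies in the range of the pulse [n]; one more pulse may
    reach it, the previous one, and only when [q = p_ n]. *)
Let flux_sum q n : (p_ n <= q)%N -> (q < p_ n.+1)%N ->
  `|\sum_(m < n.+1) tau m * flux chi q (U m) + 1| <= `|dl n| + `|dl n.-1|.
Proof.
move=> pq qp.
have B : `|tau n * flux chi q (U n) + 1| <= `|dl n|.
  move: pq; rewrite leq_eqVlt => /orP[/eqP <-|pq]; last by rewrite flux_mid // addNr normr0.
  by apply: (le_trans (flux_bottom n)); exact: ler_norm.
case: n => [|n] in pq qp B *; first by rewrite big_ord1 (le_trans B) // lerDl.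
rewrite big_ord_recr big_ord_recr /= big1 ?add0r; last first.
  move=> m _; rewrite flux0 ?mulr0 //; apply/orP; right.
  by apply: leq_trans pq; apply: leq_ltn_trans (p_lt n); rewrite p_le // ltn_ord.
have B' : `|tau n * flux chi q (U n)| <= `|dl n|.
  move: pq; rewrite leq_eqVlt => /orP[/eqP <-|pq]; last by rewrite flux0 ?mulr0 ?normr0 ?pq ?orbT.
  by apply: (le_trans (flux_top n)); exact: ler_norm.
by rewrite -addrA addrC (le_trans (ler_normD _ _)) // lerD.
Qed.

(** Every high frequency is crossed by exactly one pulse, and the errors at the
    ends of the ranges vanish in the limit. *)
Lemma anomalous_flux : exists2 l : R, 0 < l &
  (fun q => `|\int[leb]_(t in `]T / 2, T[) flux chi q (velocity t)|) @ \oo --> l.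
Proof.
exists c0; first exact: c0_gt0.
apply/cvgrPdist_lt => e e0.
have e2 : 0 < e / c0 / 2 by rewrite !divr_gt0.
have [M _ HM] := cvgr0_norm_lt _ dl0 _ e2.
near=> q.
have [|n /andP[pq qp]] := @level q; first by near: q; exact: nbhs_infty_ge.
have Mq : (p_ M.+1 <= q)%N by near: q; exact: nbhs_infty_ge.
have Mn : (M < n)%N.
  rewrite ltnNge; apply/negP => nM.
  have nM1 : (n.+1 <= M.+1)%N by [].
  by have := leq_trans qp (leq_trans (p_le nM1) Mq); rewrite ltnn.
rewrite (flux_integral qp); set S := \sum_(m < n.+1) _.
have HS := flux_sum pq qp; rewrite -/S in HS.
have d1 : `|dl n| < e / c0 / 2 by apply: HM => /=; exact: ltnW.
have d2 : `|dl n.-1| < e / c0 / 2 by apply: HM => /=; case: n Mn {pq qp S HS d1}.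
rewrite normrM (gtr0_norm c0_gt0) -[X in X - _]mulr1 -mulrBr normrM (gtr0_norm c0_gt0).
rewrite -ltr_pdivlMl // mulrC.
apply: (@le_lt_trans _ _ `|S + 1|).
  have := ler_dist_dist (-1) S; rewrite normrN1 => h; apply: (le_trans h).
  by rewrite -opprD normrN addrC.
by apply: (le_lt_trans HS); move: d1 d2; set X := e / c0; lra.
Unshelve. all: by end_near. Qed.

End flux_limit.

End pulse_limits.

(** * Norms of the cluster flow *)

Section block_norms.
Context {R : realType} {d : nat}.
Variable chi : 'rV[R]_d.+3 -> R.
Hypothesis hchi : LP_cutoff chi.
Variables (N p p' : nat) (a : R).
Local Notation lam := (2 ^ p)%N.
Local Notation h := (2 ^ p')%N.
Hypotheses (N0 : (0 < N)%N) (Nlam : (4 * N <= lam)%N) (pp : (p < p')%N) (a0 : 0 < a).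

Let lamh : (2 * lam <= h)%N.
Proof. by rewrite -expnS leq_pexp2l. Qed.

Local Notation modes := (modes N).
Local Notation cM := (@cM R d N lam h a).
Local Notation ckap := (@ckap d N lam h).
Local Notation U := (@cflow R d N lam h a).
Let P : R := (2 * pi) ^+ d.+3.
Let P0 : 0 < P. Proof. by rewrite exprn_gt0 // mulr_gt0 // pi_gt0. Qed.
Let D : R := d.+3%:R.
Let D1 : 1 <= D. Proof. by rewrite ler1n. Qed.
Let NR : (0 : R) < N%:R. Proof. by rewrite ltr0n. Qed.
Let Y := a ^+ 2 / N%:R ^+ 3.
Lemma tf_cflow : tf_vec U. Proof. exact: tf_sflow. Qed.
Lemma div_free_cflow : div_free U. Proof. exact/div_free_sflow/cM_antisym. Qed.

Let enorm_le_sup (v : 'rV[R]_d.+3 -> 'rV[R]_d.+3) (S : R) x : 0 <= S ->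
  (forall u, `|v x 0 u| <= S) -> enorm (v x) <= D * S.
Proof.
move=> S0 vS; have DS : 0 <= D * S by rewrite mulr_ge0 // (le_trans ler01).
rewrite -(@ler_pXn2r _ 2) ?nnegrE ?enorm_ge0 // enorm_sqr /sumsq big_ord1.
apply: (@le_trans _ _ (\sum_(j < d.+3) S ^+ 2)).
  by apply: ler_sum => j _; rewrite -real_normK ?num_real // ler_pXn2r ?nnegrE.
rewrite sumr_const card_ord -[leLHS]mulr_natl -/D exprMn ler_wpM2r ?sqr_ge0 //.
by rewrite expr2 ler_peMr // (le_trans ler01).
Qed.

Lemma cflow_enorm_sup x : enorm (U x) <= D * (20 * a).
Proof.
apply: enorm_le_sup; first by rewrite mulr_ge0 // ltW.
by move=> u; apply: cflow_sup.
Qed.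

Let block_sup (c : modes -> R) x : (forall i, `|c i| <= 1) ->
  enorm (sflow ckap (fun i => c i *: cM i) x) <= D * (20 * a).
Proof.
move=> c1; apply: (enorm_le_sup (v := sflow ckap (fun i => c i *: cM i))).
  by rewrite mulr_ge0 // ltW.
move=> u; apply: sflow_le; apply: le_trans (amp_sum_le N0 Nlam lamh a0 u).
apply: ler_sum => i _; have /rowP/(_ u) := ampZ ckap cM c i; rewrite [X in _ = X -> _]mxE => ->.
by rewrite normrM ler_piMl.
Qed.

Let freq_le i : enorm (freq (ckap i) : 'rV[R]_d.+3) <= 2 ^+ p'.+1.
Proof.
have /andP[_] := @enorm_all R d N lam h N0 Nlam lamh i.
by rewrite natrX exprS.
Qed.

Let block_sflow q : -1 <= q ->
  LP_block chi q U = sflow ckap (fun i => LP_symbol chi q (freq (ckap i)) *: cM i).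
Proof.
move=> q1; apply/funext => x; apply/rowP => u; rewrite mxE.
apply: (@sflow_multiplier _ _ _ _ (LP_band `|q|%N)); last by move=> xi; exact: LP_symbolN.
by apply: LP_symbol_band => //; lia.
Qed.

Let block_L3 q : -1 <= q ->
  (Lp_norm 3%:E (LP_block chi q U) <= ((400 * D ^+ 2 * P * a * Y) `^ 3^-1)%:E)%E.
Proof.
move=> q1; rewrite block_sflow //; set c := fun i => LP_symbol chi q (freq (ckap i)).
have c1 i : `|c i| <= 1 by exact: LP_symbol_itv.
have S0 : 0 <= D * (20 * a) by rewrite !mulr_ge0 // ltW.
have r2 : 2 <= 3 :> R by rewrite ler_nat.
have E1 : tint (fun x => sumsq (sflow ckap (fun i => c i *: cM i) x)) <= 20 * D * P * Y.
  by have := @scaled_energy R d N lam h a N0 Nlam lamh a0 c 1 c1; rewrite expr1n mulr1.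
have := @Lp_norm_interp R d.+3 1 d.+3 3 (D * (20 * a)) (20 * D * P * Y)
  (sflow ckap (fun i => c i *: cM i)) r2 (entries_cont_vec (tf_sflow _ _)) S0 (fun x => block_sup x c1) E1.
have -> : 3 - 2 = 1 :> R by ring.
rewrite powRr1 //.
by have -> : D * (20 * a) * (20 * D * P * Y) = 400 * D ^+ 2 * P * a * Y by ring.
Qed.

Let block_zero q : p'.+2%:Z <= q -> Lp_norm 3%:E (LP_block chi q U) = 0%E.
Proof.
move=> pq; have q1 : -1 <= q by lia.
have [k qk kp] : exists2 k : nat, q = k%:Z & (p'.+2 <= k)%N by exists `|q|%N; lia.
rewrite block_sflow // Lp_normE //.
have Z x : sflow ckap (fun i => LP_symbol chi q (freq (ckap i)) *: cM i) x = 0.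
  apply/rowP => u; rewrite sflow_scaleE mxE big1 // => i _.
  rewrite qk (LP_symbol_large hchi) ?mul0r //.
    apply: (le_trans (freq_le i)); rewrite ler_eXn2l ?ltr1n //; lia.
  right; apply/andP; split; first by lia.
  by apply: (le_trans (freq_le i)); rewrite ler_eXn2l ?ltr1n //; lia.
rewrite (_ : (\int[torus_measure d.+3]_x _)%E = 0%E) ?poweR0r ?invr_eq0 ?pnatr_eq0 //.
rewrite -[RHS](integral0 (torus_measure d.+3) setT); apply: eq_integral => x _.
have e0 : enorm (0 : 'rV[R]_d.+3) = 0.
  by have := enormZ 0 (0 : 'rV[R]_d.+3); rewrite scale0r normr0 mul0r.
by rewrite Z e0 powR0 // pnatr_eq0.
Qed.

(** The Littlewood-Paley blocks satisfy the same bounds of the energy and of the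
    supremum as the flow, as their symbols are at most 1, and they vanish beyond the
    scale [2 h]. *)
Lemma cflow_besov (s : R) : -2 <= s ->
  (besov3_norm chi s U <= (4 * (2 * h%:R) `^ (Num.max s 0) * (400 * D ^+ 2 * P * a * Y) `^ 3^-1)%:E)%E.
Proof.
move=> s2; apply: ge_ereal_sup => _ [q /= q1 <-].
have [pq|qp] := leP p'.+2%:Z q.
  by rewrite block_zero // mule0 lee_fin !mulr_ge0 ?powR_ge0.
rewrite EFinM; apply: lee_pmul; [by rewrite lee_fin powR_ge0|exact: Lp_norm_ge0| |exact: block_L3].
rewrite lee_fin.
  have qR : q%:~R <= p'.+1%:R :> R.
    by rewrite -[p'.+1%:R]/(p'.+1%:Z%:~R) ler_int; lia.
  have q1R : -1 <= q%:~R :> R by rewrite -[-1]/((-1)%:~R) ler_int.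
  have h2 : 2 * h%:R = 2 `^ p'.+1%:R :> R by rewrite powR_mulrn // natrX exprS.
  have m0 : 0 <= Num.max s 0 by rewrite le_max lexx orbT.
  rewrite h2 -powRrM.
  have -> : 4 = 2 `^ 2 :> R by rewrite powR_mulrn // -natrX.
  rewrite -powRD; last by apply/implyP => _; rewrite gt_eqF.
  apply: ler_powR; first by rewrite ler1n.
  have [s0|s0] := leP 0 s.
    have p0 : 0 <= p'.+1%:R :> R by [].
    nra.
  rewrite mulr0 addr0.
  have [k0|k0] := leP 0 (q%:~R : R); nra.
Qed.

(** Each part is a divergence, of the potential [spot], of the gradient and of the
    tensor of the products [U_i U_j] respectively. *)
Lemma cflow_Hm1 (c1 c2 c3 : R) :
  (Hm1_norm (fun x : 'rV[R]_d.+3 => c1 *: U x - c2 *: lap U x + c3 *: convection U x)%R <=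
   (Num.sqrt (3 * D ^+ 2 * Y * (20 * c1 ^+ 2 / lam%:R ^+ 2 + 80 * h%:R ^+ 2 * c2 ^+ 2
      + 8000 * a ^+ 2 * c3 ^+ 2)))%:E)%E.
Proof.
pose G i j x := c1 * spot ckap cM i j x + (- c2 * partial j (component U i) x +
   c3 * (U x 0 i * U x 0 j)).
have tp i j : test_function (partial j (component U i)) by apply: tf_partial; exact: tf_cflow.
have tuu i j : test_function (fun x => U x 0 i * U x 0 j) by apply: tfM; exact: tf_cflow.
have ts i j : test_function (spot ckap cM i j) by exact: tf_spot.
have tG i j : test_function (G i j).
  exact: tfD (tfZ _ (ts i j)) (tfD (tfZ _ (tp i j)) (tfZ _ (tuu i j))).
have Gdiv i x : component (fun x => c1 *: U x - c2 *: lap U x + c3 *: convection U x) i x =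
    \sum_j partial j (G i j) x.
  transitivity (c1 * (\sum_j partial j (spot ckap cM i j) x) - c2 * lap U x 0 i
     + c3 * (\sum_j partial j (fun y => U y 0 i * U y 0 j) x)).
    rewrite -sflow_spot (div_tensor _ _ tf_cflow div_free_cflow).
    by rewrite /component !mxE.
  rewrite mxE !mulr_sumr -sumrB -big_split /=; apply: eq_bigr => j _.
  rewrite (partialD _ _ (tfZ _ (ts i j)) (tfD (tfZ _ (tp i j)) (tfZ _ (tuu i j)))).
  rewrite (partialD _ _ (tfZ _ (tp i j)) (tfZ _ (tuu i j))).
  by rewrite !partialZ // -addrA mulNr.
apply: (le_trans (Hm1_norm_div tG Gdiv)); rewrite lee_fin; apply: ler_wsqrtr.
have tc := @tf_torus_cont R d.+3.
have B i j : tint (fun x => G i j x ^+ 2) <=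
   3 * (c1 ^+ 2 * tint (fun x => spot ckap cM i j x ^+ 2)) +
   3 * (c2 ^+ 2 * tint (fun x => partial j (component U i) x ^+ 2)) +
   3 * (c3 ^+ 2 * (400 * a ^+ 2) * tint (fun x => U x 0 j ^+ 2)).
  have k1 : torus_cont (fun x => spot ckap cM i j x ^+ 2) by exact: tc (tfM (ts i j) (ts i j)).
  have k2 : torus_cont (fun x => partial j (component U i) x ^+ 2) by exact: tc (tfM (tp i j) (tp i j)).
  have k3 : torus_cont (fun x => U x 0 j ^+ 2) by exact: tc (tfM (tf_cflow j) (tf_cflow j)).
  rewrite -(tintZ _ k1) -(tintZ _ k2) -(tintZ _ k3) -!tintZ; try exact: torus_contZ.
  rewrite -!tintD; try (do ?apply: torus_contD; do ?apply: torus_contZ => //).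
  apply: le_tint; first exact: tc (tfM (tG i j) (tG i j)).
    by do ?apply: torus_contD; do ?apply: torus_contZ.
  move=> x; rewrite /G.
  have U2 : U x 0 i ^+ 2 <= 400 * a ^+ 2.
    have := @cflow_sup R d N lam h a N0 Nlam lamh a0 x i.
    rewrite -[U x 0 i ^+ 2]real_normK ?num_real // => Hs.
    have -> : 400 * a ^+ 2 = (20 * a) ^+ 2 by ring.
    by rewrite ler_pXn2r ?nnegrE // mulr_ge0 // ltW.
  set x1 := spot _ _ _ _ _; set x2 := partial _ _ _; set y := U x 0 i in U2 *; set z := U x 0 j.
  have T3 (r s t : R) : (r + (s + t)) ^+ 2 <= 3 * r ^+ 2 + 3 * s ^+ 2 + 3 * t ^+ 2.
    by have := sqr_ge0 (r - s); have := sqr_ge0 (r - t); have := sqr_ge0 (s - t); nra.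
  apply: (le_trans (T3 _ _ _)); apply: lerD; first by apply: lerD; rewrite ?exprMn ?sqrrN.
  rewrite ler_pM2l // !exprMn -mulrA ler_wpM2l ?sqr_ge0 // ler_wpM2r ?sqr_ge0 //.
apply: (@le_trans _ _ (P^-1 * (3 * (c1 ^+ 2 * (D ^+ 2 * (20 * P * (Y / lam%:R ^+ 2)))) +
   3 * (c2 ^+ 2 * (80 * D ^+ 2 * P * h%:R ^+ 2 * Y)) +
   3 * (c3 ^+ 2 * (400 * a ^+ 2) * (D * (20 * D * P * Y)))))); last first.
  rewrite le_eqVlt; apply/orP; left; apply/eqP; field.
  by rewrite !gt_eqF.
rewrite ler_pM2l ?invr_gt0 //.
apply: (le_trans (ler_sum _ (fun i _ => ler_sum _ (fun j _ => B i j)))).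
under eq_bigr do rewrite !big_split /= -!mulr_sumr.
rewrite !big_split /= -!mulr_sumr; apply: lerD; first apply: lerD.
- rewrite ler_pM2l // ler_wpM2l ?sqr_ge0 //.
  have -> : D ^+ 2 * (20 * P * (Y / lam%:R ^+ 2)) = \sum_(i < d.+3) \sum_(j < d.+3) 20 * P * (Y / lam%:R ^+ 2).
    by rewrite !sumr_const !card_ord -mulrnA -[RHS]mulr_natl natrM -/D -expr2.
  apply: ler_sum => i _; apply: ler_sum => j _.
  have -> : Y / lam%:R ^+ 2 = a ^+ 2 / (lam%:R ^+ 2 * N%:R ^+ 3).
    by rewrite /Y; field; rewrite !gt_eqF.
  exact: cpot_energy.
- rewrite ler_pM2l // ler_wpM2l ?sqr_ge0 //.
  apply: le_trans (cflow_enstrophy N0 Nlam lamh a0).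
  rewrite le_eqVlt; apply/orP; left; apply/eqP.
  have k2 i j : torus_cont (fun x => partial j (component U i) x ^+ 2) by exact: tc (tfM (tp i j) (tp i j)).
  transitivity (\sum_i tint (fun x => \sum_j partial j (component U i) x ^+ 2)).
    by apply: eq_bigr => i _; rewrite tint_sum.
  rewrite -tint_sum; last by move=> i _; apply: torus_cont_sum.
  by apply: eq_tint => x; apply: eq_bigr => i _; apply: eq_bigr => j _; rewrite mxE.
- have EU : \sum_(j < d.+3) tint (fun x => U x 0 j ^+ 2) <= 20 * D * P * Y.
    apply: le_trans (cflow_energy N0 Nlam lamh a0).
    rewrite le_eqVlt; apply/orP; left; apply/eqP; rewrite -tint_sum.
      by apply: eq_tint => x; rewrite /sumsq big_ord1.
    by move=> j _; exact: tc (tfM (tf_cflow j) (tf_cflow j)).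
  have k0 : 0 <= c3 ^+ 2 * (400 * a ^+ 2).
    apply: mulr_ge0; [exact: sqr_ge0|apply: mulr_ge0; [exact: ler0n|exact: sqr_ge0]].
  rewrite sumr_const card_ord ler_pM2l; last by [].
  apply: (ler_wpM2l k0); rewrite -[leLHS]mulr_natl; apply: (ler_wpM2l _ EU).
  exact: ler0n.
Qed.

Lemma cflow_pairing u (B : R) (phi : 'rV[R]_d.+3 -> R) : test_function phi -> 0 <= B ->
  (forall x, `|\sum_j partial j (partial j (fun y => \sum_k partial k (partial k phi) y)) x| <= B) ->
  `|tint (fun x => U x 0 u * phi x)| <= 20 * a * (P * B / lam%:R ^+ 4).
Proof.
move=> tphi B0 HB; apply: sflow_test_pairing => //; first exact: amp_sum_le.
by move=> i; have /andP[] := @enorm_all R d N lam h N0 Nlam lamh i.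
Qed.

End block_norms.

(** * Relations between the parameters *)

Section rates.
Context {R : realType}.
(** At [b = rho = 1] one has [N = lam^(2/3)], [a = lam], an energy of order 1 and
    a duration of the order of [lam^(-2)], and all the quantities estimated below,
    with [eps = 0], are of order 1 or less.  The powers of [b] make the energy
    [b^(-6)] and the dissipation at most of the order of [b^(-1)]; the other norms
    have [eps] to spare. *)
Variables (eps P b u rho tau : R).
Hypotheses (eps0 : 0 < eps) (P0 : 0 < P) (b1 : 1 <= b) (bu : b ^+ 10 <= u)
  (bue : b ^+ 10 <= u `^ eps) (rho1 : 1 <= rho) (rho2 : rho ^+ 2 <= b).
Let lam : R := u ^+ 3.
Let h : R := rho * u ^+ 3.
Let N : R := u ^+ 2 * b ^+ 4.
Let a : R := u ^+ 3 * b ^+ 3.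
Hypotheses (tau0 : 0 < tau)
  (tau_lo : P / 8 * (a ^+ 3 * lam / N ^+ 3) <= tau^-1)
  (tau_hi : tau^-1 <= 4 * P * (a ^+ 3 * lam / N ^+ 3)).

Let b0 : 0 < b. Proof. exact: lt_le_trans b1. Qed.
Let b_le i j : (i <= j)%N -> b ^+ i <= b ^+ j.
Proof. by move=> ij; rewrite ler_weXn2l. Qed.
Let u1 : 1 <= u.
Proof. by apply: le_trans bu; rewrite exprn_ege1. Qed.
Let u0 : 0 < u. Proof. exact: lt_le_trans u1. Qed.
Let u_pow i : u <= u ^+ i.+1.
Proof. by have := @ler_weXn2l R u u1 1 i.+1 isT; rewrite expr1. Qed.
Let bun i : (i <= 10)%N -> b ^+ i <= u.
Proof. by move=> ij; apply: le_trans bu; exact: b_le. Qed.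
Let rho0 : 0 < rho. Proof. exact: lt_le_trans rho1. Qed.
Let rho_b : rho <= b.
Proof. by apply: le_trans rho2; rewrite expr2 ler_peMl // ltW. Qed.
Let bu0 := (gt_eqF b0, gt_eqF u0, gt_eqF rho0, gt_eqF P0).

Lemma energy_scale : a ^+ 2 / N ^+ 3 = b ^- 6.
Proof. by rewrite /a /N; field; rewrite !bu0. Qed.

Let transfer_scale : a ^+ 3 * lam / N ^+ 3 = u ^+ 6 / b ^+ 3.
Proof. by rewrite /a /N /lam; field; rewrite !bu0. Qed.

Lemma tau_le : tau <= 8 / P * (b ^+ 3 / u ^+ 6).
Proof.
have := tau_lo; rewrite transfer_scale => H.
have q0 : 0 < P / 8 * (u ^+ 6 / b ^+ 3) by rewrite mulr_gt0 ?divr_gt0 ?exprn_gt0.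
rewrite -[tau]invrK; have -> : 8 / P * (b ^+ 3 / u ^+ 6) = (P / 8 * (u ^+ 6 / b ^+ 3))^-1.
  by field; rewrite !bu0.
by rewrite lef_pV2 // posrE ?invr_gt0.
Qed.

Let mul_tau (X M : R) : 0 <= X -> X * (b ^+ 3 / u ^+ 6) <= M -> X * tau <= 8 / P * M.
Proof.
move=> X0 XM; apply: (@le_trans _ _ (X * (8 / P * (b ^+ 3 / u ^+ 6)))).
  by rewrite ler_wpM2l // tau_le.
by rewrite mulrCA ler_wpM2l // divr_ge0 // ltW.
Qed.

Let le_binv (X : R) : X * b <= 1 -> X <= b^-1.
Proof. by move=> H; rewrite -[b^-1]mul1r ler_pdivlMr. Qed.

Lemma tau_rate : tau <= 8 / P * b^-1.
Proof.
rewrite -[tau]mul1r; apply: mul_tau => //; rewrite mul1r; apply: le_binv.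
rewrite mulrAC -exprSr ler_pdivrMr ?exprn_gt0 // mul1r.
by apply: (le_trans (bun (_ : (4 <= 10)%N))) => //; exact: u_pow.
Qed.

Lemma energy_rate : a ^+ 2 / N ^+ 3 <= b^-1.
Proof.
rewrite energy_scale; apply: le_binv.
have -> : b ^- 6 * b = (b ^+ 5)^-1 by field; rewrite !bu0.
by rewrite invf_le1 ?exprn_gt0 // exprn_ege1.
Qed.

Lemma dissipation_rate : h ^+ 2 * (a ^+ 2 / N ^+ 3) * tau <= 8 / P * b^-1.
Proof.
apply: mul_tau; first by rewrite energy_scale !mulr_ge0 ?exprn_ge0 ?invr_ge0 ?mulr_ge0 ?exprn_ge0 // ltW.
rewrite energy_scale.
have -> : h ^+ 2 * b ^- 6 * (b ^+ 3 / u ^+ 6) = rho ^+ 2 / b ^+ 3.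
  by rewrite /h; field; rewrite !bu0.
apply: le_binv; have -> : rho ^+ 2 / b ^+ 3 * b = rho ^+ 2 / b ^+ 2 by field; rewrite !bu0.
rewrite ler_pdivrMr ?exprn_gt0 // mul1r; apply: (le_trans rho2).
by rewrite expr2 ler_peMr // ltW.
Qed.

(** The four derivatives moved to the test function beat the two powers of [lam]
    in the inverse of the duration. *)
Lemma pairing_rate : a / lam ^+ 4 <= 4 * P * (tau * b^-1).
Proof.
have := tau_hi; rewrite transfer_scale => H.
have H2 : b ^+ 3 / u ^+ 6 <= 4 * P * tau.
  have -> : b ^+ 3 / u ^+ 6 = (4 * P) * (4 * P * (u ^+ 6 / b ^+ 3))^-1.
    by field; rewrite !bu0.
  apply: ler_wpM2l; first by rewrite mulr_ge0 // ltW.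
  rewrite -[leRHS]invrK lef_pV2 // posrE ?invr_gt0 //.
  by rewrite !mulr_gt0 ?invr_gt0 ?exprn_gt0.
rewrite mulrA; apply: (@le_trans _ _ (b ^+ 3 / u ^+ 6 * b^-1)); last first.
  by rewrite ler_wpM2r // invr_ge0 ltW.
have -> : a / lam ^+ 4 = b ^+ 3 / u ^+ 6 * (u ^+ 3)^-1.
  by rewrite /a /lam; field; rewrite !bu0.
rewrite ler_wpM2l ?divr_ge0 ?exprn_ge0 // ?(ltW u0) ?(ltW b0) // lef_pV2 ?posrE ?exprn_gt0 //.
apply: (@le_trans _ _ u); first by have := bun (_ : (1 <= 10)%N); rewrite expr1; apply.
exact: u_pow.
Qed.

(** Lowering an exponent by [eps] gains enough to absorb all the powers of [b]
    that occur. *)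
Let powR_gain (V c e : R) : u <= V -> eps <= e -> V `^ (c - e) <= V `^ c / b ^+ 10.
Proof.
move=> uV ee; have V0 : 0 < V by exact: lt_le_trans uV.
rewrite powRD; last by apply/implyP => _; rewrite gt_eqF.
rewrite ler_wpM2l ?powR_ge0 // powRN lef_pV2 ?posrE ?exprn_gt0 ?powR_gt0 //.
apply: (le_trans bue); apply: (@le_trans _ _ (V `^ eps)).
  apply: (ge0_ler_powR (ltW eps0) _ _ uV); by rewrite nnegrE ltW.
by apply: ler_powR => //; exact: le_trans uV.
Qed.

Lemma besov_rate : (2 * h) `^ (3 * Num.max (3^-1 - eps) 0) * (a * (a ^+ 2 / N ^+ 3)) * tau
  <= 16 / P * b^-1.
Proof.
have hu : u <= 2 * h.
  have u3 : u <= u ^+ 3 := u_pow 2.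
  have : u ^+ 3 <= h by rewrite /h ler_peMl // exprn_ge0 // ltW.
  by move: u0 u3; lra.
have h0 : 0 < h by rewrite /h mulr_gt0 // exprn_gt0.
have G : (2 * h) `^ (3 * Num.max (3^-1 - eps) 0) <= 2 * h / b ^+ 10.
  have [s0|s0] := leP 0 (3^-1 - eps).
    have -> : 3 * (3^-1 - eps) = 1 - 3 * eps by field.
    rewrite -[X in X / _]powRr1; last by rewrite mulr_ge0 // ltW.
    by apply: powR_gain => //; move: eps0; lra.
  rewrite mulr0 powRr0 ler_pdivlMr ?exprn_gt0 // mul1r; exact: le_trans hu.
have X0 : 0 <= a * (a ^+ 2 / N ^+ 3).
  by rewrite /a energy_scale !mulr_ge0 ?invr_ge0 ?exprn_ge0 // ltW.
apply: (@le_trans _ _ (2 * h / b ^+ 10 * (a * (a ^+ 2 / N ^+ 3)) * tau)).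
  by rewrite ler_wpM2r ?(ltW tau0) // ler_wpM2r.
have -> : 16 / P * b^-1 = 8 / P * (2 * b^-1) by field; rewrite !bu0.
apply: mul_tau; first by rewrite mulr_ge0 // divr_ge0 ?exprn_ge0 ?mulr_ge0 // ltW.
have -> : 2 * h / b ^+ 10 * (a * (a ^+ 2 / N ^+ 3)) * (b ^+ 3 / u ^+ 6) = 2 * (rho / b ^+ 10).
  by rewrite energy_scale /h /a; field; rewrite !bu0.
rewrite ler_pM2l //; apply: le_binv.
have -> : rho / b ^+ 10 * b = rho / b ^+ 9 by field; rewrite !bu0.
rewrite ler_pdivrMr ?exprn_gt0 // mul1r; apply: (le_trans rho_b).
by have := @b_le 1 9 isT; rewrite expr1.
Qed.

Let a_ge_u : u <= a.
Proof.
apply: (le_trans (u_pow 2)); rewrite /a ler_peMr ?exprn_ege1 // exprn_ge0 //; exact: ltW.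
Qed.

Lemma intensity_rate (c e : R) : 1 <= c -> eps <= e ->
  (c * a) `^ (2 - e) * tau <= 8 * c ^+ 2 / P * b^-1.
Proof.
move=> c1 ee; have c0 : 0 < c by exact: lt_le_trans c1.
have a0 : 0 < a by exact: lt_le_trans a_ge_u.
have uV : u <= c * a by apply: (le_trans a_ge_u); rewrite ler_peMl // ltW.
apply: (@le_trans _ _ ((c * a) ^+ 2 / b ^+ 10 * tau)).
  rewrite ler_wpM2r ?(ltW tau0) //; apply: (le_trans (powR_gain _ uV ee)).
  by rewrite powR_mulrn // mulr_ge0 // ltW.
have -> : 8 * c ^+ 2 / P * b^-1 = 8 / P * (c ^+ 2 * b^-1) by field; rewrite !bu0.
apply: mul_tau; first by rewrite divr_ge0 ?exprn_ge0 ?mulr_ge0 // ltW.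
rewrite le_eqVlt; apply/orP; left; apply/eqP; rewrite /a; field; by rewrite !bu0.
Qed.

Lemma force_rate (c : R) : 1 <= c -> (c * u ^+ 3) `^ (2 - eps) * tau <= 8 * c ^+ 2 / P * b^-1.
Proof.
move=> c1; have c0 : 0 < c by exact: lt_le_trans c1.
have u3 : u <= u ^+ 3 := u_pow 2.
have uV : u <= c * u ^+ 3 by apply: (le_trans u3); rewrite ler_peMl // exprn_ge0 // ltW.
apply: (@le_trans _ _ ((c * u ^+ 3) ^+ 2 / b ^+ 10 * tau)).
  rewrite ler_wpM2r ?(ltW tau0) //; apply: (le_trans (powR_gain _ uV (lexx _))).
  by rewrite powR_mulrn // mulr_ge0 ?exprn_ge0 // ltW.
have -> : 8 * c ^+ 2 / P * b^-1 = 8 / P * (c ^+ 2 * b^-1) by field; rewrite !bu0.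
apply: mul_tau; first by rewrite divr_ge0 ?exprn_ge0 ?mulr_ge0 ?exprn_ge0 // ltW.
have -> : (c * u ^+ 3) ^+ 2 / b ^+ 10 * (b ^+ 3 / u ^+ 6) = c ^+ 2 / b ^+ 7 by field; rewrite !bu0.
rewrite ler_wpM2l ?sqr_ge0 // lef_pV2 ?posrE ?exprn_gt0 //.
by have := @b_le 1 7 isT; rewrite expr1.
Qed.

(** The contributions of the time derivative, of the Laplacian and of the
    convection are all at most of the order of [u^6 b^6], and the energy contributes
    the factor [b^(-6)]. *)
Lemma Hm1_scale (k1 k2 k3 D Cb c1 c2 c3 : R) : 0 <= k1 -> 0 <= k2 -> 0 <= k3 ->
  `|c1| <= Cb / tau -> `|c2| <= 1 -> `|c3| <= 1 ->
  Num.sqrt (3 * D ^+ 2 * (a ^+ 2 / N ^+ 3) * (k1 * c1 ^+ 2 / lam ^+ 2 + k2 * h ^+ 2 * c2 ^+ 2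
      + k3 * a ^+ 2 * c3 ^+ 2)) <=
  (1 + 3 * D ^+ 2 * (16 * k1 * Cb ^+ 2 * P ^+ 2 + k2 + k3)) * u ^+ 3.
Proof.
move=> k10 k20 k30 H1 H2 H3; set Q := 3 * D ^+ 2 * (16 * k1 * Cb ^+ 2 * P ^+ 2 + k2 + k3).
have D20 := sqr_ge0 D; have C20 := sqr_ge0 Cb; have P20 := sqr_ge0 P.
have M0 : 0 <= 16 * k1 * Cb ^+ 2 * P ^+ 2 by do 3!(apply: mulr_ge0 => //).
have Q0 : 0 <= Q by apply: mulr_ge0; [apply: mulr_ge0|do 2!(apply: addr_ge0 => //)].
have S0 : 0 <= (1 + Q) * u ^+ 3 by rewrite mulr_ge0 ?exprn_ge0 ?addr_ge0 // ltW.
rewrite -[leRHS](ger0_norm S0) -sqrtr_sqr; apply: ler_wsqrtr.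
have sq (c C : R) : `|c| <= C -> c ^+ 2 <= C ^+ 2.
  move=> H; rewrite -real_normK ?num_real // ler_pXn2r ?nnegrE //; exact: le_trans H.
have K2 : c2 ^+ 2 <= 1 by rewrite -(expr1n _ 2); exact: sq.
have K3 : c3 ^+ 2 <= 1 by rewrite -(expr1n _ 2); exact: sq.
pose w := u ^+ 6 * b ^+ 6.
have w0 : 0 <= w by rewrite /w mulr_ge0 ?exprn_ge0 // ltW.
have K1 : k1 * c1 ^+ 2 / lam ^+ 2 <= 16 * k1 * Cb ^+ 2 * P ^+ 2 * w.
  have Ti : (tau^-1) ^+ 2 <= (4 * P * (u ^+ 6 / b ^+ 3)) ^+ 2.
    rewrite ler_pXn2r ?nnegrE ?invr_ge0 ?(ltW tau0) // -?transfer_scale //.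
    by apply: le_trans tau_hi; rewrite invr_ge0 ltW.
  have l0 : 0 <= k1 / lam ^+ 2 by rewrite divr_ge0 ?sqr_ge0.
  have -> : k1 * c1 ^+ 2 / lam ^+ 2 = k1 / lam ^+ 2 * c1 ^+ 2 by rewrite mulrAC.
  apply: (le_trans (ler_wpM2l l0 (sq _ _ H1))).
  have -> : k1 / lam ^+ 2 * (Cb / tau) ^+ 2 = k1 / lam ^+ 2 * Cb ^+ 2 * (tau^-1) ^+ 2.
    by rewrite (exprMn _ Cb) mulrA.
  apply: (le_trans (ler_wpM2l (mulr_ge0 l0 C20) Ti)).
  have -> : k1 / lam ^+ 2 * Cb ^+ 2 * (4 * P * (u ^+ 6 / b ^+ 3)) ^+ 2 =
     16 * k1 * Cb ^+ 2 * P ^+ 2 * (u ^+ 6 * b ^- 6).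
    by rewrite /lam; field; rewrite !bu0.
  apply: ler_wpM2l => //; apply: ler_wpM2l; first by rewrite exprn_ge0 // ltW.
  apply: (@le_trans _ _ 1); last exact: exprn_ege1.
  by rewrite invf_le1 ?exprn_gt0 // exprn_ege1.
have K4 : h ^+ 2 <= w.
  have -> : h ^+ 2 = u ^+ 6 * rho ^+ 2 by rewrite /h; ring.
  rewrite ler_wpM2l ?exprn_ge0 ?(ltW u0) //; apply: (le_trans rho2).
  by have := @b_le 1 6 isT; rewrite expr1.
have K5 : a ^+ 2 = w by rewrite /a /w; ring.
have L2 : k2 * h ^+ 2 * c2 ^+ 2 <= k2 * w.
  rewrite -mulrA; apply: ler_wpM2l => //; apply: le_trans K4.
  by rewrite ler_piMr ?sqr_ge0.
have L3 : k3 * a ^+ 2 * c3 ^+ 2 <= k3 * w.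
  by rewrite -mulrA; apply: ler_wpM2l => //; rewrite K5 ler_piMr.
apply: (@le_trans _ _ (Q * u ^+ 6)).
  have -> : Q * u ^+ 6 = 3 * D ^+ 2 * b ^- 6 * (16 * k1 * Cb ^+ 2 * P ^+ 2 * w + k2 * w + k3 * w).
    by rewrite /Q /w; field; rewrite !bu0.
  rewrite energy_scale; apply: ler_wpM2l; last by apply: lerD => //; exact: lerD.
  apply: mulr_ge0; first exact: (mulr_ge0 (ler0n _ _) D20).
  by rewrite invr_ge0 exprn_ge0 // ltW.
have -> : ((1 + Q) * u ^+ 3) ^+ 2 = (1 + Q) ^+ 2 * u ^+ 6 by ring.
by rewrite ler_wpM2r ?exprn_ge0 ?(ltW u0) //; nra.
Qed.

Lemma flux_rate_bottom : a * (a ^+ 2 / N ^+ 3) * h * (N / lam) * tau <= 8 / P * b^-1.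
Proof.
apply: mul_tau.
  by rewrite energy_scale /h /N /lam /a !mulr_ge0 ?invr_ge0 ?exprn_ge0 ?mulr_ge0 ?exprn_ge0 // ltW.
have -> : a * (a ^+ 2 / N ^+ 3) * h * (N / lam) * (b ^+ 3 / u ^+ 6) = rho * b ^+ 4 / u.
  by rewrite energy_scale /h /N /lam /a; field; rewrite !bu0.
apply: le_binv; rewrite mulrAC ler_pdivrMr // mul1r -mulrA -exprSr.
apply: le_trans (bun (_ : (6 <= 10)%N)) => //.
by rewrite [leRHS]exprS ler_wpM2r // exprn_ge0 // ltW.
Qed.

Lemma flux_rate_top : a * (a ^+ 2 / N ^+ 3) * h * (N / h + lam ^+ 2 / h ^+ 2) * tau
  <= 8 / P * (b^-1 + rho^-1).
Proof.
rewrite mulrDr mulrDl mulrDr; apply: lerD.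
  apply: le_trans flux_rate_bottom; rewrite ler_wpM2r ?(ltW tau0) //.
  apply: ler_wpM2l; first by rewrite energy_scale /h /a !mulr_ge0 ?invr_ge0 ?exprn_ge0 ?mulr_ge0 ?exprn_ge0 // ltW.
  apply: ler_wpM2l; first by rewrite /N !mulr_ge0 ?exprn_ge0 // ltW.
  by rewrite lef_pV2 ?posrE /h /lam ?mulr_gt0 ?exprn_gt0 // ler_peMl // exprn_ge0 // ltW.
apply: mul_tau.
  by rewrite energy_scale /h /lam /a !mulr_ge0 ?invr_ge0 ?exprn_ge0 ?mulr_ge0 ?exprn_ge0 // ltW.
rewrite le_eqVlt; apply/orP; left; apply/eqP.
by rewrite energy_scale /h /lam /a; field; rewrite !bu0.
Qed.

End rates.

(** * The sequence of blocks *)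

Section construction.
Context {R : realType} {d : nat}.
Variables (r n0 : nat).
Hypotheses (r10 : (10 <= r)%N) (n0r : (20 * r <= n0)%N).

Let m n := (n + n0)%N.
(** With [m = n + n0] and [b = 2^(m^2)], the parameters below are [lam = b^(3 r)],
    [N = b^(2 r + 4)] and [a = b^(3 r + 3)].  The exponents are quadratic in [m] so
    that the ratio [2^(3 r (2 m + 1))] of consecutive frequencies tends to infinity
    and is nevertheless negligible against [b]. *)
Definition low_level n : nat := (3 * r * m n ^ 2)%N.
Definition box_size n : nat := (2 ^ ((2 * r + 4) * m n ^ 2))%N.
Definition intensity n : R := 2 ^+ ((3 * r + 3) * m n ^ 2).
Definition block n : 'rV[R]_d.+3 -> 'rV[R]_d.+3 :=
  cflow (box_size n) (2 ^ low_level n) (2 ^ low_level n.+1) (intensity n).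
Definition block_transfer n : R :=
  @transfer R d (box_size n) (2 ^ low_level n) (2 ^ low_level n.+1) (intensity n).
(** Normalises the flux of every pulse between its two clusters. *)
Definition duration n : R := (block_transfer n)^-1.

Let b n : R := 2 ^+ (m n ^ 2).
Let u n : R := b n ^+ r.
Let rho n : R := 2 ^+ (3 * r * (2 * m n + 1)).

Let two_pow i j : (i <= j)%N -> 2 ^+ i <= 2 ^+ j :> R.
Proof. by move=> ij; rewrite ler_weXn2l // ler1n. Qed.

Let m_ge n : (20 * r <= m n)%N. Proof. by rewrite (leq_trans n0r) // leq_addl. Qed.
Let m_gt0 n : (0 < m n)%N. Proof. by apply: leq_trans (m_ge n); rewrite muln_gt0 (leq_trans _ r10). Qed.

Let b1 n : 1 <= b n. Proof. by rewrite exprn_ege1 // ler1n. Qed.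
Let bu n : b n ^+ 10 <= u n. Proof. by rewrite ler_weXn2l. Qed.
Let rho1 n : 1 <= rho n. Proof. by rewrite exprn_ege1 // ler1n. Qed.

Let rho2 n : rho n ^+ 2 <= b n.
Proof.
rewrite -exprM; apply: two_pow.
have := m_ge n; have := m_gt0 n; rewrite -mulnn; move: (m n) => k k0 kr.
have : (20 * r * k <= k * k)%N by rewrite leq_mul2r kr orbT.
have : (r <= r * k)%N by rewrite leq_pmulr.
by lia.
Qed.

Let lamE n : (2 ^ low_level n)%:R = u n ^+ 3 :> R.
Proof. by rewrite natrX /u /b -!exprM; congr (_ ^+ _); rewrite /low_level; lia. Qed.

Let hE n : (2 ^ low_level n.+1)%:R = rho n * u n ^+ 3 :> R.
Proof.
rewrite natrX /u /b /rho -!exprM -exprD; congr (_ ^+ _); rewrite /low_level /m addSn.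
by rewrite -!mulnn; nia.
Qed.

Let NE n : (box_size n)%:R = u n ^+ 2 * b n ^+ 4 :> R.
Proof. by rewrite natrX /u /b -!exprM -exprD; congr (_ ^+ _); lia. Qed.

Let aE n : intensity n = u n ^+ 3 * b n ^+ 3.
Proof. by rewrite /intensity /u /b -!exprM -exprD; congr (_ ^+ _); lia. Qed.

Let N0 n : (0 < box_size n)%N. Proof. by rewrite expn_gt0. Qed.
Let a0 n : 0 < intensity n. Proof. by rewrite exprn_gt0. Qed.
Let levels n : (low_level n < low_level n.+1)%N.
Proof.
rewrite /low_level ltn_pmul2l ?muln_gt0 ?(leq_trans _ r10) //.
by rewrite ltn_sqr /m addSn.
Qed.
Let Nlam n : (4 * box_size n <= 2 ^ low_level n)%N.
Proof.
rewrite /box_size /low_level -[4%N]/(2 ^ 2)%N -expnD leq_pexp2l //.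
have : (0 < m n ^ 2)%N by rewrite expn_gt0 m_gt0.
by move: (m n ^ 2)%N r10 => k; nia.
Qed.
Let lamh n : (2 * 2 ^ low_level n <= 2 ^ low_level n.+1)%N.
Proof. by rewrite -expnS leq_pexp2l // levels. Qed.

Let half_le i j : (i <= j)%N -> (2 ^+ j)^-1 <= 2^-1 ^+ i :> R.
Proof. by move=> ij; rewrite exprVn lef_pV2 ?posrE ?exprn_gt0 // two_pow. Qed.

Let binv n : (b n)^-1 <= 2^-1 ^+ n.
Proof. by apply: half_le; rewrite -mulnn; have := m_gt0 n; rewrite /m; nia. Qed.

Let binv0 n : (b n)^-1 <= 2^-1 ^+ n * (2 ^+ n0)^-1.
Proof.
rewrite -exprVn -exprD; apply: half_le; have := m_gt0 n; rewrite -mulnn -/(m n); move: (m n) => k; nia.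
Qed.

Let rhoinv n : (rho n)^-1 <= 2^-1 ^+ n.
Proof. by apply: half_le; have := r10; rewrite /m; nia. Qed.

Variable chi : 'rV[R]_d.+3 -> R.
Hypothesis hchi : LP_cutoff chi.
Variables (T eps : R).
Let P : R := (2 * pi) ^+ d.+3.
Let D : R := d.+3%:R.
Hypotheses (T0 : 0 < T) (eps02 : 0 < eps < 2) (reps : 10 <= r%:R * eps)
  (n0T : 256 / (P * T) <= 2 ^+ n0).

Let P0 : 0 < P. Proof. by rewrite exprn_gt0 // mulr_gt0 // pi_gt0. Qed.
Let D1 : 1 <= D. Proof. by rewrite ler1n. Qed.
Let P00 : 0 <= P. Proof. exact: ltW. Qed.
Let D00 : 0 <= D. Proof. exact: ltW. Qed.
Let eps0 : 0 < eps. Proof. by case/andP: eps02. Qed.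

Let bue n : b n ^+ 10 <= u n `^ eps.
Proof.
have b0 : 0 <= b n by rewrite (le_trans ler01).
rewrite /u -!powR_mulrn // -powRrM; exact: ler_powR.
Qed.

Let tr_bounds n : P / 8 * ((u n ^+ 3 * b n ^+ 3) ^+ 3 * u n ^+ 3 / (u n ^+ 2 * b n ^+ 4) ^+ 3) <=
  (duration n)^-1 <= 4 * P * ((u n ^+ 3 * b n ^+ 3) ^+ 3 * u n ^+ 3 / (u n ^+ 2 * b n ^+ 4) ^+ 3).
Proof.
have := transfer_bounds (R := R) (d := d) (N0 n) (Nlam n) (lamh n) (a0 n).
by rewrite -aE -lamE -NE /duration invrK.
Qed.

Let tr_lo n := proj1 (andP (tr_bounds n)).
Let tr_hi n := proj2 (andP (tr_bounds n)).

Let dur0 n : 0 < duration n.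
Proof.
rewrite -invr_gt0; apply: lt_le_trans (tr_lo n).
have b0 : 0 < b n by exact: lt_le_trans (b1 n).
have u0 : 0 < u n by rewrite exprn_gt0.
apply: mulr_gt0; first by rewrite divr_gt0.
by apply: divr_gt0; rewrite ?exprn_gt0 ?mulr_gt0 ?exprn_gt0.
Qed.

Let rate (X K : R) n : 0 <= K -> X <= K * (b n)^-1 -> X <= K * 2^-1 ^+ n.
Proof. by move=> K0 H; apply: (le_trans H); apply: ler_wpM2l => //; exact: binv. Qed.

Let k8 : 0 <= 8 / P. Proof. by rewrite divr_ge0 // ltW. Qed.

Lemma duration_small n : 0 < duration n <= T * 2^-1 ^+ n.+1 / 16.
Proof.
rewrite dur0 /=; apply: (le_trans (tau_rate P0 (b1 n) (bu n) (dur0 n) (tr_lo n))) => //.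
apply: (@le_trans _ _ (8 / P * (2^-1 ^+ n * (2 ^+ n0)^-1))).
  by apply: ler_wpM2l.
have n2 : (2 ^+ n0)^-1 <= P * T / 256.
  have -> : P * T / 256 = (256 / (P * T))^-1 by rewrite invf_div.
  have q0 : 0 < 256 / (P * T) by apply: divr_gt0; [exact: ltr0Sn|exact: mulr_gt0].
  by rewrite lef_pV2 // posrE exprn_gt0.
apply: (@le_trans _ _ (8 / P * (2^-1 ^+ n * (P * T / 256)))).
  by apply: ler_wpM2l => //; apply: ler_wpM2l => //; rewrite exprn_ge0.
rewrite le_eqVlt; apply/orP; left; apply/eqP; rewrite exprS; field.
by rewrite gt_eqF.
Qed.

Lemma tf_block n : tf_vec (block n). Proof. exact: tf_cflow. Qed.
Lemma div_free_block n : div_free (block n). Proof. exact: div_free_cflow. Qed.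

Let K := 20 * D * P + 80 * D ^+ 2 * P * (8 / P).
Let K1 : 0 <= 20 * D * P. Proof. by do 2!(apply: mulr_ge0 => //). Qed.
Let K2 : 0 <= 80 * D ^+ 2 * P.
Proof. by do 2!(apply: mulr_ge0 => //); exact: sqr_ge0. Qed.
Let K0 : 0 <= K. Proof. by rewrite addr_ge0 // mulr_ge0. Qed.

Let energy_le n : tint (fun x => sumsq (block n x)) <= 20 * D * P.
Proof.
apply: (le_trans (cflow_energy (N0 n) (Nlam n) (lamh n) (a0 n))).
rewrite -[leRHS]mulr1; apply: ler_wpM2l => //; rewrite NE aE.
apply: (le_trans (energy_rate (b1 n) (bu n))).
by rewrite invf_le1 //; exact: lt_le_trans (b1 n).
Qed.

Lemma block_energy n : tint (fun x => sumsq (block n x)) <= K * 2^-1 ^+ n.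
Proof.
apply: (le_trans (cflow_energy (N0 n) (Nlam n) (lamh n) (a0 n))).
rewrite NE aE; apply: rate K0 _; apply: (@le_trans _ _ (20 * D * P * (b n)^-1)).
  by apply: ler_wpM2l => //; exact: energy_rate (b1 n) (bu n).
apply: ler_wpM2r; first by rewrite invr_ge0 (le_trans ler01).
by rewrite lerDl mulr_ge0.
Qed.

Lemma block_enstrophy n : tint (fun x => sumsq (gradient (block n) x)) * duration n <= K * 2^-1 ^+ n.
Proof.
apply: rate K0 _.
apply: (@le_trans _ _ (80 * D ^+ 2 * P * ((rho n * u n ^+ 3) ^+ 2 * ((u n ^+ 3 * b n ^+ 3) ^+ 2 / (u n ^+ 2 * b n ^+ 4) ^+ 3) * duration n))).
  rewrite mulrA; apply: ler_wpM2r; first exact: ltW.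
  have := cflow_enstrophy (R := R) (d := d) (N0 n) (Nlam n) (lamh n) (a0 n).
  by rewrite -aE -NE -hE !mulrA.
apply: (@le_trans _ _ (80 * D ^+ 2 * P * (8 / P * (b n)^-1))).
  apply: ler_wpM2l => //.
  exact: (dissipation_rate P0 (b1 n) (bu n) (rho1 n) (rho2 n) (dur0 n) (tr_lo n)).
rewrite mulrA; apply: ler_wpM2r; first by rewrite invr_ge0 (le_trans ler01).
by rewrite lerDr.
Qed.

Lemma block_pairing i phi : test_function phi -> exists C, forall n,
  `|tint (fun x => block n x 0 i * phi x)| <= C * (duration n * 2^-1 ^+ n).
Proof.
move=> tphi.
have tl (g : 'rV[R]_d.+3 -> R) : test_function g -> test_function (fun x => \sum_j partial j (partial j g) x).
  by move=> tg; apply: tf_sum => j _; do 2!apply: tf_partial.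
have [B B0 HB] := torus_cont_bounded (tf_torus_cont (tl _ (tl _ tphi))).
exists (20 * (P * B) * (4 * P)) => n.
apply: (le_trans (cflow_pairing (N0 n) (Nlam n) (levels n) (a0 n) i tphi B0 HB)).
have k0 : 0 <= 20 * (P * B) by do 2!(apply: mulr_ge0 => //); exact: ltW.
have -> : 20 * intensity n * (P * B / (2 ^ low_level n)%:R ^+ 4) =
   20 * (P * B) * (intensity n / (2 ^ low_level n)%:R ^+ 4) by ring.
rewrite lamE aE -[leRHS]mulrA; apply: ler_wpM2l => //.
apply: (le_trans (pairing_rate P0 (b1 n) (bu n) (dur0 n) (tr_hi n))).
apply: ler_wpM2l; first by rewrite mulr_ge0 // ltW.
by apply: ler_wpM2l; [exact: ltW|exact: binv].
Qed.

Lemma block_flux : exists2 dl : nat -> R, dl @ \oo --> (0 : R) & forall n,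
  [/\ forall q, (q < low_level n)%N || (low_level n.+1 < q)%N -> flux chi q (block n) = 0,
      forall q, (low_level n < q)%N -> (q < low_level n.+1)%N ->
        duration n * flux chi q (block n) = -1,
      `|duration n * flux chi (low_level n) (block n) + 1| <= dl n &
      `|duration n * flux chi (low_level n.+1) (block n)| <= dl n].
Proof.
have [C C0 HC] := LP_low_lipschitz hchi.
have C00 : 0 <= C by exact: ltW.
pose A := 1000 * D ^+ 2 * P; pose Cs := A * (8 / P * (16 * C)).
have A0 : 0 <= A.
  exact: (mulr_ge0 (mulr_ge0 (ler0n _ _) (sqr_ge0 D)) P00).
have tr_dur n : duration n * block_transfer n = 1.
  have := dur0 n; rewrite /duration invr_gt0 => t0.
  by rewrite mulVf // gt_eqF.
have dn n : 0 <= duration n by exact: ltW.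
exists (fun n => Cs * 2^-1 ^+ n).
  rewrite -[X in _ --> X](mulr0 Cs); apply: cvgM; first exact: cvg_cst.
  by apply: cvg_expr; rewrite ger0_norm //; lra.
move=> n; have x0 : 0 <= 2^-1 ^+ n :> R by rewrite exprn_ge0.
split.
- move=> q /orP[ql|ql].
    by rewrite /block (flux_small hchi (intensity n) (N0 n) (Nlam n) (levels n) ql).
  by rewrite /block (flux_large hchi (intensity n) (N0 n) (Nlam n) (levels n) ql).
- move=> q ql qh; rewrite /block (flux_mid hchi (intensity n) (N0 n) (Nlam n) (levels n) ql qh).
  by rewrite mulrN tr_dur.
- have -> : duration n * flux chi (low_level n) (block n) + 1 =
     duration n * (flux chi (low_level n) (block n) + block_transfer n).
    by rewrite mulrDr tr_dur.
  rewrite normrM ger0_norm //.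
  apply: (le_trans (ler_wpM2l (dn n) (flux_bottom hchi (N0 n) (Nlam n) (levels n) (a0 n) C0 HC))).
  have B := flux_rate_bottom P0 (b1 n) (bu n) (rho1 n) (rho2 n) (dur0 n) (tr_lo n).
  rewrite -aE -NE -hE -lamE in B; rewrite -/P -/D -/A.
  have -> : duration n * (A * (intensity n * (intensity n ^+ 2 / (box_size n)%:R ^+ 3) * (2 ^ low_level n.+1)%:R *
      (6 * C * ((box_size n)%:R / (2 ^ low_level n)%:R)))) =
    A * ((intensity n * (intensity n ^+ 2 / (box_size n)%:R ^+ 3) * (2 ^ low_level n.+1)%:R *
      ((box_size n)%:R / (2 ^ low_level n)%:R) * duration n) * (6 * C)) by ring.
  rewrite /Cs -[leRHS]mulrA; apply: (ler_wpM2l A0).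
  apply: (le_trans (ler_wpM2r (_ : 0 <= 6 * C) B)); first by apply: mulr_ge0.
  rewrite -[leLHS]mulrA -[leRHS]mulrA; apply: (ler_wpM2l k8).
  rewrite [leLHS]mulrC; apply: ler_pM => //; [exact: mulr_ge0|by rewrite invr_ge0 (le_trans ler01)|].
  by move: C00; lra.
- rewrite normrM ger0_norm //.
  apply: (le_trans (ler_wpM2l (dn n) (flux_top hchi (N0 n) (Nlam n) (levels n) (a0 n) C0 HC))).
  have B := flux_rate_top P0 (b1 n) (bu n) (rho1 n) (rho2 n) (dur0 n) (tr_lo n).
  rewrite -aE -NE -hE -lamE in B; rewrite -/P -/D -/A.
  have -> : duration n * (A * (intensity n * (intensity n ^+ 2 / (box_size n)%:R ^+ 3) * (2 ^ low_level n.+1)%:R *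
      (4 * C * ((box_size n)%:R / (2 ^ low_level n.+1)%:R + (2 ^ low_level n)%:R ^+ 2 / (2 ^ low_level n.+1)%:R ^+ 2)))) =
    A * ((intensity n * (intensity n ^+ 2 / (box_size n)%:R ^+ 3) * (2 ^ low_level n.+1)%:R *
      ((box_size n)%:R / (2 ^ low_level n.+1)%:R + (2 ^ low_level n)%:R ^+ 2 / (2 ^ low_level n.+1)%:R ^+ 2)
      * duration n) * (4 * C)) by ring.
  rewrite /Cs -[leRHS]mulrA; apply: (ler_wpM2l A0).
  apply: (le_trans (ler_wpM2r (_ : 0 <= 4 * C) B)); first by apply: mulr_ge0.
  rewrite -[leLHS]mulrA -[leRHS]mulrA; apply: (ler_wpM2l k8).
  have h1 := binv n; have h2 := rhoinv n.
  apply: (@le_trans _ _ ((2 * 2^-1 ^+ n) * (4 * C))).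
    by apply: ler_wpM2r; [exact: mulr_ge0|move: h1 h2; lra].
  have -> : 2 * 2^-1 ^+ n * (4 * C) = 8 * C * 2^-1 ^+ n by ring.
  by apply: ler_wpM2r => //; move: C00; lra.
Qed.

Lemma blocks_besov : in_LpX T 3%:E (besov3_norm chi (3^-1 - eps)) (velocity chi T duration block).
Proof.
pose X n : R := 400 * D ^+ 2 * P * intensity n * (intensity n ^+ 2 / (box_size n)%:R ^+ 3).
pose Y n := 4 * (2 * (2 ^ low_level n.+1)%:R) `^ (Num.max (3^-1 - eps) 0) * X n `^ 3^-1.
have s2 : -2 <= 3^-1 - eps by case/andP: eps02; lra.
have D2 : 0 <= 400 * D ^+ 2 * P.
  exact: (mulr_ge0 (mulr_ge0 (ler0n _ _) (sqr_ge0 D)) P00).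
pose Kb := 64 * (400 * D ^+ 2 * P) * (16 / P).
have Kb0 : 0 <= Kb.
  exact: (mulr_ge0 (mulr_ge0 (ler0n _ _) D2) (divr_ge0 (ler0n _ _) P00)).
have NZ n c : besov3_norm chi (3^-1 - eps) (fun x => c *: block n x) =
    (`|c|%:E * besov3_norm chi (3^-1 - eps) (block n))%E.
  by apply: (besov3_normZ hchi); exact: tf_block.
have Nq n : (0 <= besov3_norm chi (3^-1 - eps) (block n))%E.
  apply: (@le_trans _ _ ((2 `^ (0%:~R * (3^-1 - eps)))%:E * Lp_norm 3%:E (LP_block chi 0 (block n)))%E).
    by rewrite mule_ge0 ?lee_fin ?powR_ge0 // Lp_norm_ge0.
  by apply: ereal_sup_ubound; exists 0.
have p3 : 0 < 3 :> R by [].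
apply: (velocity_in_LpX hchi T0 duration_small NZ Nq p3 (Y := Y) (K := Kb)).
- move=> n; exact: (cflow_besov hchi (N0 n) (Nlam n) (levels n) (a0 n) s2).
- move=> n; apply: rate => //.
  have X0 : 0 <= X n.
    rewrite /X -mulrA; apply: mulr_ge0 => //; apply: mulr_ge0; first exact: ltW.
    by apply: divr_ge0; apply: exprn_ge0 => //; exact: ltW.
  have -> : Y n `^ 3 = 64 * ((2 * (2 ^ low_level n.+1)%:R) `^ (3 * Num.max (3^-1 - eps) 0) * X n).
    rewrite /Y powRM ?powR_ge0 ?mulr_ge0 ?powR_ge0 // powRM ?powR_ge0 //.
    rewrite -!powRrM mulVf // powRr1 // [_ * 3]mulrC.
    have -> : (4 : R) `^ 3 = 64 by rewrite powR_mulrn // -natrX.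
    by rewrite mulrA.
  have B := besov_rate eps0 P0 (b1 n) (bu n) (bue n) (rho1 n) (rho2 n) (dur0 n) (tr_lo n).
  rewrite -aE -NE -hE in B.
  have -> : 64 * ((2 * (2 ^ low_level n.+1)%:R) `^ (3 * Num.max (3^-1 - eps) 0) * X n) * duration n =
    64 * (400 * D ^+ 2 * P) * ((2 * (2 ^ low_level n.+1)%:R) `^ (3 * Num.max (3^-1 - eps) 0) *
      (intensity n * (intensity n ^+ 2 / (box_size n)%:R ^+ 3)) * duration n).
    rewrite /X; move: ((2 * (2 ^ low_level n.+1)%:R) `^ _) (400 * D ^+ 2 * P) (intensity n ^+ 2 / _) => x1 x2 x3.
    by ring.
  rewrite /Kb -[leRHS]mulrA; exact: (ler_wpM2l (mulr_ge0 (ler0n _ 64) D2) B).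
Qed.

Lemma blocks_force : in_LpX T (2 - eps)%:E (@Hm1_norm R d.+3) (force chi T duration block).
Proof.
have [Cb Cb0 HCb] := dtime_bump_bounded hchi.
have p0 : 0 < 2 - eps by case/andP: eps02; lra.
pose c := 1 + 3 * D ^+ 2 * (16 * 20 * Cb ^+ 2 * P ^+ 2 + 80 + 8000).
have Q0 : 0 <= 16 * 20 * Cb ^+ 2 * P ^+ 2 + 80 + 8000.
  apply: addr_ge0; last exact: ler0n.
  apply: addr_ge0; last exact: ler0n.
  exact: (mulr_ge0 (mulr_ge0 (mulr_ge0 (ler0n _ _) (ler0n _ _)) (sqr_ge0 Cb)) (sqr_ge0 P)).
have c1 : 1 <= c.
  rewrite /c lerDl; exact: (mulr_ge0 (mulr_ge0 (ler0n _ _) (sqr_ge0 D)) Q0).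
have K8 : 0 <= 8 * c ^+ 2 / P by exact: (divr_ge0 (mulr_ge0 (ler0n _ _) (sqr_ge0 c)) P00).
apply: (force_in_LpHm1 hchi T0 duration_small tf_block p0 (Y := fun n => c * u n ^+ 3)
  (K := 8 * c ^+ 2 / P)); last first.
  move=> n; apply: rate => //.
  exact: (force_rate eps0 P0 (b1 n) (bu n) (bue n) (dur0 n) (tr_lo n) c1).
move=> n t.
have pu : `|pulse chi T duration n t| <= 1.
  by have /andP[q0 q1] := pulse_itv hchi T duration n t; rewrite ger0_norm.
have dpu : `|dpulse chi T duration n t| <= Cb / duration n.
  rewrite normrM normfV (gtr0_norm (dur0 n)) mulrC; apply: ler_wpM2r => //.
  by rewrite invr_ge0 ltW.
have pu2 : `|pulse chi T duration n t ^+ 2| <= 1 by rewrite normrX exprn_ile1.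
apply: (le_trans (cflow_Hm1 (N0 n) (Nlam n) (levels n) (a0 n) _ _ _)).
rewrite lee_fin.
have H := Hm1_scale (b1 n) (bu n) (rho2 n) (dur0 n) (tr_hi n) D (ler0n _ 20) (ler0n _ 80) (ler0n _ 8000) dpu pu pu2.
by rewrite -aE -NE -hE -lamE in H; rewrite -/D lamE in H *.
Qed.

Let p_le_sup n x : enorm (block n x) <= 20 * D * intensity n.
Proof.
have := cflow_enorm_sup (R := R) (d := d) (N0 n) (Nlam n) (levels n) (a0 n) x.
by rewrite mulrCA mulrA.
Qed.

Let intensity_powers (e : R) : eps <= e -> forall n,
  (20 * D * intensity n) `^ (2 - e) * duration n <= 8 * (20 * D) ^+ 2 / P * 2^-1 ^+ n.
Proof.
move=> ee n; have c1 : 1 <= 20 * D.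
  by apply: (le_trans D1); rewrite ler_peMl // ler1n.
have K8 : 0 <= 8 * (20 * D) ^+ 2 / P.
  by exact: (divr_ge0 (mulr_ge0 (ler0n _ _) (sqr_ge0 _)) P00).
apply: rate => //; rewrite aE.
exact: (intensity_rate eps0 P0 (b1 n) (bu n) (bue n) (dur0 n) (tr_lo n) c1 ee).
Qed.

Let block_cont n : entries_cont (block n).
Proof. exact/entries_cont_vec/tf_block. Qed.

(** When [q <= 2] the bound of the energy is enough.  When [q > 2], interpolating
    between the energy and the supremum [a] leaves the sum of [a^((q - 2) p / q)]
    times the duration, and the condition on [p] and [q] says precisely that this
    exponent is [2 - eps p]. *)
Lemma blocks_LpLq (p q : \bar R) : (1 <= p)%E -> (1 <= q)%E ->
  (2%:E * p^-1 + 2%:E * q^-1 = (1 + eps)%:E)%E ->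
  in_LpX T p (Lp_norm q) (velocity chi T duration block).
Proof.
move=> p1 q1 pq.
have p0 : (0 < p)%E by exact: lt_le_trans p1.
have NZ n c : Lp_norm q (fun x => c *: block n x) = (`|c|%:E * Lp_norm q (block n))%E.
  by apply: Lp_normZ.
have Nq n : (0 <= Lp_norm q (block n))%E by exact: Lp_norm_ge0.
have S0 n : 0 <= 20 * D * intensity n.
  exact: (mulr_ge0 (mulr_ge0 (ler0n _ _) D00) (ltW (a0 n))).
have inve_fin (x : R) : 1 <= x -> (x%:E^-1 = (x^-1)%:E)%E.
  by move=> x1; rewrite inver gt_eqF // (lt_le_trans ltr01).
have inv_y : ((+oo : \bar R)^-1 = 0)%E by rewrite invey.
case: q q1 pq NZ Nq => [s| |] // q1 pq NZ Nq; last first.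
  case: p p1 pq p0 => [t| |] // p1 pq p0; last first.
    by move: pq; rewrite !inv_y !mule0 adde0 => -[]; move: eps0; lra.
  rewrite lee_fin in p1; have t0 : 0 < t by exact: lt_le_trans p1.
  have te : t = 2 - eps * t.
    move: pq; rewrite inv_y mule0 adde0 inve_fin // -EFinM => -[H].
    have : t * (2 / t) = t * (1 + eps) by rewrite H.
    by rewrite mulrCA divff ?gt_eqF // mulr1; lra.
  apply: (velocity_in_LpX hchi T0 duration_small NZ Nq t0 (Y := fun n => 20 * D * intensity n)
    (K := 8 * (20 * D) ^+ 2 / P)) => n; first exact: Lp_normy_le.
  rewrite {1}te; apply: intensity_powers; rewrite ler_peMr // ltW //.
rewrite lee_fin in q1; have s0 : 0 < s by exact: lt_le_trans q1.
have [s2|s2] := leP s 2.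
  apply: (@velocity_in_LpX_bounded _ _ chi hchi T duration block T0 (Lp_norm s%:E) NZ Nq p ((P + 20 * D * P) `^ s^-1) p0) => n.
  by apply: Lp_norm_low => //; rewrite q1.
case: p p1 pq p0 => [t| |] // p1 pq p0; last first.
  move: pq; rewrite inv_y mule0 add0e inve_fin // -EFinM => -[H].
  have : s * (2 / s) = s * (1 + eps) by rewrite H.
  rewrite mulrCA divff ?gt_eqF // mulr1; move: eps0 s2; nra.
rewrite lee_fin in p1; have t0 : 0 < t by exact: lt_le_trans p1.
have ts : (s - 2) * (s^-1 * t) = 2 - eps * t.
  move: pq; rewrite !inve_fin // -!EFinM -EFinD => -[H].
  have : s^-1 * t * 2 = t * (1 + eps) - 2.
    have -> : 1 + eps = 2 / t + 2 / s by [].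
    by field; rewrite !gt_eqF.
  have : s * (s^-1 * t) = t by rewrite mulrA divff ?gt_eqF // mul1r.
  rewrite mulrBl => -> h2; move: h2; move: (s^-1 * t) => x; lra.
pose E : R := 20 * D * P.
apply: (velocity_in_LpX hchi T0 duration_small NZ Nq t0
  (Y := fun n => ((20 * D * intensity n) `^ (s - 2) * E) `^ s^-1)
  (K := E `^ (s^-1 * t) * (8 * (20 * D) ^+ 2 / P))) => n.
  by apply: Lp_norm_interp => //; exact: ltW.
rewrite -powRrM powRM ?powR_ge0 // -powRrM ts mulrAC [leLHS]mulrC -[leRHS]mulrA.
apply: ler_wpM2l; first exact: powR_ge0.
by apply: intensity_powers; rewrite ler_peMr // ltW.
Qed.

Lemma blocks_L2 : in_LpX T +oo%E (Lp_norm 2%:E) (velocity chi T duration block).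
Proof.
have h12 : (1 <= 2%:E :> \bar R)%E by rewrite lee_fin ler1n.
have NZ n c : Lp_norm 2%:E (fun x => c *: block n x) = (`|c|%:E * Lp_norm 2%:E (block n))%E.
  exact: Lp_normZ.
have Nq n : (0 <= Lp_norm 2%:E (block n))%E by exact: Lp_norm_ge0.
apply: (@velocity_in_LpX_bounded _ _ chi hchi T duration block T0 (Lp_norm 2%:E) NZ Nq +oo%E (Num.sqrt (20 * D * P)) (ltry 0)) => n.
by rewrite Lp_norm2E // lee_fin ler_wsqrtr.
Qed.

End construction.

(** * Anomalous dissipation with energy equality *)

Theorem theorem1p6 (R : realType) (d : nat) (T eps : R)
  (chi : 'rV[R]_d -> R) :
  (3 <= d)%N -> 0 < T -> 0 < eps < 2 -> LP_cutoff chi ->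
  exists u f : R -> 'rV[R]_d -> 'rV[R]_d,
    [/\ class_N T u f,
        energy_equality T u f,
        exists2 l : R, 0 < l &
          (fun q : nat =>
             `|\int[lebesgue_measure]_(t in `]T / 2, T[) flux chi q (u t)|)
            @ \oo --> l &
        [/\ in_LpX T 3%:E (besov3_norm chi (3^-1 - eps)) u,
            forall p q : \bar R, (1 <= p)%E -> (1 <= q)%E ->
              (2%:E * p^-1 + 2%:E * q^-1 = (1 + eps)%:E)%E ->
              in_LpX T p (Lp_norm q) u &
            in_LpX T (2 - eps)%:E (@Hm1_norm R d) f]].
Proof.
case: d chi => [|[|[|d]]] chi // _ T0 eps02 hchi.
have /andP[eps0 _] := eps02.
have P0 : (0 : R) < (2 * pi) ^+ d.+3 by rewrite exprn_gt0 // mulr_gt0 // pi_gt0.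
(* This r makes b^10 <= lam^(eps / 3) and the n0 below makes the pulses fit into
   their cells. *)
pose r := (10 + Num.bound (10 / eps))%N.
have r10 : (10 <= r)%N by exact: leq_addr.
have reps : 10 <= r%:R * eps.
  rewrite -ler_pdivrMr //; apply: le_trans (ltW (archi_boundP _)) _.
    by rewrite divr_ge0 // ltW.
  by rewrite ler_nat leq_addl.
pose n0 := (20 * r + Num.bound (256 / ((2 * pi) ^+ d.+3 * T)))%N.
have n0r : (20 * r <= n0)%N by exact: leq_addr.
have n0T : 256 / ((2 * pi) ^+ d.+3 * T) <= 2 ^+ n0.
  have q0 : 0 <= 256 / ((2 * pi) ^+ d.+3 * T).
    by apply: divr_ge0; [exact: ler0n|rewrite mulr_ge0 // ltW].
  apply: (le_trans (ltW (archi_boundP q0))); rewrite -natrX ler_nat.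
  by apply: leq_trans (ltnW (ltn_expl _ _)) => //; exact: leq_addl.
pose tau := duration (R := R) (d := d) r n0; pose U := block (R := R) (d := d) r n0.
have ts := duration_small (d := d) r10 n0r T0 n0T : forall n, 0 < tau n <= _.
have tU n : tf_vec (U n) by exact: tf_block.
have dU n : div_free (U n) by exact: div_free_block.
have EU := block_energy (R := R) (d := d) r10 n0r.
have GU := block_enstrophy (R := R) (d := d) r10 n0r.
have PU := block_pairing (R := R) (d := d) r10 n0r.
have [energy work] := pulses_energy hchi T0 ts tU dU EU GU.
exists (velocity chi T tau U), (force chi T tau U); split => //.
- split; first split.
  + exact: (velocity_smooth hchi T0 ts tU).
  + exact: (blocks_L2 r10 n0r hchi T0).
  + exact: (force_smooth hchi T0 ts tU).
  + exists (fun _ _ => 0) => [|t x]; last exact: (pulses_NSE hchi T0 ts tU dU).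
    by split => [|t _ j x //]; exact: smooth_on_cst.
  + exact: work.
  + split; first exact: (force_limit_start hchi U T0 ts).
    exact: (force_limit_end hchi T0 ts tU dU EU PU).
- have [dl dl0 F] := block_flux r10 n0r hchi.
  apply: (anomalous_flux hchi T0 ts tU (p_ := low_level r n0) (dl := dl)) => //.
  + by move=> n; rewrite /low_level ltn_pmul2l ?muln_gt0 ?(leq_trans _ r10) // ltn_sqr addSn.
  + by move=> n q; have [H _ _ _] := F n; exact: H.
  + by move=> n q; have [_ H _ _] := F n; exact: H.
  + by move=> n; have [] := F n.
  + by move=> n; have [] := F n.
- split.
  + exact: (blocks_besov r10 n0r hchi T0 eps02 reps n0T).
  + exact: (blocks_LpLq r10 n0r hchi T0 eps02 reps n0T).
  + exact: (blocks_force r10 n0r hchi T0 eps02 reps n0T).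
Qed.
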